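(* Let $\mathbf{B}^4$ be the open unit ball of $\mathbf{R}^4$. For every $x\in\mathbf{B}^4$ with $x\neq 0$ we have $$\mathcal{C}(x)=\mathcal{C}(x,\mathbf{n}_x),$$ where $\mathbf{n}_x=x/|x|$.
   Context: For $x\in\mathbf{B}^4$, $\mathcal{C}(x)$ denotes the smallest number such that $|\nabla U(x)|\le \mathcal{C}(x)\,|U|_\infty$ for every bounded real-valued harmonic function $U$ on $\mathbf{B}^4$, where $|U|_\infty=\sup_{y\in\mathbf{B}^4}|U(y)|$ and $|\cdot|$ on vectors is the Euclidean norm. For a unit vector $\mathbf{v}\in\mathbf{R}^4$, $\mathcal{C}(x,\mathbf{v})$ denotes the smallest number such that $|\langle\nabla U(x),\mathbf{v}\rangle|\le\mathcal{C}(x,\mathbf{v})\,|U|_\infty$ for every bounded real-valued harmonic function $U$ on $\mathbf{B}^4$. *)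

(* Defs.v *)
From mathcomp Require Import all_boot all_order all_algebra.
From mathcomp Require Import all_classical all_reals all_analysis.

Set Implicit Arguments.
Unset Strict Implicit.
Unset Printing Implicit Defensive.

Import Order.TTheory GRing.Theory Num.Theory.
Import numFieldNormedType.Exports.

Local Open Scope classical_set_scope.
Local Open Scope ring_scope.

Definition dotv (R : realType) (n : nat) (u v : 'rV[R]_n) : R :=
  \sum_(i < n) u 0 i * v 0 i.

(* The library norm [`|u|] on ['rV[R]_n] is the max norm, hence the separate
   Euclidean norm; both induce the same topology, so continuity and
   derivatives below are the usual ones. *)
Definition enorm (R : realType) (n : nat) (u : 'rV[R]_n) : R :=
  Num.sqrt (dotv u u).

Definition eball (R : realType) (n : nat) : set 'rV[R]_n :=
  [set x | enorm x < 1].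

Definition partial (R : realType) (n : nat) (i : 'I_n) (f : 'rV[R]_n -> R) :
    'rV[R]_n -> R :=
  fun x => 'D_(delta_mx 0 i) f x.

Definition grad (R : realType) (n : nat) (f : 'rV[R]_n -> R) (x : 'rV[R]_n) :
    'rV[R]_n :=
  \row_(i < n) partial i f x.

Definition laplacian (R : realType) (n : nat) (f : 'rV[R]_n -> R)
    (x : 'rV[R]_n) : R :=
  \sum_(i < n) partial i (partial i f) x.

(* C^k regularity; intended for open D, where only the values of f on D
   matter. *)
Fixpoint Ck_on (R : realType) (n : nat) (k : nat) (D : set 'rV[R]_n)
    (f : 'rV[R]_n -> R) : Prop :=
  (forall x, D x -> {for x, continuous f}) /\
  (if k is k'.+1 then
     forall i : 'I_n,
       (forall x, D x -> derivable f x (delta_mx 0 i)) /\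
       Ck_on k' D (partial i f)
   else True).

Definition harmonic_on (R : realType) (n : nat) (D : set 'rV[R]_n)
    (f : 'rV[R]_n -> R) : Prop :=
  Ck_on 2 D f /\ (forall x, D x -> laplacian f x = 0).

(* U is a total function, but only its restriction to the unit ball is
   constrained or used. *)
Definition bounded_harmonic (R : realType) (n : nat) (U : 'rV[R]_n -> R) :
    Prop :=
  harmonic_on (@eball R n) U /\ [bounded U y | y in @eball R n].

Definition supnorm (R : realType) (n : nat) (U : 'rV[R]_n -> R) : R :=
  sup [set `|U y| | y in @eball R n].

Definition grad_bounds (R : realType) (n : nat) (x : 'rV[R]_n) : set R :=
  [set c | forall U : 'rV[R]_n -> R, bounded_harmonic U ->
     enorm (grad U x) <= c * supnorm U].

Definition dir_grad_bounds (R : realType) (n : nat) (x v : 'rV[R]_n) : set R :=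
  [set c | forall U : 'rV[R]_n -> R, bounded_harmonic U ->
     `|dotv (grad U x) v| <= c * supnorm U].

Definition is_smallest (R : realType) (A : set R) (c : R) : Prop :=
  A c /\ lbound A c.

(* "C(x) = c" and "C(x, v) = c".  These are relations rather than functions
   defined by [inf], so that asserting a value includes that the smallest
   constant exists; it is then unique. *)
Definition gradient_constant (R : realType) (n : nat) (x : 'rV[R]_n) (c : R) :
    Prop :=
  is_smallest (grad_bounds x) c.

Definition directional_constant (R : realType) (n : nat) (x v : 'rV[R]_n)
    (c : R) : Prop :=
  is_smallest (dir_grad_bounds x v) c.

Definition radial_dir (R : realType) (n : nat) (x : 'rV[R]_n) : 'rV[R]_n :=
  (enorm x)^-1 *: x.

(* Main.v *)
Require Import Defs.
From mathcomp Require Import all_boot all_order all_algebra.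
From mathcomp Require Import all_classical all_reals all_analysis.
From mathcomp Require Import ring lra.

Set Implicit Arguments.
Unset Strict Implicit.
Unset Printing Implicit Defensive.

Import Order.TTheory GRing.Theory Num.Theory.
Import numFieldNormedType.Exports.

Local Open Scope classical_set_scope.
Local Open Scope ring_scope.

(** By the Poisson formula, [C(x, v)] is the mean over the sphere of
    [|K_v|], where [K_v] is the derivative along [v] of the Poisson kernel at [x];
    the Poisson integral of the sign of [K_v] is extremal. It remains to show
    that this mean is largest for [v = n_x]. Write [r = |x|], [q = r / 2],
    [b = sqrt (1 - q^2)], [p = 3 q - 4 q^3] and [v = c n_x + s e] with [e]
    orthogonal to [n_x]. The projective automorphism of the sphere with centre
    parameter [p] turns the mean into that of
    [|c b xi_0 + s xi_1| / ((1 + p xi_0) (1 - q xi_0)^3)], up to a factor depending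
    on [x] only. Integrating out all but the angle in the [(b xi_0, xi_1)]-plane
    leaves the mean of [|cos (t - a)| M t], where [a] is the angle of [(c, s)], and
    [M t + M (t + pi)] is a nondecreasing function of [|cos t|]; the rearrangement
    inequality then gives the maximum at [a = 0].

    Means over the sphere are taken with respect to a finitely additive mean:
    that the Poisson kernel has mean 1 in Hopf coordinates follows from integration
    by parts, and the Poisson formula from the maximum principle. *)

(** * Finitely additive means *)

(** At the point [2 q n] the zero sets of the kernels [K_v], for all [v] in the plane of [n] and
    [e], are hyperplane sections of the sphere through the one point [p n]; this is the origin of
    [p]. The automorphism preserves the sphere and hyperplanes and carries the centre of the ball to
    [p n], so in the new coordinates every [K_v] is a linear form times a weight independent of [v].
    Since [|cos (t - a)|] has period [pi], only the sum of [M] at antipodal angles matters. No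
    Jacobian is ever computed. A weighted parametrisation of the sphere serves as soon as the
    Poisson kernel has mean 1 at every interior point: this identity alone yields the Poisson
    formula and both bounds on [C(x, v)]. It is proved once in Hopf coordinates, by rotation
    invariance, and is carried over to the projective coordinates by the Poisson formula itself,
    applied to a Newton potential with pole outside the ball. The first Hopf circle is parametrised
    through an ellipse, so that [(b xi_0, xi_1)] becomes proportional to a uniformly moving point of
    a circle. *)

Section Mean.
Context {R : realType}.

Definition bounded_fct (I : Type) (f : I -> R) : Prop :=
  exists M : R, forall i, `|f i| <= M.

Lemma bounded_cst (I : Type) (c : R) : bounded_fct (fun _ : I => c).
Proof. by exists `|c|. Qed.

Lemma boundedD (I : Type) (f g : I -> R) :
  bounded_fct f -> bounded_fct g -> bounded_fct (fun i => f i + g i).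
Proof.
move=> [M fM] [N gN]; exists (M + N) => i.
by apply: le_trans (ler_normD _ _) _; rewrite lerD.
Qed.

Lemma boundedM (I : Type) (f g : I -> R) :
  bounded_fct f -> bounded_fct g -> bounded_fct (fun i => f i * g i).
Proof.
move=> [M fM] [N gN]; exists (M * N) => i.
by rewrite normrM ler_pM.
Qed.

Lemma boundedN (I : Type) (f : I -> R) :
  bounded_fct f -> bounded_fct (fun i => - f i).
Proof. by move=> [M fM]; exists M => i; rewrite normrN. Qed.

Lemma boundedB (I : Type) (f g : I -> R) :
  bounded_fct f -> bounded_fct g -> bounded_fct (fun i => f i - g i).
Proof. by move=> bf /boundedN; apply: boundedD. Qed.

Lemma bounded_norm (I : Type) (f : I -> R) :
  bounded_fct f -> bounded_fct (fun i => `|f i|).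
Proof. by move=> [M fM]; exists M => i; rewrite normr_id. Qed.

Lemma bounded_sum (I : Type) n (f : 'I_n -> I -> R) :
  (forall j, bounded_fct (f j)) -> bounded_fct (fun i => \sum_(j < n) f j i).
Proof.
move=> bf; have /choice[M fM] := bf.
exists (\sum_(j < n) M j) => i.
by apply: le_trans (ler_norm_sum _ _ _) _; apply: ler_sum => j _.
Qed.

(** A positive normalised linear functional on bounded functions. Limits pass through it only by
    bounds uniform in the argument, and for those finite additivity and positivity suffice. *)
Record is_mean (I : Type) (E : (I -> R) -> R) : Prop := IsMean {
  meanD : forall f g, bounded_fct f -> bounded_fct g ->
    E (fun i => f i + g i) = E f + E g;
  meanZ : forall c f, bounded_fct f -> E (fun i => c * f i) = c * E f;
  mean_cst : forall c, E (fun=> c) = c;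
  mean_ge0 : forall f, bounded_fct f -> (forall i, 0 <= f i) -> 0 <= E f }.

Section MeanTheory.
Context {I : Type} {E : (I -> R) -> R} (mE : is_mean E).

Lemma eq_mean f g : (forall i, f i = g i) -> E f = E g.
Proof. by move=> fg; congr E; apply/funext. Qed.

Lemma meanN f : bounded_fct f -> E (fun i => - f i) = - E f.
Proof.
move=> bf; rewrite -mulN1r -(meanZ mE)//.
by apply: eq_mean => i; rewrite mulN1r.
Qed.

Lemma meanB f g : bounded_fct f -> bounded_fct g ->
  E (fun i => f i - g i) = E f - E g.
Proof. by move=> bf bg; rewrite (meanD mE) ?meanN//; exact: boundedN. Qed.

Lemma mean_sum n (f : 'I_n -> I -> R) : (forall j, bounded_fct (f j)) ->
  E (fun i => \sum_(j < n) f j i) = \sum_(j < n) E (f j).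
Proof.
elim: n f => [|n IH] f bf.
  rewrite big_ord0 -[RHS](mean_cst mE); apply: eq_mean => i.
  by rewrite big_ord0.
rewrite big_ord_recr /= -IH//.
rewrite -(meanD mE)//; last exact: bounded_sum.
by apply: eq_mean => i; rewrite big_ord_recr.
Qed.

Lemma le_mean f g : bounded_fct f -> bounded_fct g ->
  (forall i, f i <= g i) -> E f <= E g.
Proof.
move=> bf bg fg; rewrite -subr_ge0 -meanB//; apply: (mean_ge0 mE).
  exact: boundedB.
by move=> i; rewrite subr_ge0.
Qed.

Lemma norm_mean_le f g : bounded_fct g ->
  (forall i, `|f i| <= g i) -> `|E f| <= E g.
Proof.
move=> bg fg.
have bf : bounded_fct f.
  by case: bg => M gM; exists M => i; rewrite (le_trans (fg i))// (le_trans (ler_norm _)).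
rewrite ler_norml; apply/andP; split.
  rewrite -meanN//; apply: le_mean => //; first exact: boundedN.
  by move=> i; have := fg i; rewrite ler_norml => /andP[].
by apply: le_mean => // i; have := fg i; rewrite ler_norml => /andP[].
Qed.

Lemma norm_mean_le_cst f M : (forall i, `|f i| <= M) -> `|E f| <= M.
Proof.
move=> fM; rewrite -[M](mean_cst mE); apply: norm_mean_le => //.
exact: bounded_cst.
Qed.

End MeanTheory.

(** The order of the two means is fixed: ultrafilter limits obey no Fubini theorem. Later
    computations only differentiate in one variable under the means over the inner ones. *)
Lemma is_mean_prod (I J : Type) (E : (I -> R) -> R) (F : (J -> R) -> R) :
  is_mean E -> is_mean F ->
  is_mean (fun f : I * J -> R => E (fun i => F (fun j => f (i, j)))).
Proof.
move=> mE mF.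
have bs (f : I * J -> R) i : bounded_fct f -> bounded_fct (fun j => f (i, j)).
  by case=> M fM; exists M.
have bF (f : I * J -> R) : bounded_fct f ->
    bounded_fct (fun i => F (fun j => f (i, j))).
  by case=> M fM; exists M => i; apply: (norm_mean_le_cst mF).
split.
- move=> f g bf bg; rewrite -(meanD mE); [|exact: bF..].
  by apply: eq_mean => i; rewrite (meanD mF)//; exact: bs.
- move=> c f bf; rewrite -(meanZ mE); [|exact: bF].
  by apply: eq_mean => i; rewrite (meanZ mF)//; exact: bs.
- move=> c; rewrite -[RHS](mean_cst mE); apply: eq_mean => i.
  exact: (mean_cst mF).
- move=> f bf f0; apply: (mean_ge0 mE); first exact: bF.
  by move=> i; apply: (mean_ge0 mF) => //; exact: bs.
Qed.

End Mean.

(** * The uniform mean of the unit interval *)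

Section GridMean.
Context {R : realType}.

Definition unitI : Type := {u : R | 0 <= u <= 1}.

Lemma unitI_subproof (u : R) : 0 <= Num.min (Num.max u 0) 1 <= 1.
Proof. by rewrite le_min le_max lexx orbT ler01 ge_min lexx orbT. Qed.

Definition to_unitI (u : R) : unitI :=
  exist (fun u : R => is_true (0 <= u <= 1)) _ (unitI_subproof u).

Lemma to_unitIE (u : R) : 0 <= u <= 1 -> sval (to_unitI u) = u.
Proof.
by move=> /andP[u0 u1] /=; rewrite (max_idPl u0) (min_idPl u1).
Qed.

Definition nat_ultra : set_system nat := sval (cid (ultraFilterLemma eventually_filter)).

#[local] Instance nat_ultra_ultra : UltraFilter nat_ultra.
Proof. by rewrite /nat_ultra; case: cid => F []. Qed.

Lemma nat_ultra_eventually : nat_ultra --> \oo.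
Proof. by rewrite /nat_ultra; case: cid => F []. Qed.

Lemma fmap_ultra (T : Type) (u : nat -> T) : UltraFilter (u @ nat_ultra).
Proof.
split=> [|G GF sG]; first exact: fmap_proper_filter.
rewrite eqEsubset; split => // A GA.
have [//|nA] := in_ultra_setVsetC (u @^-1` A) nat_ultra_ultra.
have /sG GnA : (u @ nat_ultra) (~` A) by [].
by have /filter_ex[? []] : G (A `&` ~` A) by exact: filterI.
Qed.

(** The image ultrafilter contains the segment [[- M, M]], and compactness gives it a limit. *)
Lemma nat_ultra_cvg (u : nat -> R) : bounded_fct u ->
  u @ nat_ultra --> lim (u @ nat_ultra).
Proof.
move=> [M uM]; apply/cvg_ex.
have := @segment_compact R (- M) M; rewrite compact_ultra => /(_ _ (fmap_ultra u)).
move=> H; have [|l [_ ul]] := H; last by exists l.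
apply: (@filterS _ nat_ultra _ setT) (filterT) => n _ /=.
by move: (uM n); rewrite ler_norml in_itv /=.
Qed.

Definition grid_avg (f : unitI -> R) (N : nat) : R :=
  (\sum_(j < N.+1) f (to_unitI (j%:R / N.+1%:R))) / N.+1%:R.

(* Taking the limit along an ultrafilter makes every bounded function, however
   irregular, integrable; no measurability is ever needed. *)
Definition unit_mean (f : unitI -> R) : R := lim (grid_avg f @ nat_ultra).

Lemma bounded_grid_avg f : bounded_fct f -> bounded_fct (grid_avg f).
Proof.
move=> [M fM]; exists M => N.
rewrite /grid_avg normrM normfV [`|N.+1%:R|]ger0_norm// ler_pdivrMr//.
apply: le_trans (ler_norm_sum _ _ _) _.
apply: le_trans (ler_sum _ (fun j _ => fM _)) _.
by rewrite sumr_const card_ord mulr_natr.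
Qed.

Lemma unit_mean_cvg f : bounded_fct f -> grid_avg f @ nat_ultra --> unit_mean f.
Proof. by move=> bf; apply: nat_ultra_cvg; exact: bounded_grid_avg. Qed.

Lemma unit_mean_is_mean : is_mean unit_mean.
Proof.
split.
- move=> f g bf bg; apply: cvg_lim => //.
  rewrite (_ : grid_avg _ = grid_avg f \+ grid_avg g); last first.
    by apply/funext => N; rewrite /grid_avg big_split mulrDl.
  by apply: cvgD; exact: unit_mean_cvg.
- move=> c f bf; apply: cvg_lim => //.
  rewrite (_ : grid_avg _ = c \*: grid_avg f); last first.
    by apply/funext => N /=; rewrite /grid_avg -mulr_sumr -mulrA.
  by apply: cvgZr; exact: unit_mean_cvg.
- move=> c; apply: cvg_lim => //.
  rewrite (_ : grid_avg _ = cst c); first exact: cvg_cst.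
  apply/funext => N; rewrite /grid_avg sumr_const card_ord -(mulr_natr c) mulfK//.
- move=> f bf f0; apply: limr_ge; first by apply/cvg_ex; eexists; exact: unit_mean_cvg.
  apply: (@filterS _ nat_ultra _ setT) (filterT) => N _.
  by rewrite /grid_avg divr_ge0// sumr_ge0.
Qed.

(** Telescoping over the grid: each of the [1 / h] steps contributes an error of at most [e * h].
    The hypothesis looks forward from [t] only, because the grid samples [g] at left endpoints. *)
Lemma unit_mean_derivative (G : R -> R) (g : unitI -> R) :
  (forall e, 0 < e -> exists2 d, 0 < d & forall (t : unitI) s,
     sval t <= s -> s <= 1 -> s - sval t < d ->
     `|G s - G (sval t) - (s - sval t) * g t| <= e * (s - sval t)) ->
  unit_mean g = G 1 - G 0.
Proof.
move=> Gg; apply: cvg_lim => //.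
(* For a derivative the averages converge in the ordinary sense, and the ultrafilter refines the
   filter at infinity. *)
suff H : grid_avg g @ \oo --> G 1 - G 0.
  apply: cvg_trans H; exact: cvg_app nat_ultra_eventually.
apply/cvgrPdist_le => e e0; have [d d0 H] := Gg e e0.
near=> N.
have hd : (N.+1%:R^-1 : R) < d by near: N; exact: (near_infty_natSinv_lt (PosNum d0)).
set h : R := N.+1%:R^-1 in hd.
have h0 : 0 < h by rewrite invr_gt0.
have step (j : 'I_N.+1) :
    `|G (j.+1%:R / N.+1%:R) - G (j%:R / N.+1%:R)
      - h * g (to_unitI (j%:R / N.+1%:R))| <= e * h.
  have Nn : (N.+1%:R : R) != 0 by [].
  have jj : 0 <= (j%:R / N.+1%:R : R) <= 1.
    by rewrite divr_ge0//= ler_pdivrMr// mul1r ler_nat ltnW.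
  have := H (to_unitI (j%:R / N.+1%:R)) (j.+1%:R / N.+1%:R).
  rewrite to_unitIE// -[j.+1%:R]natr1 mulrDl mul1r -/h [X in X - _ < d]addrC addrK.
  rewrite [X in _ <= e * X]addrC addKr [X in X * g _]addrC addKr.
  apply => //; first by rewrite lerDl ltW.
  rewrite /h -[X in _ + X]mul1r -mulrDl natr1 ler_pdivrMr// mul1r ler_nat.
  exact: ltn_ord.
rewrite (_ : G 1 - G 0 = \sum_(j < N.+1)
    (G (j.+1%:R / N.+1%:R) - G (j%:R / N.+1%:R))); last first.
  rewrite -(big_mkord xpredT (fun j => G (j.+1%:R / N.+1%:R) - G (j%:R / N.+1%:R))) telescope_sumr//.
  by rewrite mul0r divff.
rewrite /grid_avg mulr_suml -sumrB.
apply: le_trans (ler_norm_sum _ _ _) _.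
apply: (@le_trans _ _ (\sum_(j < N.+1) e * h)).
  by apply: ler_sum => j _; rewrite [g _ / _]mulrC; exact: step.
by rewrite sumr_const card_ord -[X in X <= _]mulr_natr -mulrA mulVf ?mulr1.
Unshelve. all: by end_near. Qed.

End GridMean.
Arguments unitI R : clear implicits.

(** * Families of functions with uniformly quadratic remainder *)

Section UniformDerivative.
Context {R : realType}.

(* [dk] is the derivative of the family [k] on [D], as a function of the
   increment [h], uniformly in the parameter [i]. *)
Definition unif_deriv (T : normedModType R) (I : Type) (D : set T)
    (k : T -> I -> R) (dk : T -> I -> T -> R) : Prop :=
  exists2 M : R, 0 <= M & forall y, D y -> forall i,
    [/\ forall t h, dk y i (t *: h) = t * dk y i h,
      `|k y i| <= M, forall h, `|dk y i h| <= M * `|h| &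
      forall z, D z -> `|k z i - k y i - dk y i (z - y)| <= M * `|z - y| ^+ 2].

Section Rules.
Context {T : normedModType R} {I : Type} {D : set T}.
Implicit Types (k l : T -> I -> R) (dk dl : T -> I -> T -> R).

(** At distance at most 1 the quadratic remainder is absorbed by the linear bound; at larger
    distance the bound on the values is enough. Hence no convexity or boundedness of [D] enters. *)
Lemma unif_deriv_lipschitz k dk : unif_deriv D k dk ->
  exists2 M : R, 0 <= M & forall y z i, D y -> D z ->
    `|k y i| <= M /\ `|k z i - k y i| <= M * `|z - y|.
Proof.
move=> [M M0 kM]; exists (2 * M); first by rewrite mulr_ge0.
move=> y z i Dy Dz; have [_ ky dky kzy] := kM y Dy i; have [_ kz _ _] := kM z Dz i.
split; first by rewrite (le_trans ky)// ler_peMl// ler1n.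
have [h1|/ltW h1] := leP `|z - y| 1.
  rewrite -[k z i - k y i](subrK (dk y i (z - y))).
  apply: le_trans (ler_normD _ _) _; rewrite mulrDl mul1r mulrDl lerD//.
  apply: le_trans (kzy _ Dz) _; rewrite ler_wpM2l// expr2 ler_piMr//.
apply: le_trans (ler_normB _ _) _; apply: (@le_trans _ _ (2 * M)).
  by rewrite mulrDl mul1r lerD.
by rewrite ler_peMr// mulr_ge0.
Qed.

Lemma eq_unif_deriv k dk l dl : unif_deriv D k dk ->
  (forall y i, D y -> k y i = l y i) ->
  (forall y i h, D y -> dk y i h = dl y i h) ->
  unif_deriv D l dl.
Proof.
move=> [M M0 kM] kl kdl; exists M => // y Dy i; have [kZ k1 k2 k3] := kM y Dy i; split.
- by move=> t h; rewrite -!kdl// kZ.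
- by rewrite -kl.
- by move=> h; rewrite -kdl.
- by move=> z Dz; rewrite -!kl// -kdl// k3.
Qed.

Lemma unif_deriv_cst (u : I -> R) : bounded_fct u ->
  unif_deriv D (fun _ i => u i) (fun _ _ _ => 0).
Proof.
move=> [M uM]; exists `|M| => // y Dy i; split.
- by move=> t h; rewrite mulr0.
- by rewrite (le_trans (uM i))// ler_norm.
- by move=> h; rewrite normr0 mulr_ge0.
- by move=> z Dz; rewrite subrr subr0 normr0 mulr_ge0// exprn_ge0.
Qed.

Lemma unif_derivD k dk l dl : unif_deriv D k dk -> unif_deriv D l dl ->
  unif_deriv D (fun y i => k y i + l y i) (fun y i h => dk y i h + dl y i h).
Proof.
move=> [M M0 kM] [N N0 lN];
exists (M + N); first exact: addr_ge0.
move=> y Dy i; have [kZ k1 k2 k3] := kM y Dy i; have [lZ l1 l2 l3] := lN y Dy i; split.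
- by move=> t h; rewrite kZ lZ mulrDr.
- by rewrite (le_trans (ler_normD _ _))// lerD.
- by move=> h; rewrite (le_trans (ler_normD _ _))// mulrDl lerD.
- move=> z Dz; rewrite mulrDl.
  apply: le_trans _ (lerD (k3 z Dz) (l3 z Dz)).
  rewrite (_ : _ - _ = k z i - k y i - dk y i (z - y) + (l z i - l y i - dl y i (z - y))); last by ring.
  exact: ler_normD.
Qed.

(** The remainder of a product is the remainder of each factor times the other factor, plus a cross
    term that is quadratic by the Lipschitz bound. *)
Lemma unif_derivM k dk l dl : unif_deriv D k dk -> unif_deriv D l dl ->
  unif_deriv D (fun y i => k y i * l y i)
    (fun y i h => dk y i h * l y i + k y i * dl y i h).
Proof.
move=> uk ul.
have [A A0 kA] := unif_deriv_lipschitz uk; have [B B0 lB] := unif_deriv_lipschitz ul.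
move: uk ul => [M M0 kM] [N N0 lN];
exists (A * B + (M * B + A * N) + (M * B + A * N + M * B)).
  by rewrite !(addr_ge0, mulr_ge0).
move=> y Dy i; have [kZ k1 k2 k3] := kM y Dy i; have [lZ l1 l2 l3] := lN y Dy i.
have [k4 _] := kA y y i Dy Dy; have [l4 _] := lB y y i Dy Dy; split.
- by move=> t h; rewrite kZ lZ; ring.
- rewrite normrM (le_trans (ler_pM _ _ k4 l4))//.
  by rewrite -addrA lerDl !(addr_ge0, mulr_ge0).
- move=> h; apply: le_trans (ler_normD _ _) _; rewrite !normrM.
  apply: (@le_trans _ _ (M * `|h| * B + A * (N * `|h|))).
    by rewrite lerD// ler_pM.
  rewrite (_ : _ + _ = (M * B + A * N) * `|h|); last by ring.
  by rewrite ler_wpM2r// -addrA [X in _ <= X]addrCA lerDl !(addr_ge0, mulr_ge0).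
- move=> z Dz; have [k5 k6] := kA y z i Dy Dz; have [l5 l6] := lB y z i Dy Dz.
  have [l7 _] := lB z z i Dz Dz.
  rewrite (_ : _ - _ = (k z i - k y i - dk y i (z - y)) * l z i +
    k y i * (l z i - l y i - dl y i (z - y)) +
    dk y i (z - y) * (l z i - l y i)); last by ring.
  apply: le_trans (ler_normD _ _) _.
  apply: le_trans (lerD (ler_normD _ _) (lexx _)) _; rewrite !normrM.
  apply: (@le_trans _ _ (M * `|z - y| ^+ 2 * B + A * (N * `|z - y| ^+ 2) +
      (M * `|z - y|) * (B * `|z - y|))).
    by rewrite !lerD// ler_pM// ?k3 ?l3 ?k2.
  rewrite (_ : _ + _ = (M * B + A * N + M * B) * `|z - y| ^+ 2); last by ring.
  by rewrite ler_wpM2r ?exprn_ge0// [X in _ <= X]addrC lerDl !(addr_ge0, mulr_ge0).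
Qed.

Lemma unif_derivZ (c : R) k dk : unif_deriv D k dk ->
  unif_deriv D (fun y i => c * k y i) (fun y i h => c * dk y i h).
Proof.
move=> uk; have uc := unif_deriv_cst (bounded_cst I c).
by apply: eq_unif_deriv (unif_derivM uc uk) _ _ => // y i h _; rewrite mul0r add0r.
Qed.

Lemma unif_derivN k dk : unif_deriv D k dk ->
  unif_deriv D (fun y i => - k y i) (fun y i h => - dk y i h).
Proof.
by move=> /(unif_derivZ (-1)) /eq_unif_deriv; apply => *; rewrite mulN1r.
Qed.

Lemma unif_derivB k dk l dl : unif_deriv D k dk -> unif_deriv D l dl ->
  unif_deriv D (fun y i => k y i - l y i) (fun y i h => dk y i h - dl y i h).
Proof. by move=> uk /unif_derivN; exact: unif_derivD. Qed.

(** The set [S] confines the inner family to where [f] is tame, for instance away from 0 for the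
    inverse and the square root. *)
Lemma unif_deriv_comp (S : set R) (f df : R -> R) (C : R) k dk :
  (forall a, S a -> `|f a| <= C /\ `|df a| <= C) ->
  (forall a b, S a -> S b -> `|f b - f a - df a * (b - a)| <= C * (b - a) ^+ 2) ->
  (forall y i, D y -> S (k y i)) -> unif_deriv D k dk ->
  unif_deriv D (fun y i => f (k y i)) (fun y i h => df (k y i) * dk y i h).
Proof.
move=> fC ff Sk uk; have [A A0 kA] := unif_deriv_lipschitz uk.
case: uk => [M M0 kM].
exists (`|C| + `|C| * M + (`|C| * A ^+ 2 + `|C| * M)).
  by rewrite !(addr_ge0, mulr_ge0).
have CC a : S a -> `|f a| <= `|C| /\ `|df a| <= `|C|.
  by move=> /fC[h1 h2]; rewrite !(le_trans h1, le_trans h2)// ler_norm.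
move=> y Dy i; have [kZ k1 k2 k3] := kM y Dy i; have [fk dfk] := CC _ (Sk y i Dy); split.
- by move=> t h; rewrite kZ; ring.
- by rewrite (le_trans fk)// -addrA lerDl !(addr_ge0, mulr_ge0).
- move=> h; rewrite normrM.
  apply: (@le_trans _ _ (`|C| * (M * `|h|))); first by rewrite ler_pM.
  by rewrite mulrA ler_wpM2r// -addrA addrCA lerDl !(addr_ge0, mulr_ge0).
- move=> z Dz; have [_ k6] := kA y z i Dy Dz.
  rewrite (_ : _ - _ = (f (k z i) - f (k y i) - df (k y i) * (k z i - k y i)) +
     df (k y i) * (k z i - k y i - dk y i (z - y))); last by ring.
  apply: le_trans (ler_normD _ _) _; rewrite normrM.
  apply: (@le_trans _ _ (`|C| * (A * `|z - y|) ^+ 2 + `|C| * (M * `|z - y| ^+ 2))).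
    rewrite lerD ?ler_pM ?k3//.
    apply: le_trans (ff _ _ (Sk y i Dy) (Sk z i Dz)) _.
    apply: (@le_trans _ _ (`|C| * (k z i - k y i) ^+ 2)).
      by rewrite ler_wpM2r ?sqr_ge0// ler_norm.
    rewrite ler_wpM2l// -[X in X <= _]real_normK ?num_real//.
    by rewrite lerXn2r ?nnegrE// mulr_ge0.
  rewrite (_ : _ + _ = (`|C| * A ^+ 2 + `|C| * M) * `|z - y| ^+ 2); last by ring.
  by rewrite ler_wpM2r ?exprn_ge0// [X in _ <= X]addrC lerDl !(addr_ge0, mulr_ge0).
Qed.

Lemma unif_deriv_reindex (J : Type) (g : J -> I) k dk : unif_deriv D k dk ->
  unif_deriv D (fun y j => k y (g j)) (fun y j => dk y (g j)).
Proof. by case=> M M0 kM; exists M => // y Dy j; exact: kM. Qed.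

(** Differentiation under the mean: all the bounds are uniform in the parameter, so each of them
    survives averaging over [j]. *)
Lemma unif_deriv_mean (J : Type) (F : (J -> R) -> R)
    (k : T -> I * J -> R) (dk : T -> I * J -> T -> R) : is_mean F ->
  unif_deriv D k dk ->
  unif_deriv D (fun y i => F (fun j => k y (i, j)))
    (fun y i h => F (fun j => dk y (i, j) h)).
Proof.
move=> mF [M M0 kM]; exists M => // y Dy i.
have b1 z : D z -> bounded_fct (fun j => k z (i, j)).
  by move=> Dz; exists M => j; have [] := kM z Dz (i, j).
have b2 h : bounded_fct (fun j => dk y (i, j) h).
  by exists (M * `|h|) => j; have [_ _ + _] := kM y Dy (i, j); exact.
split.
- move=> t h; rewrite -(meanZ mF)//; apply: eq_mean => j.
  by have [+ _ _ _] := kM y Dy (i, j); exact.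
- by apply: (norm_mean_le_cst mF) => j; have [] := kM y Dy (i, j).
- by move=> h; apply: (norm_mean_le_cst mF) => j; have [_ _ + _] := kM y Dy (i, j); exact.
- move=> z Dz.
  rewrite (_ : _ - _ = F (fun j => k z (i, j) - k y (i, j) - dk y (i, j) (z - y))).
    by apply: (norm_mean_le_cst mF) => j; have [_ _ _ +] := kM y Dy (i, j); exact.
  have [bz byy bd] := And3 (b1 _ Dz) (b1 _ Dy) (b2 (z - y)).
  by rewrite !(meanB mF)//; exact: boundedB.
Qed.

Lemma unif_deriv_continuous k dk y i : unif_deriv D k dk -> nbhs y D ->
  {for y, continuous (fun z => k z i)}.
Proof.
move=> uk Dy; have [M M0 kM] := unif_deriv_lipschitz uk.
have M1 : 0 < M + 1 by rewrite ltr_pwDr.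
apply/cvgrPdist_lt => e e0; near=> z.
have Dz : D z by near: z; exact: Dy.
have [_ h] := kM y z i (nbhs_singleton Dy) Dz.
rewrite distrC; apply: le_lt_trans h _.
apply: (@le_lt_trans _ _ ((M + 1) * `|z - y|)).
  by rewrite ler_wpM2r// lerDl.
rewrite mulrC -ltr_pdivlMr// [`|z - y|]distrC; near: z.
apply: (@cvgr_dist_lt _ _ _ _ _ id y); [exact: cvg_id|by rewrite divr_gt0].
Unshelve. all: by end_near. Qed.

Lemma unif_deriv_is_derive k dk y i v : unif_deriv D k dk -> nbhs y D ->
  is_derive y v (fun z => k z i) (dk y i v).
Proof.
move=> [M M0 kM] Dy.
have [kZ _ _ kq] := kM y (nbhs_singleton Dy) i.
suff H : (fun h => h^-1 *: (k (h *: v + y) i - k y i)) @ 0^' --> dk y i v.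
  by split; [apply/cvg_ex; eexists; exact: H | apply/cvg_lim].
have C0 : 0 < M * `|v| ^+ 2 + 1 by rewrite ltr_pwDr// mulr_ge0// exprn_ge0.
apply/cvgrPdist_le => e e0; near=> h.
have h0 : h != 0 by near: h; exact: nbhs_dnbhs_neq.
have Dh : D (h *: v + y).
  near: h; apply: nbhs_dnbhs; move: Dy.
  rewrite -{1}[y]add0r -{1}[0](scale0r v) => Dy.
  have : (fun h : R => h *: v + y) @ 0 --> 0 *: v + y.
    by apply: cvgD; [apply: cvgZr_tmp; exact: cvg_id|exact: cvg_cst].
  exact.
have := kq _ Dh; rewrite addrK kZ normrZ => H.
rewrite distrC (_ : _ - _ = h^-1 * (k (h *: v + y) i - k y i - h * dk y i v)); last first.
  by rewrite /GRing.scale /=; field.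
rewrite normrM normfV ler_pdivrMl ?normr_gt0//; apply: le_trans H _.
rewrite exprMn (_ : M * _ = `|h| * (`|h| * (M * `|v| ^+ 2))); last by ring.
rewrite ler_wpM2l//.
apply: (@le_trans _ _ (`|h| * (M * `|v| ^+ 2 + 1))).
  by rewrite ler_wpM2l// lerDl.
rewrite -ler_pdivlMr//; near: h.
by apply: dnbhs0_le; rewrite divr_gt0.
Unshelve. all: by end_near. Qed.

End Rules.
End UniformDerivative.

Section UniformDerivativeReal.
Context {R : realType}.

Lemma MVT_real (f df : R -> R) (a b : R) : (forall x : R, is_derive x (1 : R) f (df x)) ->
  exists2 c, `|c - a| <= `|b - a| & f b - f a = df c * (b - a).
Proof.
move=> fdf.
have cf : continuous f.
  by move=> x; apply/differentiable_continuous/derivable1_diffP; case: (fdf x).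
have [ab|/ltW ba] := leP a b.
  have [c cab fE] := MVT_segment ab (fun x _ => fdf x) (continuous_subspaceT cf).
  exists c => //; move: cab; rewrite in_itv /= => /andP[ac cb].
  by rewrite !ger0_norm ?subr_ge0// lerB.
have [c cab fE] := MVT_segment ba (fun x _ => fdf x) (continuous_subspaceT cf).
exists c; last by rewrite -opprB fE; ring.
move: cab; rewrite in_itv /= => /andP[bc ca].
by rewrite ![`|_ - a|]distrC !ger0_norm ?subr_ge0// lerB.
Qed.

(** The mean value theorem is applied twice; the constant 1 in place of [1 / 2] is good enough. *)
Lemma quadratic_remainder (f df ddf : R -> R) (a b : R) :
  (forall x : R, is_derive x (1 : R) f (df x)) -> (forall x : R, is_derive x (1 : R) df (ddf x)) ->
  (forall x, `|ddf x| <= 1) -> `|f b - f a - df a * (b - a)| <= 1 * (b - a) ^+ 2.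
Proof.
move=> fdf dfddf ddf1.
have [c ca ->] := MVT_real a b fdf; have [d _ e] := MVT_real a c dfddf.
rewrite -mulrBl e !normrM mul1r -[X in _ <= X]ger0_norm ?sqr_ge0// normrX expr2.
by rewrite ler_wpM2r// (le_trans _ ca)// ler_piMl.
Qed.

Section Rules.
Context {T : normedModType R} {I : Type} {D : set T}.
Implicit Types (k : T -> I -> R).

Lemma unif_deriv_inv (d : R) k dk : 0 < d ->
  (forall y i, D y -> d <= `|k y i|) -> unif_deriv D k dk ->
  unif_deriv D (fun y i => (k y i)^-1) (fun y i h => - (k y i)^-2 * dk y i h).
Proof.
move=> d0 dk0; apply: (@unif_deriv_comp _ _ _ _ [set a | d <= `|a|]
   (fun a => a^-1) (fun a => - a^-2) (d^-1 + d^-2 + d^-3)) => //=.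
- move=> a da; have a0 : 0 < `|a| by exact: lt_le_trans da.
  rewrite normrN !normfV normrX; split.
    by rewrite -addrA ler_wpDr// ?addr_ge0 ?invr_ge0 ?exprn_ge0 ?(ltW d0)// lef_pV2.
  rewrite -addrA ler_wpDl ?invr_ge0 ?(ltW d0)// ler_wpDr ?invr_ge0 ?exprn_ge0 ?(ltW d0)//.
  by rewrite lef_pV2 ?posrE ?exprn_gt0// lerXn2r ?nnegrE ?(ltW d0).
- move=> a b da db.
  have a0 : 0 < `|a| by exact: lt_le_trans da.
  have b0 : 0 < `|b| by exact: lt_le_trans db.
  have a1 : a != 0 by rewrite -normr_gt0.
  have b1 : b != 0 by rewrite -normr_gt0.
  (* The Taylor remainder of the inverse is an exact rational expression, so its bound is purely
     algebraic. *)
  rewrite (_ : _ - _ = (b * a ^+ 2)^-1 * (b - a) ^+ 2); last by field; rewrite a1 b1.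
  rewrite normrM [`|_ ^+ 2|]ger0_norm ?sqr_ge0// ler_wpM2r ?sqr_ge0//.
  rewrite ler_wpDl ?addr_ge0 ?invr_ge0 ?exprn_ge0 ?(ltW d0)//.
  rewrite normfV normrM normrX lef_pV2 ?posrE ?mulr_gt0 ?exprn_gt0//.
  rewrite exprS ler_pM ?exprn_ge0 ?(ltW d0)//.
  by rewrite lerXn2r ?nnegrE ?(ltW d0).
Qed.

Lemma unif_deriv_sqrt (d : R) k dk : 0 < d ->
  (forall y i, D y -> d <= k y i) -> unif_deriv D k dk ->
  unif_deriv D (fun y i => Num.sqrt (k y i))
    (fun y i h => (2 * Num.sqrt (k y i))^-1 * dk y i h).
Proof.
move=> d0 dk0 uk; have [M M0 kM] := unif_deriv_lipschitz uk.
pose s := Num.sqrt d; have s0 : 0 < s by rewrite sqrtr_gt0.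
apply: (@unif_deriv_comp _ _ _ _ [set a | d <= a <= M] Num.sqrt
   (fun a => (2 * Num.sqrt a)^-1) (Num.sqrt M + (2 * s)^-1 + s^-3)) => //=.
- move=> a /andP[da aM].
  have sa : s <= Num.sqrt a by rewrite ler_wsqrtr.
  rewrite normfV ger0_norm ?sqrtr_ge0// ger0_norm ?mulr_ge0 ?sqrtr_ge0//; split.
    by rewrite -addrA ler_wpDr ?addr_ge0 ?invr_ge0 ?mulr_ge0 ?exprn_ge0 ?(ltW s0)// ler_wsqrtr.
  rewrite -addrA ler_wpDl ?sqrtr_ge0// ler_wpDr ?invr_ge0 ?exprn_ge0 ?(ltW s0)//.
  by rewrite lef_pV2 ?posrE ?mulr_gt0// ?(lt_le_trans s0 sa)// ler_wpM2l.
- move=> a b /andP[da aM] /andP[db bM].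
  have sa : s <= Num.sqrt a by rewrite ler_wsqrtr.
  have sb : s <= Num.sqrt b by rewrite ler_wsqrtr.
  have a0 : 0 <= a by rewrite (le_trans (ltW d0)).
  have b0 : 0 <= b by rewrite (le_trans (ltW d0)).
  rewrite -{3 4}(sqr_sqrtr a0) -{2 3}(sqr_sqrtr b0).
  move: (Num.sqrt a) (Num.sqrt b) sa sb => x y sx sy.
  have x0 : 0 < x by exact: lt_le_trans sx.
  have y0 : 0 < y by exact: lt_le_trans sy.
  (* With [a = x ^+ 2] and [b = y ^+ 2] the remainder of the square root is rational too. *)
  rewrite (_ : _ - _ = - ((2 * x) * (y + x) ^+ 2)^-1 * (y ^+ 2 - x ^+ 2) ^+ 2); last first.
    by field; rewrite !gt_eqF// addr_gt0.
  rewrite normrM [`|_ ^+ 2|]ger0_norm ?sqr_ge0// ler_wpM2r ?sqr_ge0//.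
  rewrite ler_wpDl//; first by rewrite addr_ge0 ?sqrtr_ge0// invr_ge0 mulr_ge0// ltW.
  rewrite normrN normfV ger0_norm; last first.
    by apply: mulr_ge0; [rewrite mulr_ge0// ltW|exact: sqr_ge0].
  rewrite lef_pV2 ?posrE ?mulr_gt0 ?exprn_gt0 ?addr_gt0//.
  rewrite exprS ler_pM ?exprn_ge0 ?(ltW s0)//; first by lra.
  by rewrite lerXn2r ?nnegrE ?(ltW s0) ?addr_ge0 ?ltW//; lra.
- move=> y i Dy; rewrite dk0//=; have [+ _] := kM y y i Dy Dy.
  by rewrite ler_norml => /andP[].
Qed.

Lemma unif_deriv_sin k dk : unif_deriv D k dk ->
  unif_deriv D (fun y i => sin (k y i)) (fun y i h => cos (k y i) * dk y i h).
Proof.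
apply: (@unif_deriv_comp _ _ _ _ setT sin cos 1) => //.
- by move=> a _; rewrite !ler_norml sin_geN1 sin_le1 cos_geN1 cos_le1.
- by move=> a b _ _; apply: (@quadratic_remainder _ _ (fun x => - sin x)) => // x; rewrite normrN ler_norml sin_geN1 sin_le1.
Qed.

Lemma unif_deriv_cos k dk : unif_deriv D k dk ->
  unif_deriv D (fun y i => cos (k y i)) (fun y i h => - sin (k y i) * dk y i h).
Proof.
apply: (@unif_deriv_comp _ _ _ _ setT cos (fun x => - sin x) 1) => //.
- by move=> a _; rewrite normrN !ler_norml sin_geN1 sin_le1 cos_geN1 cos_le1.
- by move=> a b _ _; apply: (@quadratic_remainder _ _ (fun x => - cos x)) => // x; rewrite normrN ler_norml cos_geN1 cos_le1.
Qed.

End Rules.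

Lemma unif_deriv_id (I : Type) (D : set R^o) (M : R) :
  (forall t, D t -> `|t| <= M) ->
  unif_deriv D (fun t (_ : I) => t) (fun _ _ h => h).
Proof.
move=> DM; exists (`|M| + 1) => [|t Dt _]; first by rewrite addr_ge0.
split=> [//||h|z Dz].
- by rewrite (le_trans (DM _ Dt))// (le_trans (ler_norm _))// lerDl.
- by rewrite mulrDl mul1r lerDr mulr_ge0.
- by rewrite subrr normr0 mulr_ge0 ?addr_ge0// exprn_ge0.
Qed.

Definition unit_itv : set R^o := [set t | 0 <= t <= 1].

(** The fundamental theorem of calculus for the mean: homogeneity of [dk] extracts the increment,
    and [M * (s - t) ^+ 2] is below [e * (s - t)] as soon as [s - t < e / (M + 1)]. *)
Lemma unit_mean_unif_deriv (I : Type) (k : R^o -> I -> R) dk i :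
  unif_deriv unit_itv k dk ->
  unit_mean (fun u => dk (sval u) i 1) = k 1 i - k 0 i.
Proof.
move=> [M M0 kM]; apply: (unit_mean_derivative (G := k^~ i)) => e e0.
have M1 : 0 < M + 1 by rewrite ltr_pwDr.
exists (e / (M + 1)); first by rewrite divr_gt0.
move=> t s ts s1; rewrite ltr_pdivlMr// => st.
have /andP[t0 t1] := svalP t.
have Dt : unit_itv (sval t) by rewrite /unit_itv /= t0.
have Ds : unit_itv s by rewrite /unit_itv /= s1 (le_trans t0).
have [kZ _ _ kq] := kM _ Dt i.
have := kq _ Ds; rewrite -[s - sval t in X in `|X|]mulr1 (kZ (s - sval t) 1).
move=> /le_trans; apply; rewrite ger0_norm ?subr_ge0// expr2 mulrA.
rewrite ler_wpM2r ?subr_ge0//; apply: le_trans (ltW st).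
by rewrite mulrC ler_wpM2l ?subr_ge0// lerDl.
Qed.

End UniformDerivativeReal.

Lemma cvg_sum_ord (R : realType) (T : Type) (F : set_system T) {FF : Filter F}
    (n : nat) (f : 'I_n -> T -> R) (l : 'I_n -> R) :
  (forall i, f i x @[x --> F] --> l i) ->
  (\sum_(i < n) f i x) @[x --> F] --> \sum_(i < n) l i.
Proof.
elim: n f l => [|n IH] f l fl.
  rewrite big_ord0; under eq_fun do rewrite big_ord0; exact: cvg_cst.
rewrite big_ord_recr; under eq_fun do rewrite big_ord_recr.
by apply: cvgD => //=; exact: IH.
Qed.

(** * The Euclidean structure of row vectors *)

Section Euclid.
Context {R : realType} {n : nat}.
Implicit Types (u v w : 'rV[R]_n.+1).

Lemma dotvC u v : dotv u v = dotv v u.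
Proof. by apply: eq_bigr => i _; rewrite mulrC. Qed.

Lemma dotvDl u v w : dotv (u + v) w = dotv u w + dotv v w.
Proof. by rewrite -big_split; apply: eq_bigr => i _; rewrite mxE mulrDl. Qed.

Lemma dotvZl a u v : dotv (a *: u) v = a * dotv u v.
Proof. by rewrite mulr_sumr; apply: eq_bigr => i _; rewrite mxE mulrA. Qed.

Lemma dotvNl u v : dotv (- u) v = - dotv u v.
Proof. by rewrite -scaleN1r dotvZl mulN1r. Qed.

Lemma dotvBl u v w : dotv (u - v) w = dotv u w - dotv v w.
Proof. by rewrite dotvDl dotvNl. Qed.

Lemma dotvDr u v w : dotv u (v + w) = dotv u v + dotv u w.
Proof. by rewrite dotvC dotvDl !(dotvC u). Qed.

Lemma dotvZr a u v : dotv u (a *: v) = a * dotv u v.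
Proof. by rewrite dotvC dotvZl (dotvC u). Qed.

Lemma dotvNr u v : dotv u (- v) = - dotv u v.
Proof. by rewrite dotvC dotvNl dotvC. Qed.

Lemma dotvBr u v w : dotv u (v - w) = dotv u v - dotv u w.
Proof. by rewrite dotvDr dotvNr. Qed.

Lemma dotv_ge0 u : 0 <= dotv u u.
Proof. by apply: sumr_ge0 => i _; rewrite -expr2 sqr_ge0. Qed.

Lemma dotv_eq0 u : (dotv u u == 0) = (u == 0).
Proof.
apply/eqP/eqP => [|->]; last by rewrite -(scale0r 0) dotvZl mul0r.
move=> /eqP; rewrite psumr_eq0 => [/allP u0|i _]; last by rewrite -expr2 sqr_ge0.
apply/rowP => i; rewrite mxE; apply/eqP.
by have := u0 i (mem_index_enum i); rewrite /= -expr2 sqrf_eq0.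
Qed.

Lemma dotv_gt0 u : u != 0 -> 0 < dotv u u.
Proof. by rewrite lt0r dotv_ge0 andbT dotv_eq0. Qed.

Lemma cauchy_schwarz u v : dotv u v ^+ 2 <= dotv u u * dotv v v.
Proof.
have [->|v0] := eqVneq v 0.
  by rewrite -(scale0r 0) !dotvZr !mul0r expr0n mulr0.
have vv := dotv_gt0 v0.
have := dotv_ge0 (dotv v v *: u - dotv u v *: v).
rewrite dotvBl !dotvBr !dotvZl !dotvZr [dotv v u]dotvC.
rewrite (_ : _ - _ = dotv v v * (dotv u u * dotv v v - dotv u v ^+ 2)); last by ring.
by rewrite pmulr_rge0// subr_ge0.
Qed.

Lemma enorm_sqr u : enorm u ^+ 2 = dotv u u.
Proof. by rewrite sqr_sqrtr// dotv_ge0. Qed.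

Lemma enorm_ge0 u : 0 <= enorm u. Proof. exact: sqrtr_ge0. Qed.

Lemma eballE u : @eball R n.+1 u <-> dotv u u < 1.
Proof.
rewrite /eball /= -enorm_sqr; split => h.
  by rewrite expr_lt1// enorm_ge0.
by rewrite -(@expr_lt1 _ 2)// enorm_ge0.
Qed.

Lemma dotv_delta u i : dotv u (delta_mx 0 i) = u 0 i.
Proof.
rewrite /dotv (bigD1 i)//= mxE !eqxx mulr1 big1 ?addr0// => j ji.
by rewrite mxE (negbTE ji) andbF mulr0.
Qed.

Lemma norm_coord_le u i : `|u 0 i| <= `|u|.
Proof.
rewrite [`|u|]mx_normE; have := @le_bigmax _ _ _ 0%:nng (fun i => `|u i.1 i.2|%:nng) (0, i).
exact.
Qed.

Lemma norm_le_enorm u : `|u| ^+ 2 <= dotv u u.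
Proof.
have [->|u0] := eqVneq u 0; first by rewrite normr0 expr0n dotv_ge0.
have [[k i] e] : exists i, `|u| = `|u i.1 i.2|.
  by apply: mx_norm_neq0; move: u0; rewrite -normr_eq0.
rewrite e real_normK ?num_real//= (ord1 k) /dotv (bigD1 i)//= -expr2 lerDl sumr_ge0// => j _.
by rewrite -expr2 sqr_ge0.
Qed.

Lemma dotv_le_norm u v : `|dotv u v| <= n.+1%:R * (`|u| * `|v|).
Proof.
apply: le_trans (ler_norm_sum _ _ _) _.
apply: (@le_trans _ _ (\sum_(i < n.+1) `|u| * `|v|)).
  by apply: ler_sum => i _; rewrite normrM ler_pM ?norm_coord_le.
by rewrite sumr_const card_ord mulr_natl.
Qed.

Lemma continuous_dotv (f g : 'rV[R]_n.+1 -> 'rV[R]_n.+1) u :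
  {for u, continuous f} -> {for u, continuous g} ->
  {for u, continuous (fun v => dotv (f v) (g v))}.
Proof.
move=> cf cg; apply: (@cvg_sum_ord _ _ (nbhs u) (nbhs_filter u)) => i.
by apply: cvgM; [move/continuous_comp : cf|move/continuous_comp : cg];
  move=> /(_ _ (fun w : 'rV[R]_n.+1 => w 0 i)); apply; exact: coord_continuous.
Qed.

Lemma continuous_sqnorm u : {for u, continuous (fun v => dotv v v)}.
Proof. by apply: (@continuous_dotv id id); move=> ?. Qed.

Lemma nbhs_ball_sq (r : R) u : dotv u u < r -> nbhs u [set v | dotv v v < r].
Proof. by move=> ur; have := @continuous_sqnorm u; move=> /(_ [set x | x < r]); apply; exact: lt_nbhsl. Qed.

Lemma compact_ball_sq (r : R) : compact [set v : 'rV[R]_n.+1 | dotv v v <= r].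
Proof.
apply: bounded_closed_compact.
  exists (r + 1); split; first exact: num_real.
  move=> M rM v /= vr; have [h|h] := leP `|v| 1.
    have := dotv_ge0 v; lra.
  apply: (@le_trans _ _ (`|v| ^+ 2)); first by rewrite expr2 ler_peMr// ltW.
  by have := norm_le_enorm v; lra.
apply: (@closed_comp _ _ (fun v => dotv v v) [set x | x <= r]); last exact: closed_le.
by move=> v _; exact: continuous_sqnorm.
Qed.

End Euclid.

(** * The maximum principle *)

Section MaximumPrinciple.
Context {R : realType}.

Lemma is_derive_line (V : normedModType R) (f : V -> R) (y v : V) (t d : R) :
  is_derive (y + t *: v) v f d -> is_derive t (1 : R) (fun s => f (y + s *: v)) d.
Proof.
have e : (fun h : R => h^-1 *: (f (y + (h *: 1 + t) *: v) - f (y + t *: v)))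
   = (fun h => h^-1 *: (f (h *: v + (y + t *: v)) - f (y + t *: v))).
  apply/funext => h; congr (_ *: (f _ - _)).
  by rewrite scalerDl [h *: 1]mulr1 addrCA.
by move=> [df dE]; split; [move: df; rewrite /derivable|move: dE; rewrite /derive]; rewrite e.
Qed.

(** Second derivative test: the maximum forces [df 0 = 0], then [c > 0] makes [df] positive just to
    the right of 0, and the mean value theorem produces a value above [f 0]. *)
Lemma no_strict_max (f df : R -> R) (c d : R) : 0 < d -> 0 < c ->
  (forall t, `|t| < d -> is_derive t (1 : R) f (df t)) ->
  is_derive 0 (1 : R) df c -> (forall t, `|t| < d -> f t <= f 0) -> False.
Proof.
move=> d0 c0 fdf ddf fmax.
have in_d t : t \in `](- d), d[ -> `|t| < d.
  by rewrite in_itv /= ltr_norml.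
have df0 : df 0 = 0.
  have D0 : (0 : R) \in `](- d), d[ by rewrite in_itv /= oppr_lt0 d0.
  have N0 : `|0 : R| < d by rewrite normr0.
  have [_ <-] := fdf 0 N0.
  have [||||] := @derive1_at_max R f (- d) d 0 => //; first lra.
  - by move=> t /in_d /fdf[].
  - by move=> t /in_d; exact: fmax.
have [t0 t00 tpos] : exists2 t0, 0 < t0 < d & forall t, 0 < t <= t0 -> 0 < df t.
  case: ddf => ddf dE.
  have : (fun h => h^-1 *: (df (h *: 1 + 0) - df 0)) @ 0^' --> c.
    by rewrite -dE; exact: ddf.
  move=> /cvgrPdist_lt /(_ c c0)[e e0 he].
  exists (Num.min (e / 2) (d / 2)).
    by rewrite lt_min !divr_gt0//= gt_min; apply/orP; right; lra.
  move=> t /andP[t0]; rewrite le_min => /andP[te td].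
  have := he t; rewrite /ball /= sub0r normrN gtr0_norm//.
  have t0' : t != 0 by rewrite gt_eqF.
  have te' : t < e by have : 0 < e by []; lra.
  move=> /(_ te' t0'); rewrite df0 subr0 [t *: 1]mulr1 addr0.
  rewrite ltr_norml => /andP[_ h].
  have : 0 < t^-1 * df t by have : t^-1 *: df t = t^-1 * df t by []; lra.
  by rewrite pmulr_rgt0// invr_gt0.
have /andP[t0_gt0 t0d] := t00.
have sub x : 0 <= x <= t0 -> `|x| < d.
  by move=> /andP[x0 xt]; rewrite ger0_norm// (le_lt_trans xt).
have [||s s0 fE] := @MVT R f df 0 t0 t0_gt0.
- move=> x; rewrite in_itv /= => /andP[x0 xt]; apply: fdf; by apply: sub; rewrite !ltW.
- apply: derivable_within_continuous => x; rewrite in_itv /= => /sub /fdf[] //.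
move: s0; rewrite in_itv /= => /andP[s0 st].
have h0 : 0 <= t0 <= t0 by rewrite lexx ltW.
have := fmax t0 (sub _ h0); rewrite -subr_le0 fE subr0.
by rewrite pmulr_lle0// leNgt tpos// s0 ltW.
Qed.

Lemma is_derive_affine (a b t : R) :
  is_derive t (1 : R) (fun s => a + b * s) b.
Proof.
rewrite (_ : (fun s => _) = (cst a + b \*: id))//.
by apply: is_derive_eq; rewrite /GRing.scale /=; ring.
Qed.

Lemma is_derive_quad (a b c t : R) :
  is_derive t (1 : R) (fun s => a * (b + c * s + s ^+ 2)) (a * (c + 2 * t)).
Proof.
have d : is_derive t (1 : R) (fun s : R => b + c * s) c by exact: is_derive_affine.
have d2 : is_derive t (1 : R) (fun s : R => s ^+ 2) (2 * t).
  by apply: is_derive_eq; rewrite /GRing.scale /=; ring.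
exact: (is_deriveZ a (is_deriveD d d2)).
Qed.

Context {n : nat}.
Implicit Types (y : 'rV[R]_n.+1) (u : 'rV[R]_n.+1 -> R).

(** Boundary values are read off inside the ball, uniformly near the sphere, so that functions given
    by an integral formula valid only in the open ball qualify. *)
Definition has_zero_boundary_values u := forall e, 0 < e ->
  exists2 r : R, r < 1 & forall y, r < dotv y y < 1 -> `|u y| <= e.

(** Adding [(e / 2) * |y|^2] makes [u] strictly subharmonic: at an interior maximum some pure second
    derivative would be positive. The maximum is therefore on the boundary of a slightly smaller
    ball, where the perturbed function is at most [e]. *)
Lemma harmonic_le0 u (u1 u2 : 'I_n.+1 -> 'rV[R]_n.+1 -> R) :
  (forall y, dotv y y < 1 -> {for y, continuous u}) ->
  (forall y j, dotv y y < 1 -> is_derive y (delta_mx 0 j) u (u1 j y)) ->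
  (forall y j, dotv y y < 1 -> is_derive y (delta_mx 0 j) (u1 j) (u2 j y)) ->
  (forall y, dotv y y < 1 -> \sum_j u2 j y = 0) ->
  has_zero_boundary_values u -> forall y, dotv y y < 1 -> u y <= 0.
Proof.
move=> cu du1 du2 lap bv y0 y01.
apply/ler_addgt0Pr => e e0; rewrite add0r.
have e2 : 0 < e / 2 by rewrite divr_gt0.
have [r r1 hr] := bv (e / 2) e2.
(* The ball [|y|^2 <= s] is compact in the open unit ball, contains [y0], and has its boundary
   inside the layer where [|u| <= e / 2]. *)
have [s s1 [ys rs]] : exists2 s : R, s < 1 & dotv y0 y0 < s /\ r < s.
  have m1 : Num.max (dotv y0 y0) r < 1 by rewrite gt_max y01.
  by exists ((Num.max (dotv y0 y0) r + 1) / 2); [lra|split];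
    have := le_max (dotv y0 y0) (dotv y0 y0) r; have := le_max r (dotv y0 y0) r;
    rewrite !lexx ?orbT /= => /idP h1 /idP h2; lra.
pose v y := u y + (e / 2) * dotv y y.
have [||c cs cmax] := @EVT_max_rV R n.+1 v [set y | dotv y y <= s] _ (@compact_ball_sq _ _ s) _.
- by exists y0; exact: ltW.
- apply: continuous_in_subspaceT => y /set_mem /= yls.
  have cuy := cu y (le_lt_trans yls s1).
  apply: (cvgD cuy); apply: cvgM; first exact: cvg_cst.
  exact: continuous_sqnorm.
have y0s : y0 \in [set y | dotv y y <= s].
  by apply/mem_set; exact: ltW.
have {}cs : dotv c c <= s by move/set_mem: cs.
have v0 := cmax _ y0s.
have h0 : 0 <= (e / 2) * dotv y0 y0 by rewrite mulr_ge0 ?dotv_ge0// ltW.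
have uv : u y0 <= v y0 by rewrite lerDl.
have [cin|cout] := ltP (dotv c c) s; last first.
  have : `|u c| <= e / 2.
    apply: hr; apply/andP; split; last exact: le_lt_trans s1.
    exact: lt_le_trans cout.
  rewrite ler_norml => /andP[_ uc].
  have : (e / 2) * dotv c c <= (e / 2) * 1 by rewrite ler_wpM2l ?ltW// (le_lt_trans cs).
  by rewrite /v in v0 uv; lra.
exfalso.
have c1 : dotv c c < 1 by exact: lt_trans s1.
(* The perturbation contributes [e] to each pure second derivative, so these sum to a positive
   number. *)
have pos : exists j, 0 < u2 j c + e.
  apply: contrapT => /forallNP H.
  have : \sum_j (u2 j c + e) <= 0.
    by apply: sumr_le0 => j _; rewrite leNgt; apply/negP; exact: H.
  rewrite big_split /= lap// sumr_const card_ord add0r leNgt.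
  by rewrite mulrn_wgt0.
have [j pj] := pos.
pose dj : 'rV[R]_n.+1 := delta_mx 0 j.
have dd t : dotv (c + t *: dj) (c + t *: dj) = dotv c c + 2 * c 0 j * t + t ^+ 2.
  rewrite dotvDl !dotvDr !dotvZl !dotvZr [dotv dj c]dotvC !dotv_delta.
  by rewrite mxE !eqxx /=; ring.
have : nbhs c [set y | dotv y y < s] by exact: nbhs_ball_sq.
have ct : (fun t : R => c + t *: dj) @ 0 --> c.
  rewrite -{2}[c]addr0 -(scale0r dj); apply: cvgD; first exact: cvg_cst.
  by apply: cvgZr_tmp; exact: cvg_id.
move=> /ct [d d0 hd].
have {}hd t : `|t| < d -> dotv (c + t *: dj) (c + t *: dj) < s.
  by move=> td; apply: hd; rewrite /= sub0r normrN.
apply: (@no_strict_max (fun t => v (c + t *: dj))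
  (fun t => u1 j (c + t *: dj) + (e / 2) * (2 * c 0 j + 2 * t)) (u2 j c + e) d) => //.
- move=> t /hd ts.
  have t1 : dotv (c + t *: dj) (c + t *: dj) < 1 by exact: lt_trans s1.
  rewrite /v; under eq_fun do rewrite dd.
  apply: is_deriveD; first exact/is_derive_line/du1.
  exact: is_derive_quad.
- apply: is_deriveD; first by apply: is_derive_line; rewrite scale0r addr0; exact: du2.
  rewrite (_ : (fun x => _) = (fun x => e * c 0 j + e * x)); last first.
    by apply/funext => x; field.
  exact: is_derive_affine.
- move=> t /hd ts; rewrite scale0r addr0; apply: cmax.
  by apply/mem_set/ltW.
Qed.

Lemma harmonic_eq0 u (u1 u2 : 'I_n.+1 -> 'rV[R]_n.+1 -> R) :
  (forall y, dotv y y < 1 -> {for y, continuous u}) ->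
  (forall y j, dotv y y < 1 -> is_derive y (delta_mx 0 j) u (u1 j y)) ->
  (forall y j, dotv y y < 1 -> is_derive y (delta_mx 0 j) (u1 j) (u2 j y)) ->
  (forall y, dotv y y < 1 -> \sum_j u2 j y = 0) ->
  has_zero_boundary_values u -> forall y, dotv y y < 1 -> u y = 0.
Proof.
move=> cu du1 du2 lap bv y y1; apply/eqP; rewrite eq_le; apply/andP; split.
  exact: (harmonic_le0 cu du1 du2).
rewrite -oppr_le0; apply: (@harmonic_le0 (- u) (fun j => - u1 j) (fun j y => - u2 j y)) => //.
- by move=> z z1; exact: (cvgN (cu z z1)).
- by move=> z j z1; apply: is_deriveN; exact: du1.
- by move=> z j z1; apply: is_deriveN; exact: du2.
- by move=> z z1; rewrite sumrN lap// oppr0.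
- by move=> e /bv[r r1 h]; exists r => // z /h; rewrite normrN.
Qed.

End MaximumPrinciple.

(** * Smooth kernels *)

Section Kernels.
Context {R : realType} {n : nat}.
Local Notation T := 'rV[R]_n.+1.
Implicit Types (I : Type) (D : set T).

(** The derivative is stored by its coordinates, which are families of the same type and can be
    differentiated in turn. *)
Definition kernel_grad I D (K : T -> I -> R) (K1 : 'I_n.+1 -> T -> I -> R) :=
  unif_deriv D K (fun y i h => \sum_j K1 j y i * h 0 j).

Lemma eq_kernel_grad I D (K L : T -> I -> R) K1 L1 : kernel_grad D K K1 ->
  (forall y i, D y -> K y i = L y i) ->
  (forall j y i, D y -> K1 j y i = L1 j y i) -> kernel_grad D L L1.
Proof.
move=> /eq_unif_deriv H KL KL1; apply: H => // y i h Dy.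
by apply: eq_bigr => j _; rewrite KL1.
Qed.

Lemma kernel_grad_cst I D (u : I -> R) : bounded_fct u ->
  kernel_grad D (fun _ i => u i) (fun _ _ _ => 0).
Proof.
move=> /(unif_deriv_cst (D := D)) /eq_unif_deriv; apply => // y i h _.
by rewrite big1// => j _; rewrite mul0r.
Qed.

Lemma kernel_gradD I D (K L : T -> I -> R) K1 L1 :
  kernel_grad D K K1 -> kernel_grad D L L1 ->
  kernel_grad D (fun y i => K y i + L y i) (fun j y i => K1 j y i + L1 j y i).
Proof.
move=> uk ul; apply: eq_unif_deriv (unif_derivD uk ul) _ _ => // y i h _.
by rewrite -big_split; apply: eq_bigr => j _ /=; rewrite mulrDl.
Qed.

Lemma kernel_gradM I D (K L : T -> I -> R) K1 L1 :
  kernel_grad D K K1 -> kernel_grad D L L1 ->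
  kernel_grad D (fun y i => K y i * L y i)
    (fun j y i => K1 j y i * L y i + K y i * L1 j y i).
Proof.
move=> uk ul; apply: eq_unif_deriv (unif_derivM uk ul) _ _ => // y i h _.
rewrite mulr_suml mulr_sumr -big_split; apply: eq_bigr => j _ /=; ring.
Qed.

Lemma kernel_gradZ I D (c : R) (K : T -> I -> R) K1 : kernel_grad D K K1 ->
  kernel_grad D (fun y i => c * K y i) (fun j y i => c * K1 j y i).
Proof.
move=> uk; apply: eq_kernel_grad (kernel_gradM (kernel_grad_cst D (bounded_cst I c)) uk) _ _ => // j y i _.
by rewrite mul0r add0r.
Qed.

Lemma kernel_gradB I D (K L : T -> I -> R) K1 L1 :
  kernel_grad D K K1 -> kernel_grad D L L1 ->
  kernel_grad D (fun y i => K y i - L y i) (fun j y i => K1 j y i - L1 j y i).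
Proof.
move=> uk /(kernel_gradZ (-1)) ul.
by apply: eq_kernel_grad (kernel_gradD uk ul) _ _ => *; rewrite mulN1r.
Qed.

Lemma kernel_grad_coord I D (M : R) j : (forall y, D y -> `|y| <= M) ->
  kernel_grad D (fun y (_ : I) => y 0 j) (fun l _ _ => (l == j)%:R).
Proof.
move=> DM; have E (h : T) : \sum_l (l == j)%:R * h 0 l = h 0 j.
  rewrite (bigD1 j)//= eqxx mul1r big1 ?addr0// => l lj.
  by rewrite (negbTE lj) mul0r.
exists (`|M| + 1) => [|y Dy _]; first by rewrite addr_ge0.
split=> [t h||h|z Dz]; rewrite ?E.
- by rewrite mxE.
- rewrite (le_trans (norm_coord_le _ _))// (le_trans (DM _ Dy))//.
  by rewrite (le_trans (ler_norm _))// lerDl.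
- by rewrite mulrDl mul1r (le_trans (norm_coord_le _ _))// lerDr mulr_ge0.
- by rewrite !mxE subrr normr0 mulr_ge0 ?addr_ge0// exprn_ge0.
Qed.

Lemma kernel_grad_inv I D (d : R) (K : T -> I -> R) K1 : 0 < d ->
  (forall y i, D y -> d <= `|K y i|) -> kernel_grad D K K1 ->
  kernel_grad D (fun y i => (K y i)^-1) (fun j y i => - (K y i)^-2 * K1 j y i).
Proof.
move=> d0 Kd /(unif_deriv_inv d0 Kd) /eq_unif_deriv; apply => // y i h _.
by rewrite mulr_sumr; apply: eq_bigr => j _; rewrite mulrA.
Qed.

Lemma kernel_grad_bounded I D (K : T -> I -> R) K1 y : kernel_grad D K K1 ->
  D y -> bounded_fct (K y).
Proof. by move=> [M M0 KM] Dy; exists M => i; have [] := KM y Dy i. Qed.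

Lemma kernel_grad1_bounded I D (K : T -> I -> R) K1 j y : kernel_grad D K K1 ->
  D y -> bounded_fct (K1 j y).
Proof.
move=> [M M0 KM] Dy; exists (M * `|delta_mx 0 j : T|) => i.
have [_ _ + _] := KM y Dy i => /(_ (delta_mx 0 j)).
by rewrite -/(dotv (\row_j K1 j y i) _) /=; under eq_bigr do [];
  rewrite (_ : \sum_l _ = K1 j y i)// (bigD1 j)//= mxE !eqxx mulr1 big1 ?addr0// => l lj;
  rewrite mxE (negbTE lj) andbF mulr0.
Qed.

Lemma kernel_grad_mean I D (E : (I -> R) -> R) (u : I -> R) (K : T -> I -> R) K1 :
  is_mean E -> bounded_fct u -> kernel_grad D K K1 ->
  kernel_grad D (fun y (_ : unit) => E (fun i => K y i * u i))
    (fun j y _ => E (fun i => K1 j y i * u i)).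
Proof.
move=> mE bu uk.
have uKu := kernel_gradM uk (kernel_grad_cst D bu).
have := unif_deriv_mean mE (unif_deriv_reindex (fun p : unit * I => p.2) uKu).
move=> /eq_unif_deriv; apply => // y _ h Dy /=.
have bK j : bounded_fct (fun i => K1 j y i * u i).
  by apply: boundedM => //; exact: kernel_grad1_bounded uk Dy.
rewrite [LHS](eq_mean (E := E) (g := fun i => \sum_j (h 0 j * (K1 j y i * u i)))).
  rewrite (mean_sum mE) => [|j]; last by apply: boundedM => //; exact: bounded_cst.
  by apply: eq_bigr => j _; rewrite (meanZ mE)// mulrC.
by move=> i; apply: eq_bigr => j _; rewrite mulr0 addr0 mulrC.
Qed.

Lemma kernel_grad_is_derive I D (K : T -> I -> R) K1 y i j : kernel_grad D K K1 ->
  nbhs y D -> is_derive y (delta_mx 0 j) (fun z => K z i) (K1 j y i).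
Proof.
move=> uk Dy; have := unif_deriv_is_derive i (delta_mx 0 j) uk Dy.
rewrite (_ : \sum_l _ = K1 j y i)// (bigD1 j)//= mxE !eqxx mulr1 big1 ?addr0// => l lj.
by rewrite mxE (negbTE lj) andbF mulr0.
Qed.

End Kernels.

(** * The Newton and Poisson kernels *)

Section PoissonKernel.
Context {R : realType}.
Local Notation T := 'rV[R]_4.

(** The fundamental solution in dimension four, up to a constant. Its exponent makes it rational,
    and the Poisson kernel of the ball is [1 - |y|^2] times its square, normalised to be 1 at the
    origin. *)
Definition newton (z y : T) : R := (dotv (y - z) (y - z))^-1.

Definition newton1 (z : T) (j : 'I_4) (y : T) : R :=
  - 2 * (y 0 j - z 0 j) * newton z y ^+ 2.

Definition newton2 (z : T) (j l : 'I_4) (y : T) : R :=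
  8 * (y 0 j - z 0 j) * (y 0 l - z 0 l) * newton z y ^+ 3
  - 2 * (l == j)%:R * newton z y ^+ 2.

Definition poisson (z y : T) : R := (1 - dotv y y) * newton z y ^+ 2.

Definition poisson1 (z : T) (j : 'I_4) (y : T) : R :=
  - 2 * y 0 j * newton z y ^+ 2
  - 4 * (1 - dotv y y) * (y 0 j - z 0 j) * newton z y ^+ 3.

Definition poisson2 (z : T) (j l : 'I_4) (y : T) : R :=
  - 2 * (l == j)%:R * newton z y ^+ 2
  + 8 * y 0 j * (y 0 l - z 0 l) * newton z y ^+ 3
  + 8 * y 0 l * (y 0 j - z 0 j) * newton z y ^+ 3
  - 4 * (1 - dotv y y) * (l == j)%:R * newton z y ^+ 3
  + 24 * (1 - dotv y y) * (y 0 j - z 0 j) * (y 0 l - z 0 l) * newton z y ^+ 4.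

(** The third level is there to make second partial derivatives of a Poisson integral continuous, as
    [Ck_on 2] demands. *)
Definition smooth_kernel (I : Type) (D : set T) (K : T -> I -> R)
    (K1 : 'I_4 -> T -> I -> R) (K2 : 'I_4 -> 'I_4 -> T -> I -> R) :=
  [/\ kernel_grad D K K1, forall j, kernel_grad D (K1 j) (K2 j) &
      forall j l, exists K3, kernel_grad D (K2 j l) K3].

Lemma dist_sq_ge (y z : T) (r : R) : dotv y y <= r -> r < 1 -> 1 <= dotv z z ->
  (1 - Num.sqrt r) ^+ 2 <= dotv (y - z) (y - z).
Proof.
move=> yr r1 z1; have r0 : 0 <= r by exact: le_trans (dotv_ge0 y) yr.
have cs := cauchy_schwarz y z.
rewrite dotvBl !dotvBr [dotv z y]dotvC.
have hz : 1 <= enorm z by rewrite -(@expr_ge1 _ 2) ?enorm_ge0// enorm_sqr.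
have hy : enorm y <= Num.sqrt r by rewrite ler_wsqrtr.
have hr : Num.sqrt r < 1 by rewrite -sqrtr1 ltr_sqrt.
have yz : dotv y z <= enorm y * enorm z.
  apply: le_trans (ler_norm _) _; rewrite -(@ler_pXn2r _ 2) ?nnegrE ?mulr_ge0 ?enorm_ge0//.
  by rewrite real_normK ?num_real// exprMn !enorm_sqr.
have y0 := enorm_ge0 y.
rewrite -(enorm_sqr y) -(enorm_sqr z).
apply: (@le_trans _ _ ((enorm z - enorm y) ^+ 2)).
  by rewrite lerXn2r ?nnegrE ?subr_ge0 ?(le_trans hy) ?(le_trans (ltW hr))// lerB.
by move: (enorm y) (enorm z) (dotv y z) yz => a b c h; lra.
Qed.

Lemma kernel_grad_dist_sq (I : Type) (D : set T) (z : I -> T) (M B : R) :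
  (forall y, D y -> `|y| <= M) -> (forall i, `|z i| <= B) ->
  kernel_grad D (fun y i => dotv (y - z i) (y - z i))
    (fun j y i => 2 * (y 0 j - z i 0 j)).
Proof.
move=> DM zB.
have E (y : T) i (h : T) : \sum_j 2 * (y 0 j - z i 0 j) * h 0 j = 2 * dotv (y - z i) h.
  by rewrite /dotv mulr_sumr; apply: eq_bigr => j _; rewrite !mxE mulrA.
pose C := `|M| + `|B|; have C0 : 0 <= C by rewrite addr_ge0.
have DC y i : D y -> `|y - z i| <= C.
  move=> Dy; apply: le_trans (ler_normB _ _) _; apply: lerD.
    by apply: le_trans (DM _ Dy) (ler_norm _).
  by apply: le_trans (zB i) (ler_norm _).
exists (4 * C ^+ 2 + 8 * C + 4) => [|y Dy i].
  by rewrite !addr_ge0// mulr_ge0// ?sqr_ge0.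
have h0 := DC y i Dy; split=> [t h||h|w Dw]; rewrite ?E.
- by rewrite dotvZr; ring.
- apply: le_trans (dotv_le_norm _ _) _.
  have : `|y - z i| * `|y - z i| <= C * C by rewrite ler_pM.
  move: (`|y - z i| * _) => a; rewrite expr2; move: (C * C) => b ab; lra.
- rewrite normrM; apply: (@le_trans _ _ (8 * C * `|h|)).
    rewrite ger0_norm// (_ : 8 * C * _ = 2 * (4 * (C * `|h|))); last by ring.
    rewrite ler_wpM2l//; apply: le_trans (dotv_le_norm _ _) _.
    by rewrite ler_wpM2l// ler_wpM2r.
  by rewrite ler_wpM2r// -addrA addrCA lerDl addr_ge0// mulr_ge0// sqr_ge0.
- rewrite (_ : _ - _ = dotv (w - y) (w - y)); last first.
    rewrite (_ : w - z i = (w - y) + (y - z i)); last by rewrite addrA subrK.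
    by move: (w - y) (y - z i) => a b; rewrite dotvDl !dotvDr [dotv b a]dotvC; ring.
  apply: le_trans (dotv_le_norm _ _) _; rewrite -expr2 ler_wpM2r ?sqr_ge0//.
  by rewrite lerDr addr_ge0// mulr_ge0// sqr_ge0.
Qed.

Section Smoothness.
Context {I : Type} {D : set T} {z : I -> T} {M B d : R}.
Hypothesis DM : forall y, D y -> `|y| <= M.
Hypothesis zB : forall i, `|z i| <= B.
Hypothesis d0 : 0 < d.
Hypothesis dz : forall y i, D y -> d <= dotv (y - z i) (y - z i).

Let coordB j : kernel_grad D (fun y i => y 0 j - z i 0 j) (fun l _ _ => (l == j)%:R).
Proof.
have bz : bounded_fct (fun i => z i 0 j).
  by exists B => i; exact: le_trans (norm_coord_le _ _) (zB i).
apply: eq_kernel_grad (kernel_gradB (kernel_grad_coord I j DM) (kernel_grad_cst D bz)) _ _ => // *.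
by rewrite subr0.
Qed.

Lemma kernel_grad_newton : kernel_grad D (fun y i => newton (z i) y)
  (fun j y i => newton1 (z i) j y).
Proof.
have dz' y i : D y -> d <= `|dotv (y - z i) (y - z i)|.
  by move=> Dy; rewrite ger0_norm ?dotv_ge0// dz.
apply: eq_kernel_grad (kernel_grad_inv d0 dz' (kernel_grad_dist_sq DM zB)) _ _ => // j y i _.
by rewrite /newton1 /newton exprVn; ring.
Qed.

Lemma smooth_newton : smooth_kernel D (fun y i => newton (z i) y)
  (fun j y i => newton1 (z i) j y) (fun j l y i => newton2 (z i) j l y).
Proof.
have gQ := kernel_grad_newton; split=> // [j|j l].
  apply: eq_kernel_grad (kernel_gradZ (-2) (kernel_gradM (coordB j) (kernel_gradM gQ gQ))) _ _ => *;
  rewrite /newton1 /newton2 ?/newton1; ring.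
eexists; apply: eq_kernel_grad (kernel_gradB
  (kernel_gradZ 8 (kernel_gradM (kernel_gradM (coordB j) (coordB l)) (kernel_gradM gQ (kernel_gradM gQ gQ))))
  (kernel_gradZ (2 * (l == j)%:R) (kernel_gradM gQ gQ))) _ _ => [*|*]; last by [].
by rewrite /newton2; ring.
Qed.

Let gradA : kernel_grad D (fun y (_ : I) => 1 - dotv y y) (fun j y _ => - 2 * y 0 j).
Proof.
have z0 (i : I) : `|0 : T| <= 0 by rewrite normr0.
apply: eq_kernel_grad (kernel_gradB (kernel_grad_cst D (bounded_cst I 1))
  (kernel_grad_dist_sq DM z0)) _ _ => [y i _|j y i _]; first by rewrite subr0.
by rewrite mxE; ring.
Qed.

Lemma smooth_poisson : smooth_kernel D (fun y i => poisson (z i) y)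
  (fun j y i => poisson1 (z i) j y) (fun j l y i => poisson2 (z i) j l y).
Proof.
have gQ := kernel_grad_newton; have gY j := kernel_grad_coord I j DM.
have gQ2 := kernel_gradM gQ gQ; have gQ3 := kernel_gradM gQ gQ2.
have gQ4 := kernel_gradM gQ gQ3.
split=> [|j|j l].
- apply: eq_kernel_grad (kernel_gradM gradA gQ2) _ _ => *;
  rewrite /poisson /poisson1 /newton1; ring.
- apply: eq_kernel_grad (kernel_gradB (kernel_gradZ (-2) (kernel_gradM (gY j) gQ2))
    (kernel_gradZ 4 (kernel_gradM (kernel_gradM gradA (coordB j)) gQ3))) _ _ => *;
  rewrite /poisson1 /poisson2 /newton1; ring.
- eexists; apply: eq_kernel_grad (kernel_gradD (kernel_gradB (kernel_gradD (kernel_gradD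
    (kernel_gradZ (-2 * (l == j)%:R) gQ2)
    (kernel_gradZ 8 (kernel_gradM (kernel_gradM (gY j) (coordB l)) gQ3)))
    (kernel_gradZ 8 (kernel_gradM (kernel_gradM (gY l) (coordB j)) gQ3)))
    (kernel_gradZ (4 * (l == j)%:R) (kernel_gradM gradA gQ3)))
    (kernel_gradZ 24 (kernel_gradM (kernel_gradM gradA (kernel_gradM (coordB j) (coordB l))) gQ4))) _ _ => [*|*]; last by [].
  by rewrite /poisson2; ring.
Qed.

End Smoothness.

(** The four diagonal terms [2 * newton ^+ 2] cancel [8 * newton ^+ 3 * |y - z|^2]: here the
    dimension enters. *)
Lemma newton_harmonic (z y : T) : dotv (y - z) (y - z) != 0 ->
  \sum_j newton2 z j j y = 0.
Proof.
move=> d0; rewrite (eq_bigr (fun j : 'I_4 =>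
  8 * newton z y ^+ 3 * ((y - z) 0 j * (y - z) 0 j) - 2 * newton z y ^+ 2)); last first.
  by move=> j _; rewrite /newton2 eqxx !mxE /=; ring.
rewrite sumrB -mulr_sumr sumr_const card_ord -/(dotv _ _) /newton; field.
exact: d0.
Qed.

Lemma poisson_harmonic (z y : T) : dotv z z = 1 -> dotv (y - z) (y - z) != 0 ->
  \sum_j poisson2 z j j y = 0.
Proof.
move=> z1 d0; pose q := newton z y; rewrite (eq_bigr (fun j : 'I_4 =>
  (- 2 * q ^+ 2 - 4 * (1 - dotv y y) * q ^+ 3) +
  (16 * q ^+ 3 * (y 0 j * (y - z) 0 j) +
  24 * (1 - dotv y y) * q ^+ 4 * ((y - z) 0 j * (y - z) 0 j)))); last first.
  by move=> j _; rewrite /poisson2 -/q eqxx !mxE /=; ring.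
rewrite big_split /= sumr_const card_ord big_split /= -!mulr_sumr -!/(dotv _ _).
have e1 : q * dotv (y - z) (y - z) = 1 by rewrite /q /newton mulVf.
have e2 : dotv (y - z) (y - z) = dotv y y - 2 * dotv y z + 1.
  by rewrite dotvBl !dotvBr [dotv z y]dotvC z1; ring.
(* Since [|z| = 1], all inner products are functions of [s = |y - z|^2] and [a = |y|^2], and
   [q * s = 1] finishes the computation. *)
have e3 : dotv y (y - z) = (dotv (y - z) (y - z) + dotv y y - 1) / 2.
  by rewrite e2 dotvBr; field.
rewrite e3; move: e1; move: q (dotv (y - z) _) (dotv y y) => q s a e1.
transitivity (- 8 * q ^+ 2 - 16 * (1 - a) * q ^+ 3 +
  8 * q ^+ 2 * (q * s) + 8 * (a - 1) * q ^+ 3 + 24 * (1 - a) * q ^+ 3 * (q * s)).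
  by field.
by rewrite e1; ring.
Qed.

End PoissonKernel.

(** * The Poisson formula *)

Section SmoothKernelMean.
Context {R : realType} {I : Type} {E : (I -> R) -> R} (mE : is_mean E).
Local Notation T := 'rV[R]_4.

Lemma smooth_kernel_mean (D : set T) (K : T -> I -> R) K1 K2 (f : I -> R) :
  bounded_fct f -> smooth_kernel D K K1 K2 ->
  smooth_kernel D (fun y (_ : unit) => E (fun i => K y i * f i))
    (fun j y _ => E (fun i => K1 j y i * f i))
    (fun j l y _ => E (fun i => K2 j l y i * f i)).
Proof.
move=> bf [g0 g1 g2]; split=> [|j|j l].
- exact: kernel_grad_mean.
- exact: kernel_grad_mean.
- by have [K3 /(kernel_grad_mean mE bf) g] := g2 j l; eexists; exact: g.
Qed.

End SmoothKernelMean.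

Section PoissonFormula.
Context {R : realType}.
Local Notation T := 'rV[R]_4.

(** A modulus of continuity in penalised form. The penalty [|y - w|^4] is the denominator of the
    Poisson kernel, so multiplying by the kernel leaves [K * (1 - |y|^2)], which vanishes at the
    boundary; the sphere never has to be split into near and far parts. *)
Lemma compact_modulus (C : set T) (u : T -> R) (e : R) : compact C ->
  (forall y, C y -> {for y, continuous u}) -> 0 < e ->
  exists2 K : R, 0 <= K & forall y w, C y -> C w ->
    `|u w - u y| <= e + K * dotv (y - w) (y - w) ^+ 2.
Proof.
move=> cC cu e0.
have [M [_ HM]] : bounded_set (u @` C).
  apply: compact_bounded; apply: continuous_compact => //.
  by apply: continuous_in_subspaceT => y /set_mem; exact: cu.
have {}HM y : C y -> `|u y| <= `|M| + 1.
  by move=> Cy; apply: (HM (`|M| + 1)); [rewrite (le_lt_trans (ler_norm _))// ltrDl|exists y].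
pose P (K : R) (y : T) := forall w, C y -> C w ->
    `|u w - u y| <= e + K * dotv (y - w) (y - w) ^+ 2.
(* Near each point the estimate holds for all large [K]; compactness makes one [K] serve
   everywhere. *)
have /compact_near_coveringP/(_ R (+oo) P _) H := cC.
have [|K [_ HK]] := H _; last first.
  exists (`|K| + 1); first by rewrite addr_ge0.
  move=> y w Cy Cw; by have /(_ y Cy w Cy Cw) := HK (`|K| + 1) (ltr_pwDr ltr01 (ler_norm _)).
move=> x Cx; have := cu x Cx => /cvgrPdist_lt /(_ (e / 2)).
have e2 : 0 < e / 2 by rewrite divr_gt0.
move=> /(_ e2) /nbhs_ballP[d /= d0]; rewrite -ball_normE => hd.
have d2 : 0 < d / 2 by rewrite divr_gt0.
have q0 : 0 < (d / 2) ^+ 4 by rewrite exprn_gt0.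
(* Either [w] is within [d] of [x], where continuity gives [e], or [|y - w| >= d / 2] and this
   threshold makes the penalty exceed twice the bound on [|u|]. *)
exists (ball x (d / 2), [set K | 2 * (`|M| + 1) / (d / 2) ^+ 4 < K]).
  split; first exact: nbhsx_ballx.
  by exists (2 * (`|M| + 1) / (d / 2) ^+ 4); split => //; exact: num_real.
move=> [y K] /=; rewrite -ball_normE => -[yx hK].
have K0 : 0 <= K.
  by apply: ltW; apply: le_lt_trans hK; rewrite divr_ge0 ?mulr_ge0 ?addr_ge0// ltW.
have nd (w v : T) : `|w - v| ^+ 4 <= dotv (w - v) (w - v) ^+ 2.
  rewrite (exprM _ 2 2); rewrite lerXn2r ?nnegrE ?dotv_ge0 ?exprn_ge0//.
  exact: norm_le_enorm.
move=> w Cy Cw.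
have hy : `|u x - u y| < e / 2.
  by apply: hd; apply: lt_trans yx _; lra.
have [xw|xw] := ltP `|x - w| d.
  have hw : `|u x - u w| < e / 2 by exact: hd.
  have : 0 <= K * dotv (y - w) (y - w) ^+ 2 by rewrite mulr_ge0// sqr_ge0.
  have -> : u w - u y = (u x - u y) - (u x - u w) by ring.
  have := ler_normB (u x - u y) (u x - u w); lra.
have yw : d / 2 <= `|y - w|.
  have := ler_normD (x - y) (y - w); rewrite addrA subrK.
  by move: yx => /= yx; lra.
have H4 : (d / 2) ^+ 4 <= dotv (y - w) (y - w) ^+ 2.
  by apply: le_trans (nd y w); rewrite lerXn2r ?nnegrE ?(ltW d2).
have H5 : 2 * (`|M| + 1) <= K * dotv (y - w) (y - w) ^+ 2.
  move: hK; rewrite ltr_pdivrMr// => /ltW /le_trans; apply.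
  by rewrite ler_wpM2l.
have := ler_normB (u w) (u y); have := HM w Cw; have := HM y Cy; lra.
Qed.

Context {I : Type} {E : (I -> R) -> R} (mE : is_mean E).
Context {z : I -> T} {J : I -> R}.
Hypothesis z1 : forall i, dotv (z i) (z i) = 1.
Hypothesis J0 : forall i, 0 <= J i.
Hypothesis bJ : bounded_fct J.
Hypothesis mass : forall y, dotv y y < 1 -> E (fun i => poisson (z i) y * J i) = 1.

Lemma norm_sphere_le i : `|z i| <= 1.
Proof. by rewrite -(@expr_le1 _ 2)// -(z1 i) norm_le_enorm. Qed.

(** Uniform bounds hold only at a positive distance from the sphere; [exists_ball] then finds such a
    ball around any given interior point. *)
Lemma smooth_poisson_ball (r : R) : r < 1 ->
  smooth_kernel [set y | dotv y y < r] (fun y i => poisson (z i) y)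
    (fun j y i => poisson1 (z i) j y) (fun j l y i => poisson2 (z i) j l y).
Proof.
move=> r1; have s1 : Num.sqrt r < 1 by rewrite -sqrtr1 ltr_sqrt.
apply: (@smooth_poisson _ I _ z 1 1 ((1 - Num.sqrt r) ^+ 2)).
- move=> y /= yr; rewrite -(@expr_le1 _ 2)// (le_trans (norm_le_enorm _))//.
  by apply: ltW; apply: lt_trans r1.
- exact: norm_sphere_le.
- by rewrite exprn_gt0// subr_gt0.
- by move=> y i /= yr; rewrite dist_sq_ge ?z1// ltW.
Qed.

Section Extension.
Variable f : I -> R.
Hypothesis bf : bounded_fct f.

Definition poisson_integral (y : T) : R := E (fun i => poisson (z i) y * (J i * f i)).
Definition poisson_integral1 (j : 'I_4) (y : T) : R :=
  E (fun i => poisson1 (z i) j y * (J i * f i)).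
Definition poisson_integral2 (j l : 'I_4) (y : T) : R :=
  E (fun i => poisson2 (z i) j l y * (J i * f i)).

Let smoothV (r : R) (r1 : r < 1) :=
  smooth_kernel_mean mE (boundedM bJ bf) (smooth_poisson_ball r1).

Lemma exists_ball (y : T) : dotv y y < 1 ->
  exists2 r : R, r < 1 & nbhs y [set v | dotv v v < r].
Proof.
move=> y1; exists ((dotv y y + 1) / 2); first lra.
by apply: nbhs_ball_sq; lra.
Qed.

Lemma poisson_integral_continuous y : dotv y y < 1 ->
  {for y, continuous poisson_integral}.
Proof.
move=> /exists_ball[r r1 ny]; have [g _ _] := smoothV r1.
exact: (unif_deriv_continuous (i := tt) g ny).
Qed.

Lemma poisson_integral1_continuous j y : dotv y y < 1 ->
  {for y, continuous (poisson_integral1 j)}.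
Proof.
move=> /exists_ball[r r1 ny]; have [_ g _] := smoothV r1.
exact: (unif_deriv_continuous (i := tt) (g j) ny).
Qed.

Lemma poisson_integral2_continuous j l y : dotv y y < 1 ->
  {for y, continuous (poisson_integral2 j l)}.
Proof.
move=> /exists_ball[r r1 ny]; have [_ _ /(_ j l)[K3 g]] := smoothV r1.
exact: (unif_deriv_continuous (i := tt) g ny).
Qed.

Lemma is_derive_poisson_integral j y : dotv y y < 1 ->
  is_derive y (delta_mx 0 j) poisson_integral (poisson_integral1 j y).
Proof.
move=> /exists_ball[r r1 ny]; have [g _ _] := smoothV r1.
exact: (kernel_grad_is_derive tt j g ny).
Qed.

Lemma is_derive_poisson_integral1 j l y : dotv y y < 1 ->
  is_derive y (delta_mx 0 l) (poisson_integral1 j) (poisson_integral2 j l y).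
Proof.
move=> /exists_ball[r r1 ny]; have [_ g _] := smoothV r1.
exact: (kernel_grad_is_derive tt l (g j) ny).
Qed.

Lemma dist_sphere_neq0 (y : T) i : dotv y y < 1 -> dotv (y - z i) (y - z i) != 0.
Proof.
by move=> y1; rewrite dotv_eq0 subr_eq0; apply/eqP => yz; move: y1; rewrite yz z1 ltxx.
Qed.

Lemma poisson_integral_harmonic y : dotv y y < 1 ->
  \sum_j poisson_integral2 j j y = 0.
Proof.
move=> y1; have [r r1 /nbhs_singleton yr] := exists_ball y1.
have [_ g _] := smooth_poisson_ball r1.
rewrite -(mean_sum mE) => [|j].
  rewrite -[RHS](mean_cst mE); apply: eq_mean => i.
  by rewrite -mulr_suml poisson_harmonic ?mul0r// dist_sphere_neq0.
by apply: boundedM; [exact: kernel_grad1_bounded (g j) yr|exact: boundedM].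
Qed.

Lemma poisson_bounded y : dotv y y < 1 -> bounded_fct (fun i => poisson (z i) y).
Proof.
move=> y1; have [r r1 /nbhs_singleton yr] := exists_ball y1.
by have [g _ _] := smooth_poisson_ball r1; exact: kernel_grad_bounded g yr.
Qed.

Lemma poisson1_bounded j y : dotv y y < 1 -> bounded_fct (fun i => poisson1 (z i) j y).
Proof.
move=> y1; have [r r1 /nbhs_singleton yr] := exists_ball y1.
by have [g _ _] := smooth_poisson_ball r1; exact: kernel_grad1_bounded g yr.
Qed.

Lemma poisson_ge0 y i : dotv y y < 1 -> 0 <= poisson (z i) y.
Proof. by move=> y1; rewrite mulr_ge0 ?sqr_ge0// subr_ge0 ltW. Qed.

Lemma poisson_integral_le M y : (forall i, `|f i| <= M) -> dotv y y < 1 ->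
  `|poisson_integral y| <= M.
Proof.
move=> fM y1; apply: (@le_trans _ _ (E (fun i => M * (poisson (z i) y * J i)))).
  apply: (norm_mean_le mE).
    by apply: boundedM; [exact: bounded_cst|apply: boundedM => //; exact: poisson_bounded].
  move=> i; rewrite normrM [`|J i * _|]normrM (ger0_norm (poisson_ge0 i y1)) (ger0_norm (J0 i)) mulrA mulrC.
  by rewrite ler_wpM2r// mulr_ge0// poisson_ge0.
rewrite (meanZ mE) ?mass ?mulr1//; apply: boundedM => //; exact: poisson_bounded.
Qed.

End Extension.

(** The difference of the two sides is harmonic, so only its boundary values need attention. By
    [mass] it equals [- E (poisson * J * (u (z i) - u w))] at [w], and [compact_modulus] bounds that
    by [e / 2 + K * (1 - |w|^2)]. *)
Theorem poisson_formula (u : T -> R) (u1 u2 : 'I_4 -> T -> R) :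
  (forall y, dotv y y <= 1 -> {for y, continuous u}) ->
  (forall y j, dotv y y < 1 -> is_derive y (delta_mx 0 j) u (u1 j y)) ->
  (forall y j, dotv y y < 1 -> is_derive y (delta_mx 0 j) (u1 j) (u2 j y)) ->
  (forall y, dotv y y < 1 -> \sum_j u2 j y = 0) ->
  bounded_fct (fun i => u (z i)) /\
  forall y, dotv y y < 1 -> u y = poisson_integral (fun i => u (z i)) y.
Proof.
move=> cu du1 du2 lap.
have cmod e : 0 < e -> _ := fun e0 => compact_modulus (compact_ball_sq (r := 1)) cu e0.
have bu : bounded_fct (fun i => u (z i)).
  have [K K0 HK] := cmod 1 ltr01.
  exists (1 + K + `|u 0|) => i.
  have := HK 0 (z i); rewrite /= -{1}(scale0r 0) dotvZl mul0r z1 lexx => /(_ ler01 isT).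
  rewrite sub0r dotvNl dotvNr opprK z1 expr1n mulr1 => h.
  by rewrite -[u (z i)](subrK (u 0)) (le_trans (ler_normD _ _))// lerD.
split=> // y y1; apply/eqP; rewrite -subr_eq0; apply/eqP.
pose f i := u (z i).
apply: (@harmonic_eq0 R 3 (u - poisson_integral f) (fun j => u1 j - poisson_integral1 f j)
  (fun j y => u2 j y - poisson_integral2 f j j y)) y1.
- by move=> w w1; exact: (cvgB (cu w (ltW w1)) (poisson_integral_continuous bu w1)).
- by move=> w j w1; apply: is_deriveB; [exact: du1|exact: is_derive_poisson_integral].
- by move=> w j w1; apply: is_deriveB; [exact: du2|exact: is_derive_poisson_integral1].
- by move=> w w1; rewrite sumrB lap// poisson_integral_harmonic// subrr.
move=> e e0; have e2 : 0 < e / 2 by rewrite divr_gt0.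
have [K K0 HK] := cmod _ e2.
have K1 : 0 < K + 1 by rewrite ltr_pwDr.
(* On this layer [K * (1 - |w|^2)] is at most [e / 2]. *)
exists (1 - e / 2 / (K + 1)); first by rewrite ltrBlDr ltrDl divr_gt0.
move=> w /andP[rw w1].
have bP := poisson_bounded w1.
have bPJ : bounded_fct (fun i => poisson (z i) w * J i) by exact: boundedM.
have -> : (u - poisson_integral f) w = - E (fun i => poisson (z i) w * J i * (u (z i) - u w)).
  transitivity (u w * E (fun i => poisson (z i) w * J i) - poisson_integral f w).
    by rewrite mass// mulr1.
  rewrite -(meanZ mE)// -(meanB mE); last 2 first.
  - by apply: boundedM => //; exact: bounded_cst.
  - by apply: boundedM => //; exact: boundedM.
  rewrite -(meanN mE).
    by apply: eq_mean => i; rewrite /f; ring.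
  by apply: boundedM => //; apply: boundedB => //; exact: bounded_cst.
(* This is [mass] at the origin, where the Poisson kernel is identically 1. *)
have EJ : E J = 1.
  rewrite -(mass (y := 0)); last by rewrite -(scale0r 0) dotvZl mul0r.
  apply: eq_mean => i; rewrite /poisson /newton sub0r dotvNl dotvNr opprK z1.
  by rewrite -(scale0r 0) dotvZl; field.
rewrite normrN; apply: (@le_trans _ _ (E (fun i => e / 2 * (poisson (z i) w * J i) +
    K * (1 - dotv w w) * J i))).
  apply: (norm_mean_le mE).
    by apply: boundedD; apply: boundedM => //; exact: bounded_cst.
  move=> i; have PJ : 0 <= poisson (z i) w * J i by rewrite mulr_ge0// poisson_ge0.
  rewrite normrM (ger0_norm PJ).
  have := HK w (z i) (ltW w1); rewrite /= z1 lexx => /(_ isT) h.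
  apply: le_trans (ler_wpM2l PJ h) _.
  rewrite le_eqVlt; apply/orP; left; apply/eqP; rewrite /poisson /newton; field.
  exact: dist_sphere_neq0.
rewrite (meanD mE); [|by apply: boundedM => //; exact: bounded_cst..].
rewrite !(meanZ mE)// mass// EJ !mulr1.
have h : (1 - dotv w w) * (K + 1) <= e / 2.
  by rewrite -ler_pdivlMr//; lra.
have w0 : 0 <= 1 - dotv w w by rewrite subr_ge0 ltW.
by move: (1 - dotv w w) w0 h => a a0; rewrite mulrDr mulr1 [a * K]mulrC; lra.
Qed.

End PoissonFormula.

(** * The sphere in Hopf coordinates *)

Section TripleMean.
Context {R : realType}.
Local Notation U := (unitI R).

Definition triple_mean (f : U * (U * U) -> R) : R :=
  unit_mean (fun a => unit_mean (fun b => unit_mean (fun c => f (a, (b, c))))).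

Lemma triple_mean_is_mean : is_mean triple_mean.
Proof.
have mU := @unit_mean_is_mean R.
exact: (is_mean_prod mU (is_mean_prod mU mU)).
Qed.

Lemma unit_itv_sval (u : U) : unit_itv (sval u).
Proof. exact: svalP u. Qed.

Lemma unif_deriv_bounded (I J : Type) (k : R^o -> I -> R) dk (p : J -> U) (q : J -> I) :
  unif_deriv unit_itv k dk -> bounded_fct (fun j => dk (sval (p j)) (q j) 1).
Proof.
move=> [M M0 kM]; exists (M * `|1 : R^o|) => j.
by have [_ _ + _] := kM _ (unit_itv_sval (p j)) (q j); exact.
Qed.

(** A derivative of a function with equal end values has mean 0; for an outer variable, the
    derivative is first taken out of the inner means. With its two companions this is the
    integration by parts behind rotation invariance. *)
Lemma triple_mean_deriv1 (k : R^o -> U * U -> R) dk :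
  unif_deriv unit_itv k dk -> (forall i, k 1 i = k 0 i) ->
  triple_mean (fun i => dk (sval i.1) i.2 1) = 0.
Proof.
move=> uk k01; have mU := @unit_mean_is_mean R.
have u1 := unif_deriv_reindex (fun p : (unit * U) * U => (p.1.2, p.2)) uk.
have u2 := unif_deriv_mean mU (unif_deriv_mean mU u1).
have := unit_mean_unif_deriv tt u2; rewrite /triple_mean /= => ->.
by apply/eqP; rewrite subr_eq0; apply/eqP; do 2!apply: eq_mean => ?; rewrite k01.
Qed.

Lemma triple_mean_deriv2 (k : R^o -> U * U -> R) dk :
  unif_deriv unit_itv k dk -> (forall i, k 1 i = k 0 i) ->
  triple_mean (fun i => dk (sval i.2.1) (i.1, i.2.2) 1) = 0.
Proof.
move=> uk k01; have mU := @unit_mean_is_mean R.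
have u2 := unif_deriv_mean mU uk.
rewrite /triple_mean /= -[RHS](mean_cst mU); apply: eq_mean => a.
rewrite (unit_mean_unif_deriv a u2); apply/eqP; rewrite subr_eq0; apply/eqP.
by apply: eq_mean => ?; rewrite k01.
Qed.

Lemma triple_mean_deriv3 (k : R^o -> U * U -> R) dk :
  unif_deriv unit_itv k dk -> (forall i, k 1 i = k 0 i) ->
  triple_mean (fun i => dk (sval i.2.2) (i.1, i.2.1) 1) = 0.
Proof.
move=> uk k01; have mU := @unit_mean_is_mean R.
rewrite /triple_mean /= -[RHS](mean_cst mU); apply: eq_mean => a.
rewrite -[RHS](mean_cst mU); apply: eq_mean => b.
by rewrite (unit_mean_unif_deriv (a, b) uk) k01 subrr.
Qed.

Lemma unif_deriv_const (I : Type) (k : R^o -> I -> R) dk i :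
  unif_deriv unit_itv k dk -> (forall t, unit_itv t -> dk t i 1 = 0) -> k 1 i = k 0 i.
Proof.
move=> uk dk0; apply/eqP; rewrite -subr_eq0 -(unit_mean_unif_deriv i uk); apply/eqP.
rewrite -[RHS](mean_cst (@unit_mean_is_mean R)); apply: eq_mean => t.
exact/dk0/unit_itv_sval.
Qed.

Lemma unif_deriv_inv_sq (I : Type) (D : set R^o) (t : R^o -> I -> R) dt (A d : R) :
  0 < d -> (forall y i, D y -> d <= A - t y i) -> unif_deriv D t dt ->
  unif_deriv D (fun y i => (A - t y i) ^- 2)
    (fun y i h => 2 * (A - t y i) ^- 3 * dt y i h).
Proof.
move=> d0 td ut.
have uA := unif_derivB (unif_deriv_cst (D := D) (bounded_cst I A)) ut.
have uI := unif_deriv_inv d0 (fun y i Dy => le_trans (td y i Dy) (ler_norm _)) uA.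
by apply: eq_unif_deriv (unif_derivM uI uI) _ _ => * /=; rewrite -!exprVn; ring.
Qed.

End TripleMean.

(** * Periodic parametrisations of the unit circle *)

Section Circle.
Context {R : realType}.

(* [om] is the angular speed of the periodic parametrization [(cc, ss)] of the
   unit circle. *)
Record circle_param (cc ss om : R -> R) : Prop := CircleParam {
  circle_eq : forall t, cc t ^+ 2 + ss t ^+ 2 = 1;
  circle_dcos : unif_deriv (unit_itv (R := R)) (fun t (_ : unit) => cc t)
    (fun t _ h => - om t * ss t * h);
  circle_dsin : unif_deriv (unit_itv (R := R)) (fun t (_ : unit) => ss t)
    (fun t _ h => om t * cc t * h);
  circle_cos01 : cc 1 = cc 0;
  circle_sin01 : ss 1 = ss 0;
  circle_speed : exists2 d, 0 < d & exists C, forall t, d <= om t <= C }.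

Lemma unif_deriv_scaled (I : Type) (a : R) :
  unif_deriv (unit_itv (R := R)) (fun t (_ : I) => a * t) (fun _ _ h => a * h).
Proof.
apply: unif_derivZ; apply: (unif_deriv_id I (M := 1)) => t /andP[t0 t1].
by rewrite ger0_norm.
Qed.

Lemma unif_deriv_cosZ (I : Type) (a : R) :
  unif_deriv (unit_itv (R := R)) (fun t (_ : I) => cos (a * t))
    (fun t _ h => - a * sin (a * t) * h).
Proof.
apply: eq_unif_deriv (unif_deriv_cos (unif_deriv_scaled I a)) _ _ => // t i h _ /=.
by ring.
Qed.

Lemma unif_deriv_sinZ (I : Type) (a : R) :
  unif_deriv (unit_itv (R := R)) (fun t (_ : I) => sin (a * t))
    (fun t _ h => a * cos (a * t) * h).
Proof.
apply: eq_unif_deriv (unif_deriv_sin (unif_deriv_scaled I a)) _ _ => // t i h _ /=.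
by ring.
Qed.

Lemma polar_coordinates (x y : R) :
  exists r a, [/\ 0 <= r, x = r * cos a, y = r * sin a & r ^+ 2 = x ^+ 2 + y ^+ 2].
Proof.
pose r := Num.sqrt (x ^+ 2 + y ^+ 2).
have s0 : 0 <= x ^+ 2 + y ^+ 2 by rewrite addr_ge0 ?sqr_ge0.
have rE : r ^+ 2 = x ^+ 2 + y ^+ 2 by rewrite sqr_sqrtr.
have [r0|r0] := eqVneq r 0.
  exists 0, 0; rewrite !mul0r expr0n -rE r0 expr0n.
  have /eqP : x ^+ 2 + y ^+ 2 = 0 by rewrite -rE r0 expr0n.
  by rewrite paddr_eq0 ?sqr_ge0// !sqrf_eq0 => /andP[/eqP-> /eqP->]; split.
have r_gt0 : 0 < r by rewrite lt_neqAle eq_sym r0 sqrtr_ge0.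
have x1 : -1 <= x / r <= 1.
  rewrite -ler_norml normrM normfV (gtr0_norm r_gt0) ler_pdivrMr// mul1r.
  by rewrite -(@ler_pXn2r _ 2) ?nnegrE ?(ltW r_gt0)// real_normK ?num_real// rE lerDl sqr_ge0.
have cE : cos (acos (x / r)) = x / r by rewrite acosK// in_itv.
have sE : sin (acos (x / r)) = `|y| / r.
  rewrite sin_acos// (_ : 1 - _ = (`|y| / r) ^+ 2).
    by rewrite sqrtr_sqr ger0_norm// divr_ge0// ltW.
  rewrite !expr_div_n real_normK ?num_real// rE; field.
  by rewrite -rE expf_neq0.
have [y0|/ltW y0] := leP 0 y.
  exists r, (acos (x / r)); rewrite cE sE ger0_norm// ![r * _]mulrC !divfK//.
  by split=> //; exact: ltW.
exists r, (- acos (x / r)); rewrite cosN sinN cE sE ler0_norm//.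
by rewrite mulNr opprK ![r * _]mulrC !divfK//; split=> //; exact: ltW.
Qed.

End Circle.

Section Coordinates4.
Context {R : realType}.

Definition o0 : 'I_4 := @Ordinal 4 0 isT.
Definition o1 : 'I_4 := @Ordinal 4 1 isT.
Definition o2 : 'I_4 := @Ordinal 4 2 isT.
Definition o3 : 'I_4 := @Ordinal 4 3 isT.

Lemma sum_ord4 (f : 'I_4 -> R) : \sum_j f j = f o0 + f o1 + f o2 + f o3.
Proof.
rewrite !big_ord_recl big_ord0 addr0 !addrA.
by do !congr (_ + _); congr f; apply: val_inj.
Qed.

Definition vec4 (a b c d : R) : 'rV[R]_4 := \row_j nth 0 [:: a; b; c; d] j.

Lemma vec4E a b c d : [/\ vec4 a b c d 0 o0 = a, vec4 a b c d 0 o1 = b,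
  vec4 a b c d 0 o2 = c & vec4 a b c d 0 o3 = d].
Proof. by rewrite !mxE. Qed.

Lemma dotv_vec4 (u : 'rV[R]_4) a b c d : dotv u (vec4 a b c d) =
  u 0 o0 * a + u 0 o1 * b + u 0 o2 * c + u 0 o3 * d.
Proof. by rewrite /dotv sum_ord4; have [-> -> -> ->] := vec4E a b c d. Qed.

Lemma dotv4 (u v : 'rV[R]_4) : dotv u v =
  u 0 o0 * v 0 o0 + u 0 o1 * v 0 o1 + u 0 o2 * v 0 o2 + u 0 o3 * v 0 o3.
Proof. by rewrite /dotv sum_ord4. Qed.

End Coordinates4.

(** * Infinitesimal rotations in Hopf coordinates *)

Section Hopf.
Context {R : realType}.
Local Notation T := 'rV[R]_4.
Local Notation U := (unitI R).
Context {cc ss om : R -> R} (circ : circle_param cc ss om).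

Let hs (t : R) := sin (pi / 2 * t).
Let hc (t : R) := cos (pi / 2 * t).
Let pc (t : R) := cos (2 * pi * t).
Let ps (t : R) := sin (2 * pi * t).

(** Two circles with radii the sine and cosine of a latitude in [[0, pi / 2]]. The first circle is
    left general, for the elliptic parametrisation used later; the second runs at constant speed. *)
Definition hopf_point (a b c : R) : T :=
  vec4 (hs b * cc a) (hs b * ss a) (hc b * pc c) (hc b * ps c).

Definition hopf (i : U * (U * U)) : T :=
  hopf_point (sval i.1) (sval i.2.1) (sval i.2.2).

(** The surface density in these coordinates up to a constant factor, which [hopf_density] later
    normalises away. *)
Definition hopf_weight (i : U * (U * U)) : R :=
  om (sval i.1) * (hs (sval i.2.1) * hc (sval i.2.1)).

Let hsc t : hs t ^+ 2 + hc t ^+ 2 = 1. Proof. by rewrite addrC cos2Dsin2. Qed.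
Let psc t : pc t ^+ 2 + ps t ^+ 2 = 1. Proof. exact: cos2Dsin2. Qed.

Lemma hopf_point_unit a b c : dotv (hopf_point a b c) (hopf_point a b c) = 1.
Proof.
rewrite dotv_vec4; have [-> -> -> ->] := vec4E (hs b * cc a) (hs b * ss a) (hc b * pc c) (hc b * ps c).
transitivity (hs b ^+ 2 * (cc a ^+ 2 + ss a ^+ 2) + hc b ^+ 2 * (pc c ^+ 2 + ps c ^+ 2)); first ring.
by rewrite (circle_eq circ) psc !mulr1.
Qed.

Let norm_le1 (x y : R) : x ^+ 2 + y ^+ 2 = 1 -> `|x| <= 1 /\ `|y| <= 1.
Proof.
move=> xy; split; rewrite -(@expr_le1 _ 2)// real_normK ?num_real//.
  by have := sqr_ge0 y; lra.
by have := sqr_ge0 x; lra.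
Qed.

Let B1 (J : Type) (x y : R -> R) (p : J -> R) : (forall t, x t ^+ 2 + y t ^+ 2 = 1) ->
  bounded_fct (fun j => x (p j)) /\ bounded_fct (fun j => y (p j)).
Proof. by move=> xy; split; exists 1 => j; have [] := norm_le1 (xy (p j)). Qed.

Let Bcc (J : Type) (p : J -> R) : bounded_fct (fun j => cc (p j)).
Proof. by have [] := B1 p (circle_eq circ). Qed.
Let Bss (J : Type) (p : J -> R) : bounded_fct (fun j => ss (p j)).
Proof. by have [] := B1 p (circle_eq circ). Qed.
Let Bhs (J : Type) (p : J -> R) : bounded_fct (fun j => hs (p j)).
Proof. by have [] := B1 p hsc. Qed.
Let Bhc (J : Type) (p : J -> R) : bounded_fct (fun j => hc (p j)).
Proof. by have [] := B1 p hsc. Qed.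
Let Bpc (J : Type) (p : J -> R) : bounded_fct (fun j => pc (p j)).
Proof. by have [] := B1 p psc. Qed.
Let Bps (J : Type) (p : J -> R) : bounded_fct (fun j => ps (p j)).
Proof. by have [] := B1 p psc. Qed.
Let Bom (J : Type) (p : J -> R) : bounded_fct (fun j => om (p j)).
Proof.
have [d d0 [C omC]] := circle_speed circ; exists C => j.
by have /andP[h1 h2] := omC (p j); rewrite ger0_norm// (le_trans (ltW d0)).
Qed.

Lemma bounded_hopf_weight : bounded_fct hopf_weight.
Proof. by apply: boundedM; [exact: Bom|apply: boundedM; [exact: Bhs|exact: Bhc]]. Qed.

Let half_pi (u : U) : 0 <= pi / 2 * sval u <= pi / 2.
Proof.
have /andP[u0 u1] := svalP u; have p0 := @pi_ge0 R.
by rewrite mulr_ge0 ?divr_ge0//= ler_piMr ?divr_ge0.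
Qed.

Lemma hopf_weight_ge0 i : 0 <= hopf_weight i.
Proof.
have [d d0 [C omC]] := circle_speed circ.
have /andP[h1 h2] := half_pi i.2.1; have p0 := @pi_gt0 R.
rewrite mulr_ge0 ?mulr_ge0//.
- by have /andP[+ _] := omC (sval i.1); apply: le_trans; exact: ltW.
- by apply: sin_ge0_pi; rewrite h1 (le_trans h2)//; lra.
- by apply: cos_ge0_pihalf; rewrite h2 andbT (le_trans _ h1)//; lra.
Qed.

Let Cst (J : Type) (f : J -> R) := @unif_deriv_cst R _ J (unit_itv (R := R)) f.
Let dhs (J : Type) := @unif_deriv_sinZ R J (pi / 2).
Let dhc (J : Type) := @unif_deriv_cosZ R J (pi / 2).
Let dps (J : Type) := @unif_deriv_sinZ R J (2 * pi).
Let dpc (J : Type) := @unif_deriv_cosZ R J (2 * pi).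
Let dcc (J : Type) := unif_deriv_reindex (fun _ : J => tt) (circle_dcos circ).
Let dss (J : Type) := unif_deriv_reindex (fun _ : J => tt) (circle_dsin circ).

Let two_pi_neq0 : (2 * pi : R) != 0.
Proof. by rewrite mulf_neq0// lt0r_neq0// pi_gt0. Qed.
Let half_pi_neq0 : (pi / 2 : R) != 0.
Proof. by rewrite mulf_neq0 ?invr_neq0// lt0r_neq0// pi_gt0. Qed.

Section Rotation.
Variables (b : T) (A : R).
Hypothesis A0 : 0 < A.
Hypothesis bA : dotv b b < A ^+ 2.

Let t (x y z : R) : R := hs y * (b 0 o0 * cc x + b 0 o1 * ss x) +
  hc y * (b 0 o2 * pc z + b 0 o3 * ps z).

Lemma dotv_hopf_point x y z : dotv b (hopf_point x y z) = t x y z.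
Proof. by rewrite dotv_vec4 /t; ring. Qed.

Let d := A - enorm b.
Let d0 : 0 < d.
Proof. by rewrite subr_gt0 -(@ltr_pXn2r _ 2) ?nnegrE ?enorm_ge0 ?(ltW A0)// enorm_sqr. Qed.
Let dt x y z : d <= A - t x y z.
Proof.
rewrite lerB// -dotv_hopf_point (le_trans (ler_norm _))//.
rewrite -(@ler_pXn2r _ 2) ?nnegrE ?enorm_ge0// real_normK ?num_real//.
by rewrite (le_trans (cauchy_schwarz _ _))// hopf_point_unit mulr1 enorm_sqr.
Qed.

Let dt1 : unif_deriv (unit_itv (R := R)) (fun x (p : U * U) => t x (sval p.1) (sval p.2))
  (fun x p h => om x * hs (sval p.1) * (b 0 o1 * cc x - b 0 o0 * ss x) * h).
Proof.
have uh : unif_deriv (unit_itv (R := R)) (fun x (p : U * U) => hs (sval p.1)) (fun _ _ _ => 0).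
  by apply: Cst; exact: Bhs.
have uc : unif_deriv (unit_itv (R := R))
    (fun x (p : U * U) => hc (sval p.1) * (b 0 o2 * pc (sval p.2) + b 0 o3 * ps (sval p.2)))
    (fun _ _ _ => 0).
  apply: Cst; apply: boundedM; first exact: Bhc.
  by apply: boundedD; apply: boundedM; rewrite //; exact: bounded_cst.
apply: eq_unif_deriv (unif_derivD (unif_derivM uh (unif_derivD
  (unif_derivZ (b 0 o0) (dcc (U * U))) (unif_derivZ (b 0 o1) (dss (U * U))))) uc) _ _ => // *.
by ring.
Qed.

Let dt2 : unif_deriv (unit_itv (R := R)) (fun y (p : U * U) => t (sval p.1) y (sval p.2))
  (fun y p h => pi / 2 * (hc y * (b 0 o0 * cc (sval p.1) + b 0 o1 * ss (sval p.1)) -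
    hs y * (b 0 o2 * pc (sval p.2) + b 0 o3 * ps (sval p.2))) * h).
Proof.
have u1 : unif_deriv (unit_itv (R := R))
    (fun y (p : U * U) => b 0 o0 * cc (sval p.1) + b 0 o1 * ss (sval p.1)) (fun _ _ _ => 0).
  by apply: Cst; apply: boundedD; apply: boundedM; rewrite //; exact: bounded_cst.
have u2 : unif_deriv (unit_itv (R := R))
    (fun y (p : U * U) => b 0 o2 * pc (sval p.2) + b 0 o3 * ps (sval p.2)) (fun _ _ _ => 0).
  by apply: Cst; apply: boundedD; apply: boundedM; rewrite //; exact: bounded_cst.
apply: eq_unif_deriv (unif_derivD (unif_derivM (dhs (U * U)) u1) (unif_derivM (dhc (U * U)) u2)) _ _ => // *.
by rewrite /hc /hs; ring.
Qed.

Let dt3 : unif_deriv (unit_itv (R := R)) (fun z (p : U * U) => t (sval p.1) (sval p.2) z)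
  (fun z p h => 2 * pi * hc (sval p.2) * (b 0 o3 * pc z - b 0 o2 * ps z) * h).
Proof.
have uh : unif_deriv (unit_itv (R := R)) (fun z (p : U * U) => hc (sval p.2)) (fun _ _ _ => 0).
  by apply: Cst; exact: Bhc.
have uc : unif_deriv (unit_itv (R := R))
    (fun z (p : U * U) => hs (sval p.2) * (b 0 o0 * cc (sval p.1) + b 0 o1 * ss (sval p.1)))
    (fun _ _ _ => 0).
  apply: Cst; apply: boundedM; first exact: Bhs.
  by apply: boundedD; apply: boundedM; rewrite //; exact: bounded_cst.
apply: eq_unif_deriv (unif_derivD uc (unif_derivM uh (unif_derivD
  (unif_derivZ (b 0 o2) (dpc (U * U))) (unif_derivZ (b 0 o3) (dps (U * U)))))) _ _ => // *.
by rewrite /pc /ps; ring.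
Qed.

Let df1 := unif_deriv_inv_sq d0 (fun x (p : U * U) _ => dt x (sval p.1) (sval p.2)) dt1.
Let df2 := unif_deriv_inv_sq d0 (fun y (p : U * U) _ => dt (sval p.1) y (sval p.2)) dt2.
Let df3 := unif_deriv_inv_sq d0 (fun z (p : U * U) _ => dt (sval p.1) (sval p.2) z) dt3.

(* The infinitesimal rotation in the plane of the coordinates [j] and [l] has
   mean 0: multiplied by the weight, it is a divergence in Hopf coordinates. *)
Definition rotation_mean (j l : 'I_4) := triple_mean (fun i =>
  hopf_weight i * (2 * (A - dotv b (hopf i)) ^- 3 *
    (b 0 l * hopf i 0 j - b 0 j * hopf i 0 l))).

(** This rotation moves the first angle only; its speed [om] is precisely the factor of the weight
    that depends on that angle. *)
Lemma rotation_mean01 : rotation_mean o0 o1 = 0.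
Proof.
have uc : unif_deriv (unit_itv (R := R)) (fun x (p : U * U) => hs (sval p.1) * hc (sval p.1))
    (fun _ _ _ => 0).
  by apply: Cst; apply: boundedM; rewrite //.
have := triple_mean_deriv1 (unif_derivM uc df1) => <-.
  apply: eq_mean => -[x [y z]]; rewrite dotv_hopf_point /hopf /hopf_weight /=.
  by have [-> -> _ _] := vec4E (hs (sval y) * cc (sval x)) (hs (sval y) * ss (sval x)) (hc (sval y) * pc (sval z)) (hc (sval y) * ps (sval z)); ring.
by move=> p; rewrite /t (circle_cos01 circ) (circle_sin01 circ).
Qed.

Let pc01 : pc 1 = pc 0. Proof. by rewrite /pc mulr1 mulr0 cos0 mulrC -[LHS]/(cos (pi * 2)) mulr_natr cos2pi. Qed.
Let ps01 : ps 1 = ps 0. Proof. by rewrite /ps mulr1 mulr0 sin0 mulrC mulr_natr sin2pi. Qed.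

Lemma rotation_mean23 : rotation_mean o2 o3 = 0.
Proof.
have uc : unif_deriv (unit_itv (R := R))
    (fun z (p : U * U) => om (sval p.1) * (hs (sval p.2) * hc (sval p.2)) * (2 * pi)^-1)
    (fun _ _ _ => 0).
  apply: Cst; apply: boundedM; last exact: bounded_cst.
  apply: boundedM; first exact: Bom.
  by apply: boundedM; [exact: Bhs|exact: Bhc].
have := triple_mean_deriv3 (unif_derivM uc df3) => <-.
  apply: eq_mean => -[x [y z]]; rewrite dotv_hopf_point /hopf /hopf_weight /=.
  have [_ _ -> ->] := vec4E (hs (sval y) * cc (sval x)) (hs (sval y) * ss (sval x)) (hc (sval y) * pc (sval z)) (hc (sval y) * ps (sval z)).
  rewrite mul0r add0r; move: (_ ^- 3) => q; move: two_pi_neq0; move: (2 * pi) => P P0; field.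
  exact: P0.
by move=> p; rewrite /t pc01 ps01.
Qed.

(** The generator of this rotation has components along all three Hopf coordinates. The terms [v1],
    [v2] and [v3] are the derivatives of the corresponding fluxes: weight times component times
    [(A - dotv b xi) ^- 2]. The angular fluxes are periodic, and the latitude flux vanishes at both
    ends through its factor [hs * hc]. *)
Lemma rotation_mean02 : rotation_mean o0 o2 = 0.
Proof.
have mE := @triple_mean_is_mean R.
have u1 : unif_deriv (unit_itv (R := R))
    (fun y (p : U * U) => - (pi / 2)^-1 * (om (sval p.1) * (cc (sval p.1) * pc (sval p.2)))) (fun _ _ _ => 0).
  apply: Cst; apply: boundedM; first exact: bounded_cst.
  by apply: boundedM; rewrite //; apply: boundedM; rewrite //.
have u2 : unif_deriv (unit_itv (R := R))
    (fun x (p : U * U) => hc (sval p.1) ^+ 2 * pc (sval p.2)) (fun _ _ _ => 0).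
  by apply: Cst; apply: boundedM; rewrite //; apply: boundedM; rewrite //.
have u3 : unif_deriv (unit_itv (R := R))
    (fun z (p : U * U) => - (2 * pi)^-1 * (om (sval p.1) * (hs (sval p.2) ^+ 2 * cc (sval p.1)))) (fun _ _ _ => 0).
  apply: Cst; apply: boundedM; first exact: bounded_cst.
  by apply: boundedM; rewrite //; apply: boundedM; rewrite //; apply: boundedM; rewrite //.
have v1 := unif_derivM u1 (unif_derivM (unif_derivM (dhs (U * U)) (dhc (U * U))) df2).
have v2 := unif_derivM u2 (unif_derivM (dss (U * U)) df1).
have v3 := unif_derivM u3 (unif_derivM (dps (U * U)) df3).
have e1 := triple_mean_deriv2 v1; have e2 := triple_mean_deriv1 v2.
have e3 := triple_mean_deriv3 v3.
have b1 := unif_deriv_bounded (fun i : U * (U * U) => i.2.1) (fun i => (i.1, i.2.2)) v1.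
have b2 := unif_deriv_bounded (fun i : U * (U * U) => i.1) (fun i => i.2) v2.
have b3 := unif_deriv_bounded (fun i : U * (U * U) => i.2.2) (fun i => (i.1, i.2.1)) v3.
have {}e1 := e1 _; have {}e2 := e2 _; have {}e3 := e3 _.
transitivity (0 + 0 + 0 : R); last by rewrite !addr0.
rewrite -[X in _ = X + _ + _]e1; last first.
  by move=> p; rewrite !mulr1 !mulr0 cos0 sin0 cos_pihalf; ring.
rewrite -[X in _ = _ + X + _]e2; last first.
  by move=> p; rewrite (circle_sin01 circ) /t (circle_cos01 circ) (circle_sin01 circ).
rewrite -[X in _ = _ + X]e3; last first.
  by move=> p; rewrite -!/(ps _) ps01 /t ps01 pc01.
rewrite -(meanD mE b1 b2) -(meanD mE (boundedD b1 b2) b3).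
apply: eq_mean => -[x [y z]]; rewrite dotv_hopf_point /hopf /hopf_weight /=.
have [-> _ -> _] := vec4E (hs (sval y) * cc (sval x)) (hs (sval y) * ss (sval x)) (hc (sval y) * pc (sval z)) (hc (sval y) * ps (sval z)).
move: (circle_eq circ (sval x)) (psc (sval z)).
rewrite -/(hs _) -/(hc _) -/(pc _) -/(ps _) -!exprVn /t.
move: (hs _) (hc _) (cc _) (ss _) (pc _) (ps _) (om _) ((A - _)^-1).
move: half_pi_neq0 two_pi_neq0; move: (pi / 2) (2 * pi).
move=> H P H0 P0 S C c r p q o k f1 f2.
(* Homogenising with the two circle equations makes the sum of the three fluxes an algebraic
   identity. *)
transitivity (o * (S * C) * (2 * k ^+ 3 * (b 0 o2 * (S * c) * (p ^+ 2 + q ^+ 2)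
    - b 0 o0 * (C * p) * (c ^+ 2 + r ^+ 2)))).
  by rewrite f1 f2 !mulr1.
by field; rewrite H0 P0.
Qed.

End Rotation.
End Hopf.

Section Scaling.
Context {R : realType}.

Lemma line_is_derive (V : normedModType R) (f : V -> R) (y v : V) (d : R) :
  is_derive 0 (1 : R) (fun s => f (y + s *: v)) d -> is_derive y v f d.
Proof.
have e : (fun h : R => h^-1 *: (f (y + (h *: 1 + (0 : R)) *: v) - f (y + (0 : R) *: v)))
   = (fun h => h^-1 *: (f (h *: v + y) - f y)).
  apply/funext => h; rewrite scale0r !addr0; congr (_ *: (f _ - _)).
  by rewrite [h *: 1]mulr1 addrC.
by move=> [df dE]; split; [move: df; rewrite /derivable|move: dE; rewrite /derive]; rewrite e.
Qed.

Lemma is_derive_scale (V : normedModType R) (f : V -> R) (a : R) (y v : V) (d : R) :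
  is_derive (a *: y) v f d -> is_derive y v (fun w => f (a *: w)) (a * d).
Proof.
move=> fd; apply: line_is_derive.
have fd' : is_derive (a * 0) (1 : R) (fun s => f (a *: y + s *: v)) d.
  by apply: is_derive_line; rewrite mulr0 scale0r addr0.
have gd : is_derive (0 : R) (1 : R) (fun s => a * s) a.
  rewrite (_ : (fun s => a * s) = (fun s => 0 + a * s)); last by apply/funext => s; rewrite add0r.
  exact: is_derive_affine.
have := is_derive1_comp fd' gd; rewrite mulrC.
rewrite (_ : _ \o _ = fun s => f (a *: (y + s *: v)))//.
by apply/funext => s /=; rewrite scalerDr scalerA.
Qed.

End Scaling.

(** * Mass one of the Poisson kernel in Hopf coordinates *)

Section HopfMass.
Context {R : realType}.
Local Notation T := 'rV[R]_4.
Local Notation U := (unitI R).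
Context {cc ss om : R -> R} (circ : circle_param cc ss om).
Local Notation hopf := (@hopf R cc ss).
Local Notation hopf_weight := (@hopf_weight R om).
Local Notation rotation_mean := (@rotation_mean R cc ss om).

Definition inv_sq_mean (A : R) (b : T) : R :=
  triple_mean (fun i => hopf_weight i * (A - dotv b (hopf i)) ^- 2).

Definition set_coords (b : T) (j l : 'I_4) (x y : R) : T :=
  \row_k if k == j then x else if k == l then y else b 0 k.

Lemma dotv_set_coords (b v : T) (j l : 'I_4) x y : j != l ->
  dotv (set_coords b j l x y) v =
  dotv b v + (x - b 0 j) * v 0 j + (y - b 0 l) * v 0 l.
Proof.
move=> jl; have -> : dotv (set_coords b j l x y) v = dotv b v + \sum_k
    (if k == j then x - b 0 j else if k == l then y - b 0 l else 0) * v 0 k.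
  rewrite -big_split; apply: eq_bigr => k _ /=; rewrite mxE.
  by case: eqVneq => [->|_]; [ring|case: eqVneq => [->|_]; ring].
rewrite (bigD1 j)//= (bigD1 l)//=; last by rewrite eq_sym.
rewrite !eqxx eq_sym (negbTE jl) big1 ?addr0 ?addrA// => k /andP[/negbTE-> /negbTE->].
by rewrite mul0r.
Qed.

Lemma sq_set_coords (b : T) (j l : 'I_4) x y : j != l ->
  dotv (set_coords b j l x y) (set_coords b j l x y) =
  dotv b b - b 0 j ^+ 2 - b 0 l ^+ 2 + x ^+ 2 + y ^+ 2.
Proof.
move=> jl; rewrite dotv_set_coords// dotvC dotv_set_coords//.
by rewrite !mxE !eqxx eq_sym (negbTE jl); ring.
Qed.

(** Turning [b] through the angle [a * t] changes the mean at a rate proportional to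
    [rotation_mean], hence not at all; at [t = 0] the coordinate [l] has become 0. *)
Lemma inv_sq_mean_rotate (A : R) (b : T) (j l : 'I_4) : j != l -> 0 < A ->
  dotv b b < A ^+ 2 ->
  (forall b' : T, dotv b' b' < A ^+ 2 -> rotation_mean b' A j l = 0) ->
  exists2 r, 0 <= r & r ^+ 2 = b 0 j ^+ 2 + b 0 l ^+ 2 /\
    inv_sq_mean A b = inv_sq_mean A (set_coords b j l r 0).
Proof.
move=> jl A0 bA rot; have mE := @triple_mean_is_mean R.
have [r [a [r0 bj bl rE]]] := polar_coordinates (b 0 j) (b 0 l).
exists r; first exact: r0.
split; first exact: rE.
pose B (t : R) := set_coords b j l (r * cos (a * t)) (r * sin (a * t)).
have BB t : dotv (B t) (B t) = dotv b b.
  rewrite sq_set_coords//.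
  transitivity (dotv b b - (b 0 j ^+ 2 + b 0 l ^+ 2)
    + r ^+ 2 * (cos (a * t) ^+ 2 + sin (a * t) ^+ 2)); first by ring.
  by rewrite cos2Dsin2 -rE; ring.
pose d := A - enorm b.
have d0 : 0 < d.
  by rewrite subr_gt0 -(@ltr_pXn2r _ 2) ?nnegrE ?enorm_ge0 ?(ltW A0)// enorm_sqr.
have dB t i : d <= A - dotv (B t) (hopf i).
  rewrite lerB// (le_trans (ler_norm _))//.
  rewrite -(@ler_pXn2r _ 2) ?nnegrE ?enorm_ge0// real_normK ?num_real//.
  by rewrite (le_trans (cauchy_schwarz _ _))// (hopf_point_unit circ) mulr1 BB enorm_sqr.
have bh k : bounded_fct (fun i => hopf i 0 k).
  exists 1 => i; rewrite (le_trans (norm_coord_le _ _))// -(@expr_le1 _ 2)//.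
  by rewrite (le_trans (norm_le_enorm _))// (hopf_point_unit circ).
have u0 : unif_deriv (unit_itv (R := R))
    (fun t i => dotv b (hopf i) - b 0 j * hopf i 0 j - b 0 l * hopf i 0 l) (fun _ _ _ => 0).
  apply: unif_deriv_cst; do 2?apply: boundedB; rewrite //; try (apply: boundedM => //; exact: bounded_cst).
  exists (4 * (`|b| * 1)) => i; rewrite (le_trans (dotv_le_norm _ _))//.
  rewrite ler_wpM2l// ler_wpM2l// -(@expr_le1 _ 2)//.
  by rewrite (le_trans (norm_le_enorm _))// (hopf_point_unit circ).
have uB := unif_derivD u0 (unif_derivD
  (unif_derivM (unif_deriv_cst (bh j)) (unif_derivZ r (unif_deriv_cosZ _ a)))
  (unif_derivM (unif_deriv_cst (bh l)) (unif_derivZ r (unif_deriv_sinZ _ a)))).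
have {}uB : unif_deriv (unit_itv (R := R)) (fun t i => dotv (B t) (hopf i))
   (fun t i h => a * (B t 0 j * hopf i 0 l - B t 0 l * hopf i 0 j) * h).
  apply: eq_unif_deriv uB _ _ => [t i _|t i h _]; first by rewrite dotv_set_coords//; ring.
  by rewrite !mxE !eqxx eq_sym (negbTE jl); ring.
have uF := unif_derivM (unif_deriv_cst (bounded_hopf_weight circ)) (unif_deriv_inv_sq d0 (fun t i _ => dB t i) uB).
have uE := unif_deriv_mean mE (unif_deriv_reindex (fun p : unit * _ => p.2) uF).
have B1 : B 1 = b.
  apply/rowP => k; rewrite mxE mulr1 -bj -bl.
  by case: eqVneq => [->//|_]; case: eqVneq => [->|].
have B0 : B 0 = set_coords b j l r 0 by rewrite /B mulr0 cos0 sin0 mulr1 mulr0.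
rewrite -B0 -{1}B1; apply: (unif_deriv_const (i := tt) uE) => t _ /=.
transitivity (- a * rotation_mean (B t) A j l); last by rewrite rot ?mulr0// BB.
rewrite /rotation_mean -(meanZ mE); first by apply: eq_mean => i; ring.
apply: boundedM; first exact: (bounded_hopf_weight circ).
apply: boundedM.
  apply: boundedM; first exact: bounded_cst.
  exists (d ^- 3) => i; have h := dB t i; have h0 := lt_le_trans d0 h.
  rewrite normfV normrX gtr0_norm// lef_pV2 ?posrE ?exprn_gt0//.
  by rewrite lerXn2r ?nnegrE ?(ltW d0) ?(ltW h0).
by apply: boundedB; (apply: boundedM; [exact: bounded_cst|exact: bh]).
Qed.

(** Rotations in the planes (0,1), (2,3) and (0,2), in this order, suffice to bring any vector of
    [R^4] to the first axis. *)
Lemma inv_sq_mean_axis (A : R) (b : T) : 0 < A -> dotv b b < A ^+ 2 ->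
  inv_sq_mean A b = inv_sq_mean A (vec4 (enorm b) 0 0 0).
Proof.
move=> A0 bA.
have [r r0 [rE ->]] := @inv_sq_mean_rotate A b o0 o1 isT A0 bA
  (fun b' b'A => rotation_mean01 circ A0 b'A).
set c := set_coords _ _ _ _ _.
have cc' : dotv c c = dotv b b by rewrite sq_set_coords// rE expr0n /=; ring.
have cA : dotv c c < A ^+ 2 by rewrite cc'.
have [q q0 [qE ->]] := @inv_sq_mean_rotate A c o2 o3 isT A0 cA
  (fun b' b'A => rotation_mean23 circ A0 b'A).
set d := set_coords _ _ _ _ _.
have dd' : dotv d d = dotv b b by rewrite sq_set_coords// qE expr0n /= -cc'; ring.
have dA : dotv d d < A ^+ 2 by rewrite dd'.
have [p p0 [pE ->]] := @inv_sq_mean_rotate A d o0 o2 isT A0 dA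
  (fun b' b'A => rotation_mean02 circ A0 b'A).
set e := set_coords _ _ _ _ _.
have ee' : dotv e e = dotv b b by rewrite sq_set_coords// pE expr0n /= -dd'; ring.
have eE : e = vec4 p 0 0 0.
  by apply/rowP => -[[|[|[|[|//]]]] lt]; rewrite !mxE.
have -> : enorm b = p; last by rewrite -eE.
apply/eqP; rewrite -(@eqrXn2 _ 2) ?enorm_ge0// enorm_sqr -ee' eE.
by rewrite dotv_vec4; have [-> -> -> ->] := vec4E p 0 0 0; apply/eqP; ring.
Qed.

Lemma hopf_unit i : dotv (hopf i) (hopf i) = 1.
Proof. exact: (hopf_point_unit circ). Qed.

Let potential := @poisson_integral R _ (@triple_mean R) hopf hopf_weight (fun=> 1).
Let potential1 := @poisson_integral1 R _ (@triple_mean R) hopf hopf_weight (fun=> 1).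
Let potential2 := @poisson_integral2 R _ (@triple_mean R) hopf hopf_weight (fun=> 1).

Lemma potential_radial (y y' : T) : dotv y y < 1 -> dotv y y = dotv y' y' ->
  potential y = potential y'.
Proof.
(* On the sphere [|w - xi|^2 = A - dotv b xi] with [A = 1 + |w|^2] and [b = 2 *: w], and
   [A ^+ 2 - |b|^2 = (1 - |w|^2) ^+ 2] is positive. *)
have H w : dotv w w < 1 -> potential w =
    (1 - dotv w w) * inv_sq_mean (1 + dotv w w) (vec4 (enorm (2 *: w)) 0 0 0).
  move=> w1; have w0 := dotv_ge0 w; rewrite -inv_sq_mean_axis; last 2 first.
  - by rewrite ltr_pwDl.
  - rewrite dotvZl dotvZr -subr_gt0 (_ : _ - _ = (1 - dotv w w) ^+ 2); last by ring.
    by rewrite exprn_gt0// subr_gt0.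
  have mE := triple_mean_is_mean (R := R).
  have d0 : 1 - dotv w w != 0 by rewrite gt_eqF// subr_gt0.
  have e i : poisson (hopf i) w * hopf_weight i =
      (1 - dotv w w) * (hopf_weight i * (1 + dotv w w - dotv (2 *: w) (hopf i)) ^- 2).
    rewrite /poisson /newton dotvZl -exprVn.
    rewrite (_ : dotv (w - hopf i) _ = 1 + dotv w w - 2 * dotv w (hopf i)); first ring.
    by rewrite dotvBl !dotvBr hopf_unit [dotv (hopf i) w]dotvC; ring.
  have bPw : bounded_fct (fun i => poisson (hopf i) w * hopf_weight i).
    by apply: boundedM; [exact: (poisson_bounded hopf_unit)|exact: (bounded_hopf_weight circ)].
  have bF := boundedM (bounded_cst _ (1 - dotv w w)^-1) bPw.
  rewrite /inv_sq_mean -(meanZ mE).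
    by apply: eq_mean => i; rewrite mulr1 e.
  case: bF => M HM; exists M => i; move: (HM i); rewrite e mulKf//.
move=> y1 yy'; have y'1 : dotv y' y' < 1 by rewrite -yy'.
rewrite (H _ y1) (H _ y'1) -yy'.
have -> : enorm (2 *: y') = enorm (2 *: y) by rewrite /enorm !dotvZl !dotvZr yy'.
exact: erefl.
Qed.

Let pot_cont y (y1 : dotv y y < 1) : {for y, continuous potential}.
Proof.
exact: (poisson_integral_continuous (triple_mean_is_mean (R := R)) hopf_unit
  (bounded_hopf_weight circ) (bounded_cst _ 1)).
Qed.

(** A radial harmonic function is constant: on the ball of radius [|y|] it has the boundary value
    [potential y], so by the maximum principle it has this value at the centre as well. *)
Lemma potential_constant (y : T) : dotv y y < 1 -> potential y = potential 0.
Proof.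
move=> y1; have mE := triple_mean_is_mean (R := R).
have bw := bounded_hopf_weight circ; have b1 := bounded_cst (U * (U * U)) (1 : R).
have z00 : dotv (0 : T) 0 = 0 by rewrite -(scale0r 0) dotvZl mul0r.
pose a := enorm y.
have aa (w : T) : dotv (a *: w) (a *: w) = dotv y y * dotv w w.
  by rewrite dotvZl dotvZr mulrA -expr2 enorm_sqr.
have aw (w : T) : dotv w w < 1 -> dotv (a *: w) (a *: w) < 1.
  move=> w1; rewrite aa (le_lt_trans _ w1)// ler_piMl ?dotv_ge0// ltW//.
apply/eqP; rewrite eq_sym -subr_eq0; apply/eqP.
rewrite -{1}(scaler0 _ a).
apply: (@harmonic_eq0 R 3 (fun w => potential (a *: w) - potential y)
  (fun j w => a * potential1 j (a *: w)) (fun j w => a * (a * potential2 j j (a *: w)))).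
- move=> w w1; have c1 : {for w, continuous (fun w : T => potential (a *: w))}.
    apply: (@continuous_comp _ _ _ (fun w : T => a *: w) potential); last exact: (pot_cont (aw _ w1)).
    exact: scaler_continuous.
  by apply: (cvgB c1); exact: cvg_cst.
- move=> w j w1.
  have H := is_derive_scale (is_derive_poisson_integral mE hopf_unit bw b1 j (aw w w1)).
  by have := is_deriveB H (is_derive_cst (potential y) w (delta_mx 0 j)); rewrite subr0.
- move=> w j w1.
  have H := is_derive_scale (is_derive_poisson_integral1 mE hopf_unit bw b1 j j (aw w w1)).
  exact: (is_deriveZ a H).
- move=> w w1; rewrite -2!mulr_sumr.
  by rewrite (poisson_integral_harmonic mE hopf_unit bw b1 (aw w w1)) !mulr0.
- move=> e e0.
  have ct : (fun t : R => t *: y) @ (1 : R) --> y.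
    by rewrite -{2}[y]scale1r; apply: cvgZr_tmp; exact: cvg_id.
  have /cvgrPdist_lt/(_ e e0)/ct[d /= d0 hd] := pot_cont y1.
  exists (1 - d); first by rewrite ltrBlDr ltrDl.
  move=> w /andP[rw w1].
  have w0 := dotv_ge0 w; have sw : Num.sqrt (dotv w w) ^+ 2 = dotv w w by rewrite sqr_sqrtr.
  (* Radiality moves the point to the ray through [y], where continuity at the single point [y]
     controls it. *)
  rewrite (potential_radial (y' := Num.sqrt (dotv w w) *: y) (aw _ w1)); last first.
    by rewrite aa dotvZl dotvZr mulrA -expr2 sw mulrC.
  rewrite distrC; apply/ltW/hd => /=.
  have s1 : Num.sqrt (dotv w w) <= 1 by rewrite -[leRHS]sqrtr1 ler_wsqrtr// ltW.
  rewrite ger0_norm ?subr_ge0// ltrBlDr -ltrBlDl (lt_le_trans rw)//.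
  by rewrite -{1}sw expr2 ler_piMr// sqrtr_ge0.
- by rewrite z00.
Qed.

Lemma unit_mean_sin_cos :
  unit_mean (fun b : U => sin (pi / 2 * sval b) * cos (pi / 2 * sval b)) = pi^-1 :> R.
Proof.
have s := @unif_deriv_sinZ R unit (pi / 2).
have := unit_mean_unif_deriv tt (unif_derivZ pi^-1 (unif_derivM s s)).
rewrite !mulr1 mulr0 sin0 sin_pihalf mulr0 mulr0 subr0 !mulr1 => <-.
apply: eq_mean => b; have p0 : (pi : R) != 0 by rewrite lt0r_neq0// pi_gt0.
by move: (sin _) (cos _) => x y; move: p0; move: pi => P P0; field.
Qed.

Lemma hopf_total_gt0 : 0 < triple_mean hopf_weight.
Proof.
have mU := @unit_mean_is_mean R; have [d d0 [C omC]] := circle_speed circ.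
have bs : bounded_fct (fun b : U => sin (pi / 2 * sval b) * cos (pi / 2 * sval b)).
  exists 1 => b.
  by rewrite normrM mulr_ile1// ler_norml ?sin_geN1 ?sin_le1 ?cos_geN1 ?cos_le1.
have bo : bounded_fct (fun a : U => om (sval a)).
  by exists C => a; have /andP[h1 h2] := omC (sval a); rewrite ger0_norm// (le_trans (ltW d0)).
have -> : triple_mean hopf_weight = unit_mean (fun a : U => pi^-1 * om (sval a)).
  rewrite /triple_mean; apply: eq_mean => a; rewrite mulrC -unit_mean_sin_cos -(meanZ mU)//.
  apply: eq_mean => b.
  exact: (mean_cst mU (om (sval a) * (sin (pi / 2 * sval b) * cos (pi / 2 * sval b)))).
rewrite (meanZ mU)// mulr_gt0// ?invr_gt0 ?pi_gt0//.
apply: (lt_le_trans d0); rewrite -[d](mean_cst mU); apply: (le_mean mU) => //.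
  exact: bounded_cst.
by move=> a; have /andP[] := omC (sval a).
Qed.

Definition hopf_density (i : U * (U * U)) : R := hopf_weight i / triple_mean hopf_weight.

Lemma bounded_hopf_density : bounded_fct hopf_density.
Proof. by apply: boundedM; [exact: (bounded_hopf_weight circ)|exact: bounded_cst]. Qed.

Lemma hopf_density_ge0 i : 0 <= hopf_density i.
Proof. by rewrite divr_ge0 ?(hopf_weight_ge0 circ)// ltW// hopf_total_gt0. Qed.

Lemma hopf_mass (y : T) : dotv y y < 1 ->
  triple_mean (fun i => poisson (hopf i) y * hopf_density i) = 1.
Proof.
move=> y1; have mE := triple_mean_is_mean (R := R).
have bP := boundedM (poisson_bounded hopf_unit y1) (bounded_hopf_weight circ).
transitivity ((triple_mean hopf_weight)^-1 * potential y).
  rewrite -(meanZ mE).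
    by apply: eq_mean => i; rewrite /hopf_density mulr1; ring.
  by case: bP => M HM; exists M => i; rewrite mulr1.
rewrite potential_constant//.
have -> : potential 0 = triple_mean hopf_weight.
  apply: eq_mean => i; rewrite /poisson /newton sub0r dotvNl dotvNr opprK hopf_unit.
  by rewrite -(scale0r 0) dotvZl; field.
by rewrite mulVf// lt0r_neq0// hopf_total_gt0.
Qed.

End HopfMass.

(** * Projective automorphisms of the sphere *)

Section NewtonPoint.
Context {R : realType}.
Local Notation T := 'rV[R]_4.
Variables (z y : T).
Hypothesis yz : y != z.

Let smooth_newton_near : exists2 D : set T, nbhs y D &
  smooth_kernel D (fun y (_ : unit) => newton z y)
    (fun j y _ => newton1 z j y) (fun j l y _ => newton2 z j l y).
Proof.
have d0 : 0 < dotv (y - z) (y - z) by rewrite dotv_gt0// subr_eq0.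
(* A neighbourhood of [y] that is bounded and stays away from the pole [z]. *)
exists [set v : T | dotv v v < dotv y y + 1 /\
    dotv (y - z) (y - z) / 2 < dotv (v - z) (v - z)].
  apply: filterI; first by apply: nbhs_ball_sq; rewrite ltrDl.
  have c : {for y, continuous (fun v : T => dotv (v - z) (v - z))}.
    have cf : {for y, continuous (fun v : T => v - z)}.
      by apply: (@cvgB _ _ _ (nbhs y) _ id (cst z)); [exact: cvg_id|exact: cvg_cst].
    exact: (continuous_dotv cf cf).
  have /c : nbhs (dotv (y - z) (y - z)) [set x | dotv (y - z) (y - z) / 2 < x].
    by apply: lt_nbhsr; rewrite ltr_pdivrMr// ltr_pMr// ltr1n.
  by [].
apply: (@smooth_newton R unit _ (fun=> z) (dotv y y + 2) `|z| (dotv (y - z) (y - z) / 2)).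
- move=> v [/ltW vy _]; have [h|h] := leP `|v| 1.
    by rewrite (le_trans h)// ler_wpDl ?dotv_ge0// ler1n.
  have : `|v| <= `|v| ^+ 2 by rewrite expr2 ler_peMr// ltW.
  by move=> /le_trans; apply; rewrite (le_trans (norm_le_enorm v))// (le_trans vy)// lerD2l ler1n.
- by [].
- by rewrite divr_gt0.
- by move=> v _ [_ /ltW].
Qed.

Lemma newton_continuous : {for y, continuous (newton z)}.
Proof.
have [D yD [g _ _]] := smooth_newton_near.
exact: (unif_deriv_continuous (i := tt) g yD).
Qed.

Lemma is_derive_newton j : is_derive y (delta_mx 0 j) (newton z) (newton1 z j y).
Proof.
have [D yD [g _ _]] := smooth_newton_near.
exact: (kernel_grad_is_derive tt j g yD).
Qed.

Lemma is_derive_newton1 j l :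
  is_derive y (delta_mx 0 l) (newton1 z j) (newton2 z j l y).
Proof.
have [D yD [_ g _]] := smooth_newton_near.
exact: (kernel_grad_is_derive tt l (g j) yD).
Qed.

End NewtonPoint.

Section Klein.
Context {R : realType}.
Local Notation T := 'rV[R]_4.
Context {I : Type} {E : (I -> R) -> R} (mE : is_mean E).
Context {xi : I -> T} {J : I -> R}.
Hypothesis xi1 : forall i, dotv (xi i) (xi i) = 1.
Hypothesis J0 : forall i, 0 <= J i.
Hypothesis bJ : bounded_fct J.
Hypothesis mass : forall y, dotv y y < 1 -> E (fun i => poisson (xi i) y * J i) = 1.

Variable k : R.
Hypothesis k01 : 0 < k < 1.
(** The parameter [k] is the tangent of half the angle with sine [klein_p] and cosine [klein_b]. It
    keeps both rational and places the pole of the auxiliary Newton potential at [- k^-1] on the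
    first axis. *)
Definition klein_p := 2 * k / (1 + k ^+ 2).
Definition klein_b := (1 - k ^+ 2) / (1 + k ^+ 2).
Local Notation p := klein_p.
Local Notation b := klein_b.

Definition klein_den (i : I) := 1 + p * xi i 0 o0.

Definition klein (i : I) : T := (klein_den i)^-1 *:
  vec4 (p + xi i 0 o0) (b * xi i 0 o1) (b * xi i 0 o2) (b * xi i 0 o3).

(** The cubed factor is the Jacobian of the automorphism on the three-dimensional sphere;
    [klein_mass] is what justifies it. *)
Definition klein_density (i : I) : R := J i * (b / klein_den i) ^+ 3.

Let k2 : 0 < 1 + k ^+ 2. Proof. by rewrite ltr_pwDl// sqr_ge0. Qed.
Let kk : k ^+ 2 < 1.
Proof. by have /andP[k0 k1] := k01; rewrite expr_lt1// ltW. Qed.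

Lemma klein_p_bounds : 0 < p < 1.
Proof.
have /andP[k0 k1] := k01; rewrite divr_gt0 ?mulr_gt0//= ltr_pdivrMr// mul1r.
by rewrite -subr_gt0 (_ : _ - _ = (1 - k) ^+ 2); [rewrite exprn_gt0// subr_gt0|ring].
Qed.

Lemma klein_b_gt0 : 0 < b.
Proof. by rewrite divr_gt0// subr_gt0. Qed.

Lemma klein_bp : b ^+ 2 = 1 - p ^+ 2.
Proof. by rewrite /b /p; field; rewrite gt_eqF. Qed.

Lemma klein_den_ge i : 1 - p <= klein_den i.
Proof.
have /andP[p0 p1] := klein_p_bounds.
have : `|xi i 0 o0| <= 1.
  rewrite (le_trans (norm_coord_le _ _))// -(@expr_le1 _ 2)//.
  by rewrite (le_trans (norm_le_enorm _))// xi1.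
rewrite ler_norml => /andP[x0 _].
by rewrite lerD2l -[- p]mulrN1 ler_wpM2l// ltW.
Qed.

Lemma klein_den_gt0 i : 0 < klein_den i.
Proof.
have /andP[p0 p1] := klein_p_bounds; apply: lt_le_trans (klein_den_ge i).
by rewrite subr_gt0.
Qed.

Let xi4 i : xi i 0 o1 ^+ 2 + xi i 0 o2 ^+ 2 + xi i 0 o3 ^+ 2 = 1 - xi i 0 o0 ^+ 2.
Proof. by have := xi1 i; rewrite dotv4 => <-; ring. Qed.

Lemma klein_unit i : dotv (klein i) (klein i) = 1.
Proof.
rewrite dotvZl dotvZr dotv_vec4; have [-> -> -> ->] := vec4E (p + xi i 0 o0)
  (b * xi i 0 o1) (b * xi i 0 o2) (b * xi i 0 o3).
transitivity ((klein_den i)^-1 ^+ 2 * ((p + xi i 0 o0) ^+ 2 +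
   b ^+ 2 * (xi i 0 o1 ^+ 2 + xi i 0 o2 ^+ 2 + xi i 0 o3 ^+ 2))); first by ring.
rewrite xi4 klein_bp (_ : _ + _ = klein_den i ^+ 2); last by rewrite /klein_den; ring.
by rewrite -exprMn mulVf ?expr1n// gt_eqF// klein_den_gt0.
Qed.

Lemma klein_density_ge0 i : 0 <= klein_density i.
Proof.
by rewrite mulr_ge0// exprn_ge0// divr_ge0 ?ltW ?klein_b_gt0 ?klein_den_gt0.
Qed.

Lemma bounded_klein_density : bounded_fct klein_density.
Proof.
apply: boundedM => //; exists ((b / (1 - p)) ^+ 3) => i.
have /andP[p0 p1] := klein_p_bounds.
have b0 := klein_b_gt0; have d0 := klein_den_gt0 i.
have p1' : 0 < 1 - p by rewrite subr_gt0.
rewrite normrX ger0_norm; last by rewrite divr_ge0// ltW.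
rewrite lerXn2r ?nnegrE; [by []|by rewrite divr_ge0// ltW|by rewrite divr_ge0// ltW|].
by rewrite ler_wpM2l ?(ltW b0)// lef_pV2 ?posrE ?klein_den_ge.
Qed.

Let pole : T := vec4 (- k^-1) 0 0 0.
(** Normalised so that on the sphere it equals [(klein_den i)^-1]; this is the harmonic function
    that the Poisson formula is applied to. *)
Let h (y : T) : R := (1 + k ^+ 2) / k ^+ 2 * newton pole y.

Let hE y : h y = (1 + k ^+ 2) / (1 + 2 * k * y 0 o0 + k ^+ 2 * dotv y y).
Proof.
have /andP[k0 k1] := k01; have kn : k != 0 by rewrite gt_eqF.
have e : dotv (y - pole) (y - pole) = (1 + 2 * k * y 0 o0 + k ^+ 2 * dotv y y) / k ^+ 2.
  have pp : dotv pole pole = k ^- 2.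
    by rewrite dotv_vec4; have [-> -> -> ->] := vec4E (- k^-1 : R) 0 0 0; field.
  have yp : dotv y pole = - (y 0 o0 / k) by rewrite dotv_vec4; ring.
  by rewrite dotvBl !dotvBr [dotv pole y]dotvC pp yp; field.
by rewrite /h /newton e invf_div mulrA divfK// expf_neq0.
Qed.

Let pole_neq y : dotv y y <= 1 -> y != pole.
Proof.
have /andP[k0 k1] := k01; move=> y1; apply/eqP => yE; move: y1; rewrite yE dotv_vec4.
have [-> -> -> ->] := vec4E (- k^-1 : R) 0 0 0; rewrite !mulr0 !addr0 mulrNN leNgt.
by rewrite -invfM invf_gt1 ?mulr_gt0// -expr2 kk.
Qed.

Let h_formula (y : T) : dotv y y < 1 -> bounded_fct (fun i => h (xi i)) /\
  h y = E (fun i => poisson (xi i) y * (J i * h (xi i))).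
Proof.
move=> y1.
have [||||bh hf] := @poisson_formula R I E mE xi J xi1 J0 bJ mass h
  (fun j y => (1 + k ^+ 2) / k ^+ 2 * newton1 pole j y)
  (fun j y => (1 + k ^+ 2) / k ^+ 2 * newton2 pole j j y).
- move=> w /pole_neq w1; have c1 := newton_continuous w1.
  exact: (cvgZl_tmp (k := (1 + k ^+ 2) / k ^+ 2) c1).
- by move=> w j /ltW/pole_neq w1; exact: (is_deriveZ ((1 + k ^+ 2) / k ^+ 2) (is_derive_newton w1 j)).
- by move=> w j /ltW/pole_neq w1; exact: (is_deriveZ ((1 + k ^+ 2) / k ^+ 2) (is_derive_newton1 w1 j j)).
- move=> w /ltW/pole_neq w1; rewrite -mulr_sumr newton_harmonic ?mulr0//.
  by rewrite dotv_eq0 subr_eq0.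
by split; last exact: hf.
Qed.

(** The Poisson kernel at [y], composed with the automorphism and multiplied by the density, is
    [b ^+ 2 / mu] times the Poisson kernel at another interior point [w] times [h]. The Poisson
    formula evaluates the mean as [b ^+ 2 / mu * h w], which is 1. *)
Lemma klein_mass y : dotv y y < 1 ->
  E (fun i => poisson (klein i) y * klein_density i) = 1.
Proof.
move=> y1.
have /andP[p0 p1] := klein_p_bounds; have b0 := klein_b_gt0.
have AM (M B : R) : 0 < M -> 0 < B ->
    1 + (M ^+ 2 - B ^+ 2) / (2 * ((M + B) / 2)) ^+ 2 = M / ((M + B) / 2).
  by move=> M0 B0; have MB : M + B != 0 by [rewrite gt_eqF// addr_gt0]; field.
have AB (M B : R) : 0 < M -> 0 < B ->
    1 - (M ^+ 2 - B ^+ 2) / (2 * ((M + B) / 2)) ^+ 2 = B / ((M + B) / 2).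
  by move=> M0 B0; have MB : M + B != 0 by [rewrite gt_eqF// addr_gt0]; field.
(* These make [klein_den i * |y - klein i|^2] equal to the affine function [M + dotv N (xi i)]. To
   write it as [mu * |w - xi i|^2] one needs [mu * (1 + |w|^2) = M] and [- 2 * mu * w = N]; as
   [|N|^2 = M ^+ 2 - B ^+ 2], the root with [|w| < 1] is [mu = (M + B) / 2]. *)
pose a := dotv y y; pose B := b * (1 - a); pose M := 1 + a - 2 * p * y 0 o0.
pose mu := (M + B) / 2.
pose N : T := vec4 (p * (1 + a) - 2 * y 0 o0) (- 2 * b * y 0 o1) (- 2 * b * y 0 o2) (- 2 * b * y 0 o3).
have B0 : 0 < B by rewrite mulr_gt0// subr_gt0.
have aE : a = y 0 o0 ^+ 2 + y 0 o1 ^+ 2 + y 0 o2 ^+ 2 + y 0 o3 ^+ 2 by rewrite /a dotv4; ring.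
have M0 : 0 < M.
  have s1 := sqr_ge0 (y 0 o1); have s2 := sqr_ge0 (y 0 o2); have s3 := sqr_ge0 (y 0 o3).
  have s4 := sqr_ge0 (y 0 o0 - p).
  have bb : 0 < b ^+ 2 by rewrite exprn_gt0.
  have -> : M = b ^+ 2 + (y 0 o0 - p) ^+ 2 + y 0 o1 ^+ 2 + y 0 o2 ^+ 2 + y 0 o3 ^+ 2.
    by rewrite /M aE klein_bp; ring.
  by rewrite !(ltr_pwDl _ s3, ltr_pwDl _ s2, ltr_pwDl _ s1, ltr_pwDl _ s4).
have mu0 : 0 < mu by rewrite divr_gt0// addr_gt0.
have NN : dotv N N = M ^+ 2 - B ^+ 2.
  rewrite dotv_vec4; have [-> -> -> ->] := vec4E (p * (1 + a) - 2 * y 0 o0) (- 2 * b * y 0 o1) (- 2 * b * y 0 o2) (- 2 * b * y 0 o3).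
  transitivity ((p * (1 + a) - 2 * y 0 o0) ^+ 2 + 4 * b ^+ 2 * (a - y 0 o0 ^+ 2)).
    by rewrite aE; ring.
  have -> : B ^+ 2 = (1 - p ^+ 2) * (1 - a) ^+ 2 by rewrite -klein_bp /B; ring.
  by rewrite klein_bp /M; ring.
pose w : T := (- (2 * mu)^-1) *: N.
have ww : dotv w w = (M ^+ 2 - B ^+ 2) / (2 * mu) ^+ 2.
  rewrite dotvZl dotvZr NN; move: mu0; move: (mu) (M) (B) => m M' B' m0; field.
  by rewrite gt_eqF.
have wM : 1 + dotv w w = M / mu.
  by rewrite ww (AM _ _ M0 B0).
have wB : 1 - dotv w w = B / mu.
  by rewrite ww (AB _ _ M0 B0).
have w1 : dotv w w < 1 by rewrite -subr_gt0 wB divr_gt0.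
have [bh hw] := h_formula w1.
have bP := poisson_bounded xi1 w1.
transitivity (b ^+ 2 / mu * h w); last first.
  have N0 : w 0 o0 = - (p * (1 + a) - 2 * y 0 o0) / (2 * mu).
    by rewrite mxE; have [-> _ _ _] := vec4E (p * (1 + a) - 2 * y 0 o0) (- 2 * b * y 0 o1) (- 2 * b * y 0 o2) (- 2 * b * y 0 o3); ring.
  have K : mu - k * (p * (1 + a) - 2 * y 0 o0) + k ^+ 2 * (M - mu) = b ^+ 2 * (1 + k ^+ 2).
    rewrite /mu /M /B /klein_p /klein_b; move: (y 0 o0) (a) => s a'; field.
    by rewrite gt_eqF.
  have w2 : dotv w w = M / mu - 1 by rewrite -wM addrAC subrr add0r.
  have -> : h w = (1 + k ^+ 2) / (b ^+ 2 * (1 + k ^+ 2) / mu).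
    rewrite hE w2 N0 -K; congr (_ / _); move: mu0; move: (mu) (M) => m M' m0; field.
    by rewrite gt_eqF.
  move: mu0 b0; move: (mu) b => m b' m0 b'0; field.
  by rewrite !gt_eqF.
rewrite hw -(meanZ mE); last exact: boundedM bP (boundedM bJ bh).
apply: eq_mean => i.
have d0 := klein_den_gt0 i.
have hx : h (xi i) = (klein_den i)^-1.
  have e : 1 + 2 * k * xi i 0 o0 + k ^+ 2 * 1 = (1 + k ^+ 2) * klein_den i.
    by rewrite /klein_den /klein_p; field; rewrite gt_eqF.
  by rewrite hE xi1 e invfM mulrA divff ?mul1r// gt_eqF.
have e1 : dotv (w - xi i) (w - xi i) = (M + dotv N (xi i)) / mu.
  rewrite dotvBl !dotvBr xi1 [dotv (xi i) w]dotvC.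
  rewrite (_ : _ - _ = 1 + dotv w w - 2 * dotv w (xi i)); last by ring.
  rewrite wM dotvZl; move: mu0; move: (mu) (M) (dotv N _) => m M' D m0; field.
  by rewrite gt_eqF.
have e2 : dotv (y - klein i) (y - klein i) = (M + dotv N (xi i)) / klein_den i.
  rewrite dotvBl !dotvBr klein_unit [dotv (klein i) y]dotvC -/a.
  rewrite dotvZr dotv_vec4 [dotv N _]dotvC dotv_vec4 /M /klein_den; field.
  by rewrite gt_eqF.
have n0 : M + dotv N (xi i) != 0.
  have := dist_sphere_neq0 xi1 i w1; rewrite e1; apply: contra_neq => ->; by rewrite mul0r.
rewrite /poisson /newton /klein_density hx e1 e2 wB -/a /B.
move: d0 n0 mu0; move: (klein_den i) (M + _) (mu) (a) => den S m a' d0 n0 mu0; field.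
by rewrite n0 !gt_eqF.
Qed.

End Klein.

(** * One-dimensional calculus for the uniform mean *)

Section Calculus.
Context {R : realType}.
Local Notation U := (unitI R).

Lemma uniform_continuity (g : R -> R) (a b e : R) :
  (forall x, a <= x <= b -> {for x, continuous g}) -> 0 < e ->
  exists2 d, 0 < d & forall x y, a <= x <= b -> a <= y <= b -> `|x - y| < d ->
    `|g x - g y| <= e.
Proof.
move=> cg e0; have e2 : 0 < e / 2 by rewrite divr_gt0.
pose P (d x : R) := forall y, a <= x <= b -> a <= y <= b -> `|x - y| < d ->
    `|g x - g y| <= e.
have /compact_near_coveringP/(_ R (0^'+) P _) H := @segment_compact R a b.
have [|d /= d0 hd] := H _; last first.
  exists (d / 2); first by rewrite divr_gt0.
  move=> x y xab yab xy.
  have dd : `|0 - d / 2| < d by rewrite sub0r normrN gtr0_norm ?divr_gt0//; lra.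
  have d20 : 0 < d / 2 by rewrite divr_gt0.
  have xI : x \in `[a, b] by rewrite in_itv.
  exact: (hd (d / 2) dd d20 x xI y xab yab xy).
move=> x; rewrite /= in_itv /= => xab.
have /cvgrPdist_lt /(_ _ e2) /nbhs_ballP[d /= d0 hd] := cg x xab.
have d2 : 0 < d / 2 by rewrite divr_gt0.
exists (ball x (d / 2), [set t | t < d / 2]).
  split; first exact: nbhsx_ballx.
  by exists (d / 2) => // t /=; rewrite sub0r normrN => /ltr_normlW.
move=> [y t] /= [xy td] z yab zab yz.
have h1 : `|g x - g y| < e / 2 by apply: hd; rewrite /ball /= in xy *; lra.
have h2 : `|g x - g z| < e / 2.
  apply: hd; rewrite /ball /= in xy *.
  have := ler_normD (x - y) (y - z); rewrite addrA subrK; lra.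
have -> : g y - g z = (g x - g z) - (g x - g y) by ring.
have := ler_normB (g x - g z) (g x - g y); lra.
Qed.

Lemma unit_mean_C1 (G g : R -> R) :
  (forall x : R, 0 <= x <= 1 -> is_derive x (1 : R) G (g x)) ->
  (forall x : R, 0 <= x <= 1 -> {for x, continuous g}) ->
  unit_mean (fun u : U => g (sval u)) = G 1 - G 0.
Proof.
move=> dG cg; apply: unit_mean_derivative => e e0.
have [d d0 hd] := uniform_continuity cg e0; exists d => // t s ts s1 st.
have /andP[t0 t1] := svalP t.
have dGs (x : R) : x \in `]sval t, s[ -> is_derive x (1 : R) G (g x).
  by rewrite in_itv /= => /andP[h1 h2]; apply: dG; rewrite (le_trans t0 (ltW h1)) (le_trans (ltW h2)).
have cG : {within `[sval t, s], continuous G}.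
  apply: derivable_within_continuous => x; rewrite in_itv /= => /andP[h1 h2].
  have x01 : 0 <= x <= 1 by rewrite (le_trans t0 h1) (le_trans h2).
  by have [] := dG x x01.
have [c ct ->] := MVT_segment ts dGs cG.
move: ct; rewrite in_itv /= => /andP[tc cs].
rewrite [g c * _]mulrC -mulrBr normrM mulrC (ger0_norm (_ : 0 <= s - sval t)) ?subr_ge0//.
rewrite ler_wpM2r ?subr_ge0//; apply: hd.
- by rewrite (le_trans t0 tc) (le_trans cs).
- by rewrite t0.
- rewrite ger0_norm ?subr_ge0//; lra.
Qed.

(** The Lebesgue integral serves only to provide a primitive; means are then evaluated by
    [unit_mean_C1]. *)
Lemma continuous_primitive (f : R -> R) (a b : R) : continuous f ->
  exists K : R -> R, forall x : R, a < x < b -> is_derive x (1 : R) K (f x).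
Proof.
move=> cf; exists (fun x => \int[@lebesgue_measure R]_(t in `[a, x]) f t) => x /andP[ax xb].
have fi : (@lebesgue_measure R).-integrable `[a, b] (EFin \o f).
  by apply: continuous_compact_integrable; [exact: segment_compact|exact: continuous_subspaceT].
have [d1 d2] := continuous_FTC1_closed xb fi ax (cf x).
by split; [exact: d1|rewrite -derive1E; exact: d2].
Qed.

(** Both sides are the increment of one primitive between the common end values, so neither
    substitution has to be monotone or inverted. The primitive lives on []-1, 2[], which makes the
    points of [[0, 1]] interior. *)
Lemma unit_mean_subst (f s1 ds1 s2 ds2 : R -> R) : continuous f ->
  (forall x : R, 0 <= x <= 1 -> [/\ 0 <= s1 x <= 1, is_derive x (1 : R) s1 (ds1 x)
     & {for x, continuous ds1}]) ->
  (forall x : R, 0 <= x <= 1 -> [/\ 0 <= s2 x <= 1, is_derive x (1 : R) s2 (ds2 x)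
     & {for x, continuous ds2}]) ->
  s1 0 = s2 0 -> s1 1 = s2 1 ->
  unit_mean (fun u : U => f (s1 (sval u)) * ds1 (sval u)) =
  unit_mean (fun u : U => f (s2 (sval u)) * ds2 (sval u)).
Proof.
move=> cf h1 h2 e0 e1; have [K dK] := @continuous_primitive f (-1) 2 cf.
have H (s ds : R -> R) : (forall x : R, 0 <= x <= 1 -> [/\ 0 <= s x <= 1,
    is_derive x (1 : R) s (ds x) & {for x, continuous ds}]) ->
    unit_mean (fun u : U => f (s (sval u)) * ds (sval u)) = K (s 1) - K (s 0).
  move=> h; apply: (@unit_mean_C1 (K \o s) (fun x => f (s x) * ds x)) => x /h[sx dsx cds].
    have sx' : -1 < s x < 2.
      by case/andP: sx => sx0 sx1; rewrite (lt_le_trans (ltrN10 R) sx0) (le_lt_trans sx1)// ltr1n.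
    exact: (is_derive1_comp (dK _ sx') dsx).
  have cs : {for x, continuous s}.
    by apply/differentiable_continuous/derivable1_diffP; case: dsx.
  have cfs : {for x, continuous (fun x => f (s x))} by apply: (@continuous_comp _ _ _ s f) => //; exact: cf.
  exact: (cvgM cfs cds).
by rewrite (H s1)// (H s2)// e0 e1.
Qed.

(** By periodicity [K t - K (t - 1)] has derivative 0; following it from [t = 1] to [t = a]
    identifies the two increments. The bound [N] leaves room for both arguments on the way. *)
Lemma unit_mean_reflect (g : R -> R) (a : R) : continuous g ->
  (forall x, g (x + 1) = g x) ->
  unit_mean (fun u : U => g (a - sval u)) = unit_mean (fun u : U => g (sval u)).
Proof.
move=> cg gp; pose N := `|a| + 3.
have [K dK] := @continuous_primitive g (- N) N cg.
have a1 : - `|a| <= a <= `|a| by rewrite -ler_norml.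
have e1 : unit_mean (fun u : U => g (a - sval u)) = K a - K (a - 1).
  transitivity (- K (a - 1) - - K (a - 0)); last by rewrite subr0 opprK addrC.
  apply: (@unit_mean_C1 (fun x => - K (a - x)) (fun x => g (a - x))) => x /andP[x0 x1].
    have d1 : is_derive x (1 : R) (fun x => a - x) (-1).
      rewrite (_ : (fun x => a - x) = (fun x => a + -1 * x)); first exact: is_derive_affine.
      by apply/funext => y; rewrite mulN1r.
    have ax : - N < a - x < N by apply/andP; split; rewrite /N; lra.
    by have := is_deriveN (@is_derive1_comp R K (fun x => a - x) x _ _ (dK _ ax) d1); rewrite mulrN1 opprK.
  apply: (@continuous_comp _ _ _ (fun x => a - x) g); last exact: cg.
  by apply: cvgB; [exact: cvg_cst|exact: cvg_id].
have e2 : unit_mean (fun u : U => g (sval u)) = K 1 - K 0.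
  apply: (@unit_mean_C1 K g) => [y /andP[y0 y1]|y _]; last exact: cg.
  by apply: dK; apply/andP; split; rewrite /N; lra.
apply: (etrans e1); apply: (etrans _ (esym e2)).
pose L (t : R) := K (1 + (a - 1) * t) - K (1 + (a - 1) * t - 1).
have : unit_mean (fun _ : U => 0) = L 1 - L 0.
  apply: (@unit_mean_C1 L (fun=> 0)) => x /andP[x0 x1]; last exact: cvg_cst.
  have d1 := is_derive_affine 1 (a - 1) x.
  have d2 : is_derive x (1 : R) (fun x => 1 + (a - 1) * x - 1) (a - 1).
    rewrite (_ : (fun x => _) = (fun x => 0 + (a - 1) * x)); first exact: is_derive_affine.
    by apply/funext => y; ring.
  have ax : - `|a| - 1 <= 1 + (a - 1) * x <= `|a| + 1.
    have := ler_norm (a * x); have := ler_norm (- (a * x)).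
    rewrite normrN normrM (ger0_norm x0).
    have : `|a| * x <= `|a| * 1 by rewrite ler_wpM2l.
    by move: (a * x) (`|a| * x) => ax nx; nra.
  rewrite -[0](subrr (g (1 + (a - 1) * x) * (a - 1))).
  have r1 : - N < 1 + (a - 1) * x < N by apply/andP; split; rewrite /N; lra.
  have r2 : - N < 1 + (a - 1) * x - 1 < N by apply/andP; split; rewrite /N; lra.
  have c2 := @is_derive1_comp R K (fun x => 1 + (a - 1) * x - 1) x _ _ (dK _ r2) d2.
  rewrite -{2}[1 + (a - 1) * x](subrK 1) gp.
  exact: (is_deriveB (@is_derive1_comp R K (fun x => 1 + (a - 1) * x) x _ _ (dK _ r1) d1) c2).
have -> : L 1 = K a - K (a - 1) by rewrite /L; congr (K _ - K _); ring.
have -> : L 0 = K 1 - K 0 by rewrite /L; congr (K _ - K _); ring.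
rewrite (mean_cst (@unit_mean_is_mean R)).
by move=> /esym/eqP; rewrite subr_eq0 => /eqP.
Qed.

End Calculus.

(** * A rearrangement inequality on the circle *)

Section Rearrangement.
Context {R : realType}.
Local Notation U := (unitI R).

(** A translation is the composition of two reflections. *)
Lemma unit_mean_shift (g : R -> R) (a : R) : continuous g ->
  (forall x, g (x + 1) = g x) ->
  unit_mean (fun u : U => g (sval u + a)) = unit_mean (fun u : U => g (sval u)).
Proof.
move=> cg gp; rewrite -(unit_mean_reflect 0 cg gp).
pose k (x : R) := g (0 - x).
have ck : continuous k.
  move=> x; apply: (@continuous_comp _ _ _ (fun x => 0 - x) g); last exact: cg.
  by apply: cvgB; [exact: cvg_cst|exact: cvg_id].
have kp x : k (x + 1) = k x by rewrite /k -gp; congr g; ring.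
rewrite -/(k _) -[RHS](unit_mean_reflect (- a) ck kp).
by apply: eq_mean => u; rewrite /k; congr g; ring.
Qed.

(* Reflecting the circle about the midpoint of the two peaks exchanges [phi]
   with its translate, so that four times the difference of the two sides is the
   mean of a pointwise nonnegative product. *)
Lemma rearrangement (phi M : R -> R) (b : R) :
  continuous phi -> continuous M -> bounded_fct phi -> bounded_fct M ->
  (forall x, M (x + 1) = M x) ->
  (forall x, phi (- x) = phi x) -> (forall x, phi (x + 1 / 2) = phi x) ->
  (forall x y, phi x <= phi y -> M x + M (x + 1 / 2) <= M y + M (y + 1 / 2)) ->
  unit_mean (fun u : U => phi (sval u - b) * M (sval u)) <=
  unit_mean (fun u : U => phi (sval u) * M (sval u)).
Proof.
move=> cphi cM bphi bM Mp phiN phih mono.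
have mU := @unit_mean_is_mean R.
have phip x : phi (x + 1) = phi x.
  by rewrite -(phih x) -(phih (x + 1 / 2)); congr phi; field.
(* As [phi] has period [1 / 2], averaging over half a turn replaces [M] by this sum in both means,
   at the price of a factor 2. *)
pose Ms x := M x + M (x + 1 / 2).
have cadd (f : R -> R) c : continuous f -> continuous (fun x => f (x + c)).
  move=> cf x; apply: (@continuous_comp _ _ _ (fun x => x + c) f); last exact: cf.
  by apply: cvgD; [exact: cvg_id|exact: cvg_cst].
have csub c : continuous (fun x => phi (x - c)) by exact: cadd.
have cMs : continuous Ms by move=> x; apply: cvgD; [exact: cM|exact: cadd].
have Msp x : Ms (x + 1) = Ms x.
  by rewrite /Ms Mp; congr (_ + _); rewrite -(Mp (x + 1 / 2)); congr M; ring.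
have bs (f g : R -> R) (h k : U -> R) : bounded_fct f -> bounded_fct g ->
    bounded_fct (fun u => f (h u) * g (k u)).
  by move=> [A fA] [B gB]; exists (A * B) => u; rewrite normrM ler_pM.
have bMs : bounded_fct Ms.
  have [B MB] := bM; exists (B + B) => x.
  by rewrite (le_trans (ler_normD _ _))// lerD.
have half c : unit_mean (fun u : U => phi (sval u - c) * M (sval u)) *+ 2 =
    unit_mean (fun u : U => phi (sval u - c) * Ms (sval u)).
  have cg : continuous (fun x => phi (x - c) * M x) by move=> x; apply: cvgM; [exact: csub|exact: cM].
  have gp x : phi (x + 1 - c) * M (x + 1) = phi (x - c) * M x.
    by rewrite Mp -(phip (x - c)); congr (phi _ * _); ring.
  rewrite mulr2n -{2}(unit_mean_shift (1 / 2) cg gp) -(meanD mU).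
  - apply: eq_mean => u; rewrite /Ms mulrDr; congr (_ + _ * _).
    by rewrite -(phih (sval u - c)); congr phi; ring.
  - exact: bs.
  - exact: bs.
have refl c d : unit_mean (fun u : U => phi (sval u - c) * Ms (sval u)) =
    unit_mean (fun u : U => phi (d - sval u - c) * Ms (d - sval u)).
  have cg : continuous (fun x => phi (x - c) * Ms x) by move=> x; apply: cvgM; [exact: csub|exact: cMs].
  have gp x : phi (x + 1 - c) * Ms (x + 1) = phi (x - c) * Ms x.
    by rewrite Msp -(phip (x - c)); congr (phi _ * _); ring.
  by rewrite -(unit_mean_reflect d cg gp).
have hA : unit_mean (fun u : U => phi (sval u) * M (sval u)) *+ 2 =
    unit_mean (fun u : U => phi (sval u) * Ms (sval u)).
  by have := half 0; under eq_fun do rewrite subr0; under [in RHS]eq_fun do rewrite subr0.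
have hA' : unit_mean (fun u : U => phi (sval u) * M (sval u)) *+ 2 =
    unit_mean (fun u : U => phi (sval u - b) * Ms (b - sval u)).
  have := refl 0 b; under eq_fun do rewrite subr0; rewrite hA => ->.
  by apply: eq_mean => u; rewrite -phiN; congr (phi _ * _); ring.
have hB := half b.
have hB' : unit_mean (fun u : U => phi (sval u - b) * M (sval u)) *+ 2 =
    unit_mean (fun u : U => phi (sval u) * Ms (b - sval u)).
  rewrite hB (refl b b); apply: eq_mean => u.
  by rewrite -phiN; congr (phi _ * _); ring.
suff : 0 <= unit_mean (fun u : U => phi (sval u) * M (sval u)) *+ 2 +
    unit_mean (fun u : U => phi (sval u) * M (sval u)) *+ 2 -
    (unit_mean (fun u : U => phi (sval u - b) * M (sval u)) *+ 2 +
    unit_mean (fun u : U => phi (sval u - b) * M (sval u)) *+ 2).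
  by move: (unit_mean _) (unit_mean _) => x y; lra.
rewrite {1}hA hA' {1}hB hB'.
rewrite -!(meanD mU); [|exact: bs..].
rewrite -(meanB mU); [|by apply: boundedD; exact: bs..].
apply: (mean_ge0 mU) => [|u].
  by apply: boundedB; apply: boundedD; exact: bs.
have mono' := mono (sval u) (b - sval u); have mono2 := mono (b - sval u) (sval u).
have -> : phi (sval u - b) = phi (b - sval u) by rewrite -phiN opprB.
rewrite (_ : _ - _ = (phi (sval u) - phi (b - sval u)) * (Ms (sval u) - Ms (b - sval u))); last by ring.
have [h|/ltW h] := leP (phi (sval u)) (phi (b - sval u)).
  by rewrite mulr_le0// subr_le0// mono'.
by rewrite mulr_ge0// subr_ge0// mono2.
Qed.

End Rearrangement.

(** * Monotonicity of the chord densities *)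

Section ChordAlgebra.
Context {R : realType}.
Implicit Types (m h t : R).

(** In the variable [h = 1 / u] with [u ^+ 2 = 1 - t ^+ 2], [chord_den] and [chord_fun] express the
    sum of the densities at [t] and [- t], scaled by [u ^+ 3]; see [chord_densityD]. *)
Definition chord_den m h := (1 - 2 * m) ^+ 2 + 4 * m * (1 - m) * h ^+ 2.

Definition chord_fun m h :=
  (8 * (1 - m) * h ^+ 3 - 2 * (3 - 4 * m) * h) / chord_den m h.

Let bracket m h1 h2 :=
  8 * (1 - m) * (1 - 2 * m) ^+ 2 * (h1 ^+ 2 + h1 * h2 + h2 ^+ 2) +
  8 * (1 - m) * (4 * m * (1 - m)) * (h1 * h2) ^+ 2 -
  2 * (3 - 4 * m) * (1 - 2 * m) ^+ 2 +
  2 * (3 - 4 * m) * (4 * m * (1 - m)) * (h1 * h2).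

(** For [m <= 1] an expansion in [h1 * h2 - 1] and [(h1 - h2) ^+ 2] has nonnegative coefficients.
    This fails beyond 1, a range that does occur; there the positivity of the denominators is used,
    whose product appears after multiplication by [m]. *)
Let bracket_ge0 m h1 h2 : 0 <= m -> 1 <= h1 -> 1 <= h2 ->
  0 < chord_den m h1 -> 0 < chord_den m h2 -> 0 <= bracket m h1 h2.
Proof.
move=> m0 h11 h21 d1 d2.
have y1 : 0 <= h1 * h2 - 1 by rewrite subr_ge0 mulr_ege1.
have [m1|m1] := leP m 1.
  have m1' : 0 <= 1 - m by rewrite subr_ge0.
  have -> : bracket m h1 h2 =
      8 * (1 - m) * (1 - 2 * m) ^+ 2 * (h1 - h2) ^+ 2 + (16 * (1 - m) ^+ 2 + 2) +
      (h1 * h2 - 1) * (8 * (1 - m) * (4 * m * (1 - m)) * (h1 * h2 - 1) +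
        (1 - m) * (24 - 8 * m)) by rewrite /bracket; ring.
  have h8 : 0 <= 24 - 8 * m by lra.
  apply: addr_ge0; first apply: addr_ge0.
  - by rewrite mulr_ge0 ?sqr_ge0// mulr_ge0 ?sqr_ge0// mulr_ge0.
  - by rewrite addr_ge0// mulr_ge0// sqr_ge0.
  - by rewrite mulr_ge0// addr_ge0 ?mulr_ge0.
have m0' : 0 < m by exact: lt_trans m1.
rewrite -(pmulr_rge0 _ m0').
have -> : m * bracket m h1 h2 = 2 * (chord_den m h1 * chord_den m h2) +
   8 * m * (m - 1) ^+ 2 * (h1 * h2) + 2 * (1 - 2 * m) ^+ 2 * (m - 1).
  by rewrite /bracket /chord_den; ring.
have h12 : 0 <= h1 * h2 by rewrite -[h1 * h2](subrK 1) addr_ge0.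
have m2 : 0 <= m - 1 by rewrite subr_ge0 ltW.
apply: addr_ge0; last by rewrite mulr_ge0// mulr_ge0// sqr_ge0.
apply: addr_ge0; first by rewrite mulr_ge0// mulr_ge0// ltW.
by rewrite mulr_ge0// mulr_ge0 ?sqr_ge0// mulr_ge0.
Qed.

(** The numerator of the difference factors as [h2 - h1] times [bracket]. *)
Lemma chord_fun_nondecreasing m h1 h2 : 0 <= m -> 1 <= h1 -> h1 <= h2 ->
  0 < chord_den m h1 -> 0 < chord_den m h2 -> chord_fun m h1 <= chord_fun m h2.
Proof.
move=> m0 h11 h12 d1 d2; have h21 := le_trans h11 h12.
rewrite -subr_ge0.
have -> : chord_fun m h2 - chord_fun m h1 =
    (h2 - h1) * bracket m h1 h2 / (chord_den m h1 * chord_den m h2).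
  rewrite /chord_fun /bracket; move: d1 d2; rewrite /chord_den => d1 d2; field.
  by rewrite !gt_eqF.
apply: divr_ge0; last by rewrite mulr_ge0 ?ltW.
by apply: mulr_ge0; [rewrite subr_ge0|exact: bracket_ge0].
Qed.

Definition chord_density m t := ((1 - t) ^+ 2 * (1 - t + 2 * m * t))^-1.

(** With [x = (1 - 2 * m) * t] the densities at [t] and [- t] have denominators
    [(1 - t) ^+ 2 * (1 - x)] and [(1 + t) ^+ 2 * (1 + x)]; their product is even in [t] and becomes
    a function of [u]. *)
Lemma chord_densityD m t u : 0 < u -> u ^+ 2 = 1 - t ^+ 2 ->
  ((1 - 2 * m) * t) ^+ 2 < 1 -> 0 < chord_den m u^-1 /\
  u ^+ 3 * (chord_density m t + chord_density m (- t)) = chord_fun m u^-1.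
Proof.
move=> u0 uE mt.
have e : chord_den m u^-1 = (1 - ((1 - 2 * m) * t) ^+ 2) / u ^+ 2.
  rewrite exprMn; have -> : t ^+ 2 = 1 - u ^+ 2 by rewrite uE; ring.
  by rewrite /chord_den; field; rewrite gt_eqF.
set x := (1 - 2 * m) * t in mt e *.
have u2 : 0 < 1 - t ^+ 2 by rewrite -uE exprn_gt0.
have x2 : 0 < 1 - x ^+ 2 by rewrite subr_gt0.
split; first by rewrite e divr_gt0// exprn_gt0.
have /andP[t1 t2] : (1 - t != 0) && (1 + t != 0).
  by rewrite -negb_or -mulf_eq0 (_ : _ * _ = 1 - t ^+ 2) ?gt_eqF//; ring.
have /andP[x3 x4] : (1 - x != 0) && (1 + x != 0).
  by rewrite -negb_or -mulf_eq0 (_ : _ * _ = 1 - x ^+ 2) ?gt_eqF//; ring.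
have -> : chord_density m t + chord_density m (- t) =
    (8 * (1 - m) - 2 * (3 - 4 * m) * u ^+ 2) / ((u ^+ 2) ^+ 2 * (1 - x ^+ 2)).
  have d1 : chord_density m t = ((1 - t) ^+ 2 * (1 - x))^-1.
    by rewrite /chord_density /x; congr (_^-1); ring.
  have d2 : chord_density m (- t) = ((1 + t) ^+ 2 * (1 + x))^-1.
    by rewrite /chord_density /x; congr (_^-1); ring.
  have n : (1 + t) ^+ 2 * (1 + x) + (1 - t) ^+ 2 * (1 - x) =
      8 * (1 - m) - 2 * (3 - 4 * m) * u ^+ 2 by rewrite uE /x; ring.
  rewrite d1 d2 -n uE; move: (x) x3 x4 => x' x3 x4.
  rewrite (_ : (1 - t ^+ 2) ^+ 2 * (1 - x' ^+ 2) =
    ((1 - t) ^+ 2 * (1 - x')) * ((1 + t) ^+ 2 * (1 + x'))); last by ring.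
  by field; rewrite t1 t2 x3 x4.
rewrite /chord_fun e; move: (x) x2 => x' x2; field.
by rewrite !gt_eqF.
Qed.

End ChordAlgebra.

(** * The inequality between directional derivatives *)

Section AffineCircle.
Context {R : realType}.
Variable q : R.
Hypothesis q01 : 0 < q < 1 / 2.
Local Notation U := (unitI R).

Definition chord_b : R := Num.sqrt (1 - q ^+ 2).
Local Notation b := chord_b.

Let q0 : 0 < q. Proof. by case/andP: q01. Qed.
Let q1 : q < 1 / 2. Proof. by case/andP: q01. Qed.
Let qq : q ^+ 2 < 1.
Proof. by rewrite expr_lt1 ?(ltW q0)// (lt_trans q1)// ltr_pdivrMr// mul1r ltr1n. Qed.
Let qq0 : 0 < 1 - q ^+ 2. Proof. by rewrite subr_gt0. Qed.

Lemma chord_b_gt0 : 0 < b. Proof. by rewrite sqrtr_gt0. Qed.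
Lemma chord_b_sqr : b ^+ 2 = 1 - q ^+ 2. Proof. by rewrite sqr_sqrtr// ltW. Qed.

(** The circle point is [(cos, b * sin)] divided by its length, so that [b * ellipse_cos] and
    [ellipse_sin] are the same multiple [b / S] of the cosine and the sine. *)
Definition ellipse_sq (x : R) : R :=
  cos (2 * pi * x) ^+ 2 + (1 - q ^+ 2) * sin (2 * pi * x) ^+ 2.
Definition ellipse_cos x := cos (2 * pi * x) / Num.sqrt (ellipse_sq x).
Definition ellipse_sin x := b * sin (2 * pi * x) / Num.sqrt (ellipse_sq x).
Definition ellipse_speed x := 2 * pi * b / ellipse_sq x.

Lemma ellipse_sqE x : ellipse_sq x = 1 - q ^+ 2 + q ^+ 2 * cos (2 * pi * x) ^+ 2.
Proof. by rewrite /ellipse_sq sin2cos2; ring. Qed.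

Lemma ellipse_sq_ge x : 1 - q ^+ 2 <= ellipse_sq x.
Proof. by rewrite ellipse_sqE lerDl mulr_ge0 ?sqr_ge0. Qed.

Lemma ellipse_sq_gt0 x : 0 < ellipse_sq x.
Proof. exact: lt_le_trans (ellipse_sq_ge x). Qed.

Lemma ellipse_sq_le1 x : ellipse_sq x <= 1.
Proof.
have -> : ellipse_sq x = 1 - q ^+ 2 * sin (2 * pi * x) ^+ 2.
  by rewrite /ellipse_sq cos2sin2; ring.
by rewrite gerBl mulr_ge0 ?sqr_ge0.
Qed.

Lemma ellipse_circle : circle_param ellipse_cos ellipse_sin ellipse_speed.
Proof.
have s0 x : 0 < Num.sqrt (ellipse_sq x) by rewrite sqrtr_gt0 ellipse_sq_gt0.
have ss x : Num.sqrt (ellipse_sq x) ^+ 2 = ellipse_sq x by rewrite sqr_sqrtr// ltW// ellipse_sq_gt0.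
have dc := @unif_deriv_cosZ R unit (2 * pi); have ds := @unif_deriv_sinZ R unit (2 * pi).
have dE := unif_derivD (unif_derivM dc dc) (unif_derivZ (1 - q ^+ 2) (unif_derivM ds ds)).
have {}dE : unif_deriv (unit_itv (R := R)) (fun x (_ : unit) => ellipse_sq x)
    (fun x _ h => - (2 * pi) * (2 * q ^+ 2 * (cos (2 * pi * x) * sin (2 * pi * x))) * h).
  by apply: eq_unif_deriv dE _ _ => [x i _|x i h _]; rewrite /ellipse_sq; ring.
have dS := unif_deriv_sqrt qq0 (fun x _ _ => ellipse_sq_ge x) dE.
have hS (x : R^o) (i : unit) : unit_itv x -> b <= `|Num.sqrt (ellipse_sq x)|.
  by move=> _; rewrite ger0_norm ?sqrtr_ge0// ler_wsqrtr// ellipse_sq_ge.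
have dI := unif_deriv_inv chord_b_gt0 hS dS.
have sp x : ellipse_speed x = 2 * pi * b / Num.sqrt (ellipse_sq x) ^+ 2 by rewrite ss.
have rel x : Num.sqrt (ellipse_sq x) ^+ 2 = cos (2 * pi * x) ^+ 2 + b ^+ 2 * sin (2 * pi * x) ^+ 2.
  by rewrite ss chord_b_sqr.
have cs (x : R) : cos (2 * pi * x) ^+ 2 = 1 - sin (2 * pi * x) ^+ 2 by rewrite cos2sin2.
have qb : q ^+ 2 = 1 - b ^+ 2 by rewrite chord_b_sqr; ring.
split.
- move=> x; rewrite /ellipse_cos /ellipse_sin !expr_div_n -mulrDl exprMn -rel divff//.
  by rewrite expf_neq0// gt_eqF.
- apply: eq_unif_deriv (unif_derivM dc dI) _ _ => [//|x i h _].
  rewrite sp /ellipse_sin qb; move: (s0 x) (rel x) (cs x).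
  move: (2 * pi : R) b (Num.sqrt (ellipse_sq x)) (cos (2 * pi * x)) (sin (2 * pi * x)) => P b' S c s S0 r e.
  transitivity (P * s * h / S ^+ 3 * (c ^+ 2 * (1 - b' ^+ 2) - S ^+ 2)).
    by field; rewrite gt_eqF.
  have -> : c ^+ 2 * (1 - b' ^+ 2) - S ^+ 2 = - b' ^+ 2 by rewrite r e; ring.
  by field; rewrite gt_eqF.
- apply: eq_unif_deriv (unif_derivM (unif_derivZ b ds) dI) _ _ => [//|x i h _].
  rewrite sp /ellipse_cos qb; move: (s0 x) (rel x) (cs x).
  move: (2 * pi : R) b (Num.sqrt (ellipse_sq x)) (cos (2 * pi * x)) (sin (2 * pi * x)) => P b' S c s S0 r e.
  transitivity (P * b' * c * h / S ^+ 3 * (s ^+ 2 * (1 - b' ^+ 2) + S ^+ 2)).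
    by field; rewrite gt_eqF.
  have -> : s ^+ 2 * (1 - b' ^+ 2) + S ^+ 2 = 1 by rewrite r e; ring.
  by field; rewrite gt_eqF.
- by rewrite /ellipse_cos /ellipse_sq !mulr1 mulr0 mulr_natl cos2pi sin2pi cos0 sin0.
- by rewrite /ellipse_sin /ellipse_sq !mulr1 mulr0 mulr_natl cos2pi sin2pi cos0 sin0 mulr0.
- have p0 : 0 < 2 * pi * b by rewrite !mulr_gt0 ?pi_gt0 ?chord_b_gt0.
  exists (2 * pi * b) => //; exists (2 * pi * b / (1 - q ^+ 2)) => x.
  rewrite /ellipse_speed ler_pdivlMr ?ellipse_sq_gt0// ler_piMr ?(ltW p0) ?ellipse_sq_le1//=.
  by rewrite ler_wpM2l ?(ltW p0)// lef_pV2 ?posrE ?ellipse_sq_gt0// ellipse_sq_ge.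
Qed.

End AffineCircle.

(** * The angular density and its monotonicity *)

Section DiscInequality.
Context {R : realType}.
Variable q : R.
Hypothesis q01 : 0 < q < 1 / 2.
Local Notation U := (unitI R).
Local Notation b := (chord_b q).
Local Notation S x := (Num.sqrt (ellipse_sq q x)).

Let q0 : 0 < q. Proof. by case/andP: q01. Qed.
Let q1 : q < 1 / 2. Proof. by case/andP: q01. Qed.

(** The height [dotv z n] at which the radial derivative of the Poisson kernel at [2 q n] changes
    sign. If [q = sin a] then [p = sin (3 a)], whence [sqrt (1 - p^2) = b * (1 - 4 * q ^+ 2)]. *)
Definition disc_p : R := 3 * q - 4 * q ^+ 3.
Local Notation p := disc_p.

Definition disc_weight (t : R) : R := ((1 + p * t) * (1 - q * t) ^+ 3)^-1.

Lemma disc_p_bounds : 0 < p < 1.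
Proof.
have h1 : 0 < 1 - 2 * q by have := q1; lra.
have h2 : 0 < 3 - 4 * q ^+ 2.
  rewrite (_ : _ - _ = 2 + (1 - 2 * q) * (1 + 2 * q)); last by ring.
  by rewrite addr_gt0// mulr_gt0// addr_gt0// mulr_gt0.
apply/andP; split.
  by rewrite (_ : p = q * (3 - 4 * q ^+ 2)) ?mulr_gt0// /p; ring.
rewrite -subr_gt0 (_ : _ - _ = (1 + q) * (1 - 2 * q) ^+ 2); last by rewrite /p; ring.
by rewrite mulr_gt0 ?exprn_gt0// addr_gt0.
Qed.

Lemma disc_weight_den_gt0 t : `|t| <= 1 -> 0 < 1 + p * t /\ 0 < 1 - q * t.
Proof.
have /andP[p0 p1] := disc_p_bounds; rewrite ler_norml => /andP[t0 t1]; split.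
  have : p * -1 <= p * t by rewrite ler_wpM2l// ltW.
  by move: (p * t) => x; lra.
have : q * t <= q * 1 by rewrite ler_wpM2l// ltW.
by have := q1; move: (q * t) => x; lra.
Qed.

Definition chord_slope (s : R) : R := 2 * (1 - q ^+ 2) * s.
Local Notation mm := chord_slope.

Definition chord_mean (t : R) : R :=
  unit_mean (fun s : U => sval s ^+ 2 * chord_density (mm (sval s)) t).

Let mm_bound (s t : R) : 0 <= s <= 1 -> `|t| <= q -> `|(1 - 2 * mm s) * t| <= p.
Proof.
move=> /andP[s0 s1] tq.
(* The factor [1 - 2 * mm s] is largest in absolute value at [s = 1], where it is [4 * q ^+ 2 - 3];
   so the bound is [p] itself, and [p < 1] keeps the denominators positive. *)
have -> : p = (2 * (2 * (1 - q ^+ 2)) - 1) * q by rewrite /p; ring.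
have g1 : 1 <= 2 * (1 - q ^+ 2).
  have : q ^+ 2 <= 1 / 2 * (1 / 2) by rewrite expr2 ler_pM ?ltW.
  lra.
rewrite normrM ler_pM// ler_norml /mm.
have : 2 * (1 - q ^+ 2) * s <= 2 * (1 - q ^+ 2) by rewrite ler_piMr//; lra.
have : 0 <= 2 * (1 - q ^+ 2) * s by rewrite mulr_ge0//; lra.
by move: (2 * (1 - q ^+ 2)) g1 => g g1; move: (g * s) => x; lra.
Qed.

Let Dq : set R^o := [set t | `|t| <= q].

(** It provides the boundedness and the Lipschitz continuity of [chord_mean] on [[- q, q]]. *)
Let chord_mean_deriv : exists dk, unif_deriv Dq (fun t (_ : unit) => chord_mean t) dk.
Proof.
have /andP[p0 p1] := disc_p_bounds.
have ut := unif_deriv_id U (fun t (h : Dq t) => h).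
have u1 := unif_deriv_cst (D := Dq) (bounded_cst U (1 : R)).
have um : unif_deriv Dq (fun t (s : U) => 1 - 2 * mm (sval s)) (fun _ _ _ => 0).
  apply: unif_deriv_cst; exists 5 => s; have /andP[s0 s1] := svalP s.
  have g0 : 0 <= 1 - q ^+ 2 <= 1.
    by rewrite subr_ge0 expr_le1 ?(ltW q0)// ?gerBl ?sqr_ge0// ltW// (lt_trans q1)// ltr_pdivrMr// mul1r ltr1n.
  case/andP: g0 => g0 g1; rewrite ler_norml /mm.
  have : (1 - q ^+ 2) * sval s <= 1 by rewrite mulr_ile1.
  have : 0 <= (1 - q ^+ 2) * sval s by rewrite mulr_ge0.
  rewrite (_ : 2 * (_ * _) = 4 * ((1 - q ^+ 2) * sval s)); last by ring.
  move: ((1 - _) * _) => x h1 h2; apply/andP; split; lra.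
have us2 : unif_deriv Dq (fun t (s : U) => sval s ^+ 2) (fun _ _ _ => 0).
  apply: unif_deriv_cst; exists 1 => s; have /andP[s0 s1] := svalP s.
  by rewrite ger0_norm ?sqr_ge0// expr_le1.
have uA := unif_derivB u1 ut.
have uB := unif_derivB u1 (unif_derivM um ut).
have uI1 : exists dk, unif_deriv Dq (fun t (s : U) => (1 - t)^-1) dk.
  eexists; apply: (@unif_deriv_inv _ _ _ _ (1 / 2) _ _ _ _ uA) => // t s /= tq.
  have h2 : (t : R) <= 1 / 2 := le_trans (ler_norm (t : R)) (le_trans tq (ltW q1)).
  move: (t : R) h2 => t' h2; have h3 : 0 <= 1 - t' by lra.
  by rewrite (ger0_norm h3); lra.
have uI2 : exists dk, unif_deriv Dq (fun t (s : U) => (1 - (1 - 2 * mm (sval s)) * t)^-1) dk.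
  eexists; apply: (@unif_deriv_inv _ _ _ _ (1 - p) _ _ _ _ uB) => [|t s tq]; first by rewrite subr_gt0.
  have := mm_bound (svalP s) tq; have := ler_norm ((1 - 2 * mm (sval s)) * t).
  move: (_ * (t : R)) => x h1 h2.
  have h3 : 0 <= 1 - x by lra.
  by rewrite (ger0_norm h3); lra.
have [dk1 {}uI1] := uI1; have [dk2 {}uI2] := uI2.
have uF := unif_derivM us2 (unif_derivM (unif_derivM uI1 uI1) uI2).
eexists; have := unif_deriv_mean (@unit_mean_is_mean R)
  (unif_deriv_reindex (fun p : unit * U => p.2) uF).
move=> /eq_unif_deriv; apply; last by [].
move=> t i _; apply: eq_mean => s /=; rewrite /chord_density -invfM -expr2 -invfM.
by congr (_ * (_ * _)^-1); ring.
Qed.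

Local Notation ecos := (ellipse_cos q).

Lemma norm_ellipse_cos_le x : `|q * ecos x| <= q.
Proof.
have c1 := circle_eq (ellipse_circle q01) x.
rewrite normrM (gtr0_norm q0) ler_piMr ?(ltW q0)// -(@expr_le1 _ 2)// real_normK ?num_real//.
by have := sqr_ge0 (ellipse_sin q x); rewrite -c1; lra.
Qed.

(** One factor [1 / S] comes from the linear form and two come from the speed of the elliptic
    parametrisation; [chord_mean] is the contribution of the latitude. *)
Definition disc_mod (x : R) : R := S x ^- 3 * chord_mean (q * ecos x).

Let S_gt0 x : 0 < S x. Proof. by rewrite sqrtr_gt0 ellipse_sq_gt0. Qed.

Let continuous_cos2 : continuous (fun x : R => cos (2 * pi * x)).
Proof.
move=> x; apply: (@continuous_comp _ _ _ (fun x => 2 * pi * x) cos); last exact: continuous_cos.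
exact: mulrl_continuous.
Qed.

Let continuous_S : continuous (fun x => S x).
Proof.
move=> x; apply: (@continuous_comp _ _ _ (ellipse_sq q) Num.sqrt); last exact: sqrt_continuous.
have -> : ellipse_sq q = (fun x => 1 - q ^+ 2 + q ^+ 2 * (cos (2 * pi * x) * cos (2 * pi * x))).
  by apply/funext => y; rewrite ellipse_sqE.
apply: cvgD; first exact: cvg_cst.
apply: cvgM; first exact: cvg_cst.
by apply: cvgM; exact: continuous_cos2.
Qed.

Let continuous_mod : continuous disc_mod.
Proof.
have [dk /unif_deriv_lipschitz[M M0 kM]] := chord_mean_deriv.
have ct : continuous (fun x => q * ecos x).
  move=> x; apply: cvgM; first exact: cvg_cst.
  apply: cvgM; first exact: continuous_cos2.
  by apply: cvgV; [rewrite gt_eqF|exact: continuous_S].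
have cN : continuous (fun x => chord_mean (q * ecos x)).
  move=> x; apply/cvgrPdist_lt => e e0.
  have M1 : 0 < M + 1 by rewrite ltr_pwDr.
  have eM : 0 < e / (M + 1) by rewrite divr_gt0.
  have /cvgrPdist_lt/(_ _ eM) := ct x.
  apply: filterS => y xy.
  have [_ h] := kM (q * ecos y) (q * ecos x) tt (norm_ellipse_cos_le y) (norm_ellipse_cos_le x).
  apply: le_lt_trans h _; move: xy; rewrite ltr_pdivlMr// mulrC; apply: le_lt_trans.
  by rewrite ler_wpM2r// lerDl.
move=> x; apply: cvgM; last exact: cN.
apply: cvgV; first by rewrite expf_neq0// gt_eqF.
have -> : (fun x => S x ^+ 3) = (fun x => S x * (S x * S x)) by apply/funext => y; ring.
by apply: cvgM; [exact: continuous_S|apply: cvgM; exact: continuous_S].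
Qed.

Lemma bounded_disc_mod : bounded_fct disc_mod.
Proof.
have [dk [M M0 kM]] := chord_mean_deriv.
have b0 := chord_b_gt0 q01.
apply: boundedM; last by exists M => x; have [] := kM _ (norm_ellipse_cos_le x) tt.
exists (b ^- 3) => x; have h : b <= S x by rewrite ler_wsqrtr// ellipse_sq_ge.
rewrite ger0_norm ?invr_ge0 ?exprn_ge0 ?sqrtr_ge0//.
by rewrite lef_pV2 ?posrE ?exprn_gt0// lerXn2r ?nnegrE ?sqrtr_ge0// ltW.
Qed.

Let cos_period (x : R) : cos (2 * pi * (x + 1)) = cos (2 * pi * x).
Proof. by rewrite mulrDr mulr1 mulr_natl cosD2pi. Qed.

Let cos_half (x : R) : cos (2 * pi * (x + 1 / 2)) = - cos (2 * pi * x).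
Proof.
rewrite (_ : 2 * pi * (x + 1 / 2) = 2 * pi * x + pi); last by field.
exact: cosDpi.
Qed.

Let S_half x : S (x + 1 / 2) = S x.
Proof. by rewrite !ellipse_sqE cos_half sqrrN. Qed.

Lemma bounded_chord (t : R) : `|t| <= q ->
  bounded_fct (fun s : U => sval s ^+ 2 * chord_density (mm (sval s)) t).
Proof.
move=> tq; have /andP[p0 p1] := disc_p_bounds.
have p1' : 0 < 1 - p by rewrite subr_gt0.
apply: boundedM.
  exists 1 => s; have /andP[s0 s1] := svalP s.
  by rewrite ger0_norm ?sqr_ge0// expr_le1.
have h2 : t <= 1 / 2 := le_trans (ler_norm t) (le_trans tq (ltW q1)).
have h3 : 1 / 2 <= 1 - t by lra.
exists ((1 / 2) ^+ 2 * (1 - p))^-1 => s; rewrite /chord_density.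
have -> : 1 - t + 2 * mm (sval s) * t = 1 - (1 - 2 * mm (sval s)) * t by ring.
have h4 : 1 - p <= 1 - (1 - 2 * mm (sval s)) * t.
  by rewrite lerD2l lerN2 (le_trans (ler_norm _))// mm_bound// (svalP s).
have h5 : (1 / 2) ^+ 2 * (1 - p) <= (1 - t) ^+ 2 * (1 - (1 - 2 * mm (sval s)) * t).
  by rewrite ler_pM ?sqr_ge0 ?(ltW p1')// lerXn2r ?nnegrE//; lra.
have h6 : 0 < (1 / 2) ^+ 2 * (1 - p) by rewrite mulr_gt0// exprn_gt0.
rewrite ger0_norm ?invr_ge0; last exact: le_trans (ltW h6) h5.
by rewrite lef_pV2 ?posrE// (lt_le_trans h6).
Qed.

Let ratio_sqr x : (b / S x) ^+ 2 = 1 - (q * ecos x) ^+ 2.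
Proof.
have S2 : S x ^+ 2 = 1 - q ^+ 2 + q ^+ 2 * cos (2 * pi * x) ^+ 2.
  by rewrite sqr_sqrtr ?ellipse_sqE// -ellipse_sqE ltW// ellipse_sq_gt0.
have S0 := S_gt0 x; rewrite /ellipse_cos; move: S2 S0.
move: (S x) (cos (2 * pi * x)) => s c S2 S0.
rewrite expr_div_n chord_b_sqr// (_ : 1 - q ^+ 2 = s ^+ 2 - q ^+ 2 * c ^+ 2); last by rewrite S2; ring.
by field; rewrite gt_eqF.
Qed.

Let chord_facts x (s : U) : 0 < chord_den (mm (sval s)) (S x / b) /\
  (b / S x) ^+ 3 * (chord_density (mm (sval s)) (q * ecos x) +
    chord_density (mm (sval s)) (- (q * ecos x))) = chord_fun (mm (sval s)) (S x / b).
Proof.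
have /andP[p0 p1] := disc_p_bounds.
rewrite -[S x / b]invf_div; apply: chord_densityD.
- by rewrite divr_gt0 ?S_gt0// chord_b_gt0.
- exact: ratio_sqr.
have h := mm_bound (svalP s) (norm_ellipse_cos_le x).
rewrite -real_normK ?num_real// expr_lt1//; exact: le_lt_trans h p1.
Qed.

(** Half a turn reverses the sign of [ecos] and preserves [S], so the densities at [t] and [- t] are
    paired, and [S ^- 3] supplies the cube of [u = b / S]. *)
Let modD x : disc_mod x + disc_mod (x + 1 / 2) =
  b ^- 3 * unit_mean (fun s : U => sval s ^+ 2 * chord_fun (mm (sval s)) (S x / b)).
Proof.
have mU := @unit_mean_is_mean R.
have -> : disc_mod (x + 1 / 2) = S x ^- 3 * chord_mean (- (q * ecos x)).
  by rewrite /disc_mod S_half; congr (_ * chord_mean _); rewrite /ellipse_cos S_half cos_half; ring.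
have bt1 := bounded_chord (norm_ellipse_cos_le x).
have bt2 : bounded_fct (fun s : U => sval s ^+ 2 * chord_density (mm (sval s)) (- (q * ecos x))).
  by apply: bounded_chord; rewrite normrN norm_ellipse_cos_le.
rewrite /disc_mod -mulrDr -(meanD mU)//.
have b0 := chord_b_gt0 q01; have S0 := S_gt0 x.
have -> : S x ^- 3 = b ^- 3 * (b / S x) ^+ 3.
  by move: (b) (S x) b0 S0 => b' S' b0 S0; field; rewrite !gt_eqF.
rewrite -mulrA; congr (_ * _); rewrite -(meanZ mU); last exact: boundedD.
apply: eq_mean => s; have [_ <-] := chord_facts x s; ring.
Qed.

Let bounded_chord_fun x : bounded_fct (fun s : U => sval s ^+ 2 * chord_fun (mm (sval s)) (S x / b)).
Proof.
have bt1 := bounded_chord (norm_ellipse_cos_le x).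
have bt2 : bounded_fct (fun s : U => sval s ^+ 2 * chord_density (mm (sval s)) (- (q * ecos x))).
  by apply: bounded_chord; rewrite normrN norm_ellipse_cos_le.
have [M HM] := boundedM (bounded_cst U ((b / S x) ^+ 3)) (boundedD bt1 bt2).
by exists M => s; have [_ <-] := chord_facts x s; rewrite mulrCA mulrDr; exact: HM.
Qed.

(** The variable [h = S / b] is at least 1 and grows with [|cos|], so monotonicity in [h] holds
    under the mean over [s]. *)
Lemma disc_mod_mono x y : `|cos (2 * pi * x)| <= `|cos (2 * pi * y)| ->
  disc_mod x + disc_mod (x + 1 / 2) <= disc_mod y + disc_mod (y + 1 / 2).
Proof.
move=> xy; have b0 := chord_b_gt0 q01; rewrite !modD ler_wpM2l ?invr_ge0 ?exprn_ge0 ?(ltW b0)//.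
apply: (le_mean (@unit_mean_is_mean R)); [exact: bounded_chord_fun|exact: bounded_chord_fun|move=> s].
rewrite ler_wpM2l ?sqr_ge0//.
have bS z : b <= S z by rewrite ler_wsqrtr// ellipse_sq_ge.
apply: chord_fun_nondecreasing.
- have /andP[s0 s1] := svalP s; rewrite /mm mulr_ge0// mulr_ge0//.
  by rewrite -chord_b_sqr// sqr_ge0.
- by rewrite ler_pdivlMr// mul1r.
- rewrite ler_pM2r ?invr_gt0// ler_wsqrtr// !ellipse_sqE lerD2l ler_wpM2l ?sqr_ge0//.
  by rewrite -[leLHS]real_normK ?num_real// -[leRHS]real_normK ?num_real// lerXn2r.
- by have [] := chord_facts x s.
- by have [] := chord_facts y s.
Qed.

Theorem disc_rearrangement (a : R) :
  unit_mean (fun u : U => `|cos (2 * pi * sval u - a)| * disc_mod (sval u)) <=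
  unit_mean (fun u : U => `|cos (2 * pi * sval u)| * disc_mod (sval u)).
Proof.
have p0 : (2 * pi : R) != 0 by rewrite mulf_neq0// lt0r_neq0// pi_gt0.
have := @rearrangement R (fun x => `|cos (2 * pi * x)|) disc_mod (a / (2 * pi)).
have -> : (fun u : U => `|cos (2 * pi * (sval u - a / (2 * pi)))| * disc_mod (sval u)) =
    (fun u => `|cos (2 * pi * sval u - a)| * disc_mod (sval u)).
  by apply/funext => u; rewrite mulrBr [_ * (a / _)]mulrC divfK.
apply.
- by move=> x; apply: (@continuous_comp _ _ _ (fun x => cos (2 * pi * x)) (fun x => `|x|));
    [exact: continuous_cos2|exact: norm_continuous].
- exact: continuous_mod.
- by exists 1 => x; rewrite normr_id ler_norml cos_geN1 cos_le1.
- exact: bounded_disc_mod.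
- by move=> x; rewrite /disc_mod /ellipse_cos !ellipse_sqE !cos_period.
- by move=> x; rewrite mulrN cosN.
- by move=> x; rewrite cos_half normrN.
- exact: disc_mod_mono.
Qed.

End DiscInequality.

(** * Integration over the latitude *)

Section ChordIntegral.
Context {R : realType}.
Variable q : R.
Hypothesis q01 : 0 < q < 1 / 2.
Local Notation U := (unitI R).
Local Notation b := (chord_b q).
Local Notation S x := (Num.sqrt (ellipse_sq q x)).
Local Notation p := (disc_p q).
Local Notation W := (disc_weight q).

Lemma is_derive_projective (t x : R) : 1 - t + t * x != 0 ->
  is_derive x (1 : R) (fun y => y / (1 - t + t * y)) ((1 - t) / (1 - t + t * x) ^+ 2).
Proof.
move=> d0; have da := is_derive_affine (1 - t) t x.
have dV : is_derive x (1 : R) (fun y => (1 - t + t * y)^-1) (- (1 - t + t * x) ^- 2 * t).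
  have [d1 d2] := da; split; first exact: derivableV.
  by rewrite deriveV// d2.
have di : is_derive x (1 : R) (fun y : R => y) (1 : R) by exact: is_derive_id.
have H := is_deriveM di dV.
apply: (is_derive_eq H).
rewrite /GRing.scale /=; field; exact: d0.
Qed.

(** The substitution [sin = s / (1 - t + t * s)] with [t = q * C] fixes 0 and 1 and makes both
    factors of the weight fractions over [1 - t + t * s]. All powers of this denominator cancel,
    leaving [s ^+ 2] times the chord density with slope parameter [2 * (1 - q ^+ 2) * s]. *)
Lemma unit_mean_chord (C : R) : `|C| <= 1 ->
  unit_mean (fun u : U => sin (pi / 2 * sval u) ^+ 2 * cos (pi / 2 * sval u) *
     W (sin (pi / 2 * sval u) * C)) = 2 / pi * chord_mean q (q * C).
Proof.
move=> C1; have mU := @unit_mean_is_mean R.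
have /andP[q0 q1] := q01; have /andP[p0 p1] := disc_p_bounds q01.
pose f (x : R) := x ^+ 2 * W (x * C).
(* [unit_mean_subst] asks for continuity on the whole line, while [f] may have poles outside
   [[0, 1]]; clamping the argument extends it. *)
pose cl (x : R) : R := Num.min (Num.max x 0) 1.
have clE x : 0 <= x <= 1 -> cl x = x by move=> x01; exact: to_unitIE.
have cl01 x : 0 <= cl x <= 1 by exact: unitI_subproof.
have ccl : continuous cl.
  move=> x; apply: (@continuous_min R R (fun y : R => Num.max y 0) (fun=> 1)); last exact: cvg_cst.
  by apply: (@continuous_max R R (fun y : R => y) (fun=> 0)); [exact: cvg_id|exact: cvg_cst].
have xC x : 0 <= x <= 1 -> `|x * C| <= 1.
  by case/andP=> x0 x1; rewrite normrM mulr_ile1// ger0_norm.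
have cf x : 0 <= x <= 1 -> {for x, continuous f}.
  move=> x01; have [d1 d2] := disc_weight_den_gt0 q01 (xC x x01).
  have cx : {for x, continuous (fun y : R => y * C)} by exact: mulrr_continuous.
  have c1 (k : R) : {for x, continuous (fun y : R => k * (y * C))} by apply: cvgM; [exact: cvg_cst|exact: cx].
  have c2 : {for x, continuous (fun y : R => 1 + p * (y * C))} by apply: cvgD; [exact: cvg_cst|exact: c1].
  have c3 : {for x, continuous (fun y : R => 1 - q * (y * C))} by apply: cvgB; [exact: cvg_cst|exact: c1].
  have c4 : {for x, continuous (fun y : R => (1 - q * (y * C)) ^+ 3)}.
    exact: (continuous_comp c3 (@exprn_continuous R 3 _)).
  have c5 : {for x, continuous (fun y : R => W (y * C))}.
    by apply: (cvgV _ (cvgM c2 c4)); rewrite mulf_neq0 ?expf_neq0// gt_eqF.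
  exact: (cvgM (@exprn_continuous R 2 x) c5).
have cF : continuous (fun x => f (cl x)).
  by move=> x; apply: (@continuous_comp _ _ _ cl f); [exact: ccl|exact/cf].
have [t tE] : exists t, q * C = t by exists (q * C).
rewrite tE.
have tq : `|t| <= q by rewrite -tE normrM (gtr0_norm q0) ler_piMr// ltW.
have t1 : `|t| < 1 by apply: le_lt_trans tq _; lra.
have den x : 0 <= x <= 1 -> 0 < 1 - t + t * x.
  case/andP=> x0 x1; move: t1; rewrite ltr_norml => /andP[t2 t3].
  have : 0 <= (1 - t) * (1 - x) by rewrite mulr_ge0; lra.
  by rewrite mulrBr mulr1 mulrBl mul1r; nra.
have := @unit_mean_subst R (fun x => f (cl x)) (fun x => sin (pi / 2 * x))
  (fun x => cos (pi / 2 * x) * (pi / 2)) (fun x => x / (1 - t + t * x))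
  (fun x => (1 - t) / (1 - t + t * x) ^+ 2) cF.
have pi0 := @pi_gt0 R.
move=> /(_ _ _ _ _)H.
have {}H : unit_mean (fun u : U => f (cl (sin (pi / 2 * sval u))) * (cos (pi / 2 * sval u) * (pi / 2))) =
  unit_mean (fun u : U => f (cl (sval u / (1 - t + t * sval u))) * ((1 - t) / (1 - t + t * sval u) ^+ 2)).
  apply: H.
  - move=> x /andP[x0 x1]; split.
    + have h : 0 <= pi / 2 * x <= pi / 2 by rewrite mulr_ge0 ?divr_ge0 ?(ltW pi0)//= ler_piMr// divr_ge0// ltW.
      rewrite sin_le1 andbT; apply: sin_ge0_pi; case/andP: h => h1 h2; lra.
    + have h := is_derive_affine 0 (pi / 2) x.
      have e : (fun x : R => sin (pi / 2 * x)) = sin \o (fun y => 0 + pi / 2 * y).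
        by apply/funext => y /=; rewrite add0r.
      rewrite e -[pi / 2 * x]add0r.
      exact: (@is_derive1_comp _ sin (fun y => 0 + pi / 2 * y) x _ _ (is_derive_sin _) h).
    + have ch : {for x, continuous (fun y : R => cos (pi / 2 * y))}.
        apply: (@continuous_comp _ _ _ (fun y => pi / 2 * y) cos); last exact: continuous_cos.
        exact: mulrl_continuous.
      by apply: (cvgM ch); exact: cvg_cst.
  - move=> x x01; have d0 := den x x01; split.
    + case/andP: (x01) => x0 x1; rewrite divr_ge0 ?(ltW d0)//= ler_pdivrMr// mul1r.
      rewrite -subr_ge0 (_ : _ - _ = (1 - t) * (1 - x)); last by ring.
      by rewrite mulr_ge0 ?subr_ge0// ltW// (le_lt_trans (ler_norm _)).
    + by apply: is_derive_projective; rewrite gt_eqF.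
    + have cd : {for x, continuous (fun y : R => 1 - t + t * y)}.
        by apply: cvgD; [exact: cvg_cst|exact: mulrl_continuous].
      apply: cvgM; first exact: cvg_cst.
      apply: cvgV; first by rewrite expf_neq0// gt_eqF.
      exact: (continuous_comp cd (@exprn_continuous R 2 _)).
  - by rewrite mulr0 sin0 mul0r.
  - by rewrite mulr1 sin_pihalf mulr1 subrK divr1.
have bF : bounded_fct (fun x => f (cl x)).
  have D0 : 0 < (1 - p) * (1 - q) ^+ 3.
    by rewrite mulr_gt0 ?subr_gt0 ?exprn_gt0 ?subr_gt0//; lra.
  exists ((1 - p) * (1 - q) ^+ 3)^-1 => x; have x01 := cl01 x; move: (cl x) x01 => y y01.
  have [d1 d2] := disc_weight_den_gt0 q01 (xC y y01).
  have /andP[y0 y1] := y01.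
  have yC : - 1 <= y * C <= 1 by rewrite -ler_norml xC.
  case/andP: yC => yC0 yC1.
  have e1 : 1 - p <= 1 + p * (y * C).
    by rewrite lerD2l -[- p]mulrN1 ler_wpM2l// ltW.
  have e2 : 1 - q <= 1 - q * (y * C).
    by rewrite lerD2l lerN2 ler_piMr// ltW.
  rewrite normrM ger0_norm ?sqr_ge0// ger0_norm; last first.
    by rewrite invr_ge0 mulr_ge0 ?exprn_ge0// ltW.
  apply: (@le_trans _ _ (W (y * C))).
    by rewrite ler_piMl ?expr_le1// invr_ge0 mulr_ge0 ?exprn_ge0// ltW.
  have D1 : 0 < (1 + p * (y * C)) * (1 - q * (y * C)) ^+ 3 by rewrite mulr_gt0// exprn_gt0.
  rewrite lef_pV2 ?posrE//.
  by rewrite ler_pM ?exprn_ge0 ?lerXn2r ?nnegrE ?subr_ge0 ?(ltW d2)//; lra.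
have bG : bounded_fct (fun u : U => f (cl (sin (pi / 2 * sval u))) * (cos (pi / 2 * sval u) * (pi / 2))).
  apply: boundedM; first by have [M HM] := bF; exists M => u.
  apply: boundedM; last exact: bounded_cst.
  by exists 1 => u; rewrite ler_norml cos_geN1 cos_le1.
have pn : (pi : R) != 0 by rewrite gt_eqF.
transitivity (2 / pi * unit_mean (fun u : U => f (cl (sin (pi / 2 * sval u))) *
    (cos (pi / 2 * sval u) * (pi / 2)))).
  rewrite -(meanZ mU)//; apply: eq_mean => u; rewrite clE.
    rewrite /f; move: (sin (pi / 2 * sval u)) (cos (pi / 2 * sval u)) (W (sin (pi / 2 * sval u) * C)) => s c w.
    by move: pn; move: (pi : R) => P P0; field.
  have /andP[u0 u1] := svalP u.
  have h : 0 <= pi / 2 * sval u <= pi / 2 by rewrite mulr_ge0 ?divr_ge0 ?(ltW pi0)//= ler_piMr// divr_ge0// ltW.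
  rewrite sin_le1 andbT; apply: sin_ge0_pi; case/andP: h => h1 h2; lra.
rewrite H; congr (_ * _); apply: eq_mean => s.
have d0 := den _ (svalP s).
have /andP[s0 s1] := svalP s.
have l01 : 0 <= sval s / (1 - t + t * sval s) <= 1.
  rewrite divr_ge0 ?(ltW d0)//= ler_pdivrMr// mul1r.
  rewrite -subr_ge0 (_ : _ - _ = (1 - t) * (1 - sval s)); last by ring.
  by rewrite mulr_ge0 ?subr_ge0// ltW// (le_lt_trans (ler_norm _)).
rewrite clE// /f; have [d1 d2] := disc_weight_den_gt0 q01 (xC _ l01).
move: (sval s) d0 s0 s1 l01 d1 d2 => x d0 s0 s1 l01 d1 d2.
have e1 : 1 + p * (x / (1 - t + t * x) * C) = (1 - t + 2 * chord_slope q x * t) / (1 - t + t * x).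
  rewrite (_ : p = (3 - 4 * q ^+ 2) * q); last by rewrite /disc_p; ring.
  rewrite (_ : _ * q * _ = (3 - 4 * q ^+ 2) * (x / (1 - t + t * x)) * (q * C)); last by ring.
  rewrite tE /chord_slope; field.
  by rewrite gt_eqF.
have e2 : 1 - q * (x / (1 - t + t * x) * C) = (1 - t) / (1 - t + t * x).
  rewrite (_ : q * _ = (x / (1 - t + t * x)) * (q * C)); last by ring.
  rewrite tE; field.
  by rewrite gt_eqF.
rewrite /disc_weight /chord_density e1 e2; move: d1 d2; rewrite e1 e2.
rewrite !pmulr_lgt0 ?invr_gt0//; move: d0.
move: (1 - t) (1 - t + t * x) (1 - t + 2 * chord_slope q x * t) => B d A d0 A0 B0; field.
by rewrite !gt_eqF.
Qed.

End ChordIntegral.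

(** * From the sphere to the circle *)

Section DiscTriple.
Context {R : realType}.
Variable q : R.
Hypothesis q01 : 0 < q < 1 / 2.
Local Notation U := (unitI R).
Local Notation b := (chord_b q).
Local Notation S x := (Num.sqrt (ellipse_sq q x)).
Local Notation W := (disc_weight q).
Local Notation hopf := (@hopf R (ellipse_cos q) (ellipse_sin q)).
Local Notation hopf_weight := (@hopf_weight R (ellipse_speed q)).

Lemma disc_weight_bound : exists M, forall t, `|t| <= 1 -> `|W t| <= M.
Proof.
have /andP[q0 q1] := q01; have /andP[p0 p1] := disc_p_bounds q01.
have D0 : 0 < (1 - disc_p q) * (1 - q) ^+ 3.
  by rewrite mulr_gt0 ?subr_gt0 ?exprn_gt0 ?subr_gt0//; lra.
exists ((1 - disc_p q) * (1 - q) ^+ 3)^-1 => t t1.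
have [d1 d2] := disc_weight_den_gt0 q01 t1.
have /andP[t2 t3] : -1 <= t <= 1 by rewrite -ler_norml.
have e1 : 1 - disc_p q <= 1 + disc_p q * t.
  by rewrite lerD2l -[- disc_p q]mulrN1 ler_wpM2l// ltW.
have e2 : 1 - q <= 1 - q * t by rewrite lerD2l lerN2 ler_piMr// ltW.
have D1 : 0 < (1 + disc_p q * t) * (1 - q * t) ^+ 3 by rewrite mulr_gt0// exprn_gt0.
rewrite ger0_norm ?invr_ge0 ?(ltW D1)// lef_pV2 ?posrE//.
by rewrite ler_pM ?exprn_ge0 ?lerXn2r ?nnegrE ?subr_ge0 ?(ltW d2)//; lra.
Qed.

Lemma ellipse_cos_norm_le1 x : `|ellipse_cos q x| <= 1.
Proof.
have c1 := circle_eq (ellipse_circle q01) x.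
rewrite -(@expr_le1 _ 2)// real_normK ?num_real//.
by have := sqr_ge0 (ellipse_sin q x); rewrite -c1; lra.
Qed.

(** The third Hopf coordinate does not occur and the second is integrated by [unit_mean_chord]. The
    constant collects [2 / pi] from there, [2 * pi * b] from the speed and [b] from the linear
    form. *)
Lemma triple_mean_disc (c s : R) :
  triple_mean (fun i => hopf_weight i *
    (`|c * b * hopf i 0 o0 + s * hopf i 0 o1| * W (hopf i 0 o0))) =
  4 * b ^+ 2 * unit_mean (fun u : U =>
    `|c * cos (2 * pi * sval u) + s * sin (2 * pi * sval u)| * disc_mod q (sval u)).
Proof.
have mU := @unit_mean_is_mean R; have b0 := chord_b_gt0 q01; have pi0 := @pi_gt0 R.
rewrite -(meanZ mU); last first.
  apply: boundedM; last first.
    by have [M HM] := bounded_disc_mod q01; exists M => u.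
  exists (`|c| + `|s|) => u; rewrite normr_id (le_trans (ler_normD _ _))// lerD// normrM ler_piMr//.
    by rewrite ler_norml cos_geN1 cos_le1.
  by rewrite ler_norml sin_geN1 sin_le1.
rewrite /triple_mean; apply: eq_mean => a.
pose C := ellipse_cos q (sval a).
have C1 : `|C| <= 1 by exact: ellipse_cos_norm_le1.
pose K := ellipse_speed q (sval a) * `|c * b * C + s * ellipse_sin q (sval a)|.
transitivity (unit_mean (fun u : U => K * (sin (pi / 2 * sval u) ^+ 2 * cos (pi / 2 * sval u) *
     W (sin (pi / 2 * sval u) * C)))).
  apply: eq_mean => u; rewrite -[RHS](mean_cst mU); apply: eq_mean => v.
  have -> : hopf (a, (u, v)) 0 o0 = sin (pi / 2 * sval u) * C by rewrite mxE.
  have -> : hopf (a, (u, v)) 0 o1 = sin (pi / 2 * sval u) * ellipse_sin q (sval a) by rewrite mxE.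
  rewrite /hopf_weight /= /K; have /andP[u0 u1] := svalP u.
  have h : 0 <= pi / 2 * sval u <= pi / 2 by rewrite mulr_ge0 ?divr_ge0 ?(ltW pi0)//= ler_piMr// divr_ge0// ltW.
  have s0 : 0 <= sin (pi / 2 * sval u) by apply: sin_ge0_pi; case/andP: h => h1 h2; lra.
  move: (sin _) (cos _) s0 (W _) => x y x0 w.
  rewrite (_ : _ + s * (x * _) = x * (c * b * C + s * ellipse_sin q (sval a))); last by ring.
  by rewrite normrM (ger0_norm x0); ring.
rewrite (meanZ mU).
  rewrite unit_mean_chord// /K /disc_mod -/C /ellipse_speed.
  have E0 := ellipse_sq_gt0 q01 (sval a); have S0 : 0 < S (sval a) by rewrite sqrtr_gt0.
  have S2 : ellipse_sq q (sval a) = S (sval a) ^+ 2 by rewrite sqr_sqrtr// ltW.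
  have -> : `|c * b * C + s * ellipse_sin q (sval a)| = b / S (sval a) *
      `|c * cos (2 * pi * sval a) + s * sin (2 * pi * sval a)|.
    rewrite -[b / _]ger0_norm ?divr_ge0 ?ltW// -normrM; congr `|_|.
    by rewrite /C /ellipse_cos /ellipse_sin; ring.
  have -> : 2 * pi * b / ellipse_sq q (sval a) = 2 * pi * b / S (sval a) ^+ 2 by rewrite -S2.
  move: (S (sval a)) S0 (chord_mean _ _) `|_| => x x0 y z.
  by move: (pi : R) pi0 => P P0; field; rewrite !gt_eqF.
apply: boundedM.
  apply: boundedM.
    exists 1 => u; rewrite normrX exprn_ile1//.
    by rewrite ler_norml sin_geN1 sin_le1.
  by exists 1 => u; rewrite ler_norml cos_geN1 cos_le1.
have [M HM] := disc_weight_bound; exists M => u; apply: HM.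
by rewrite normrM mulr_ile1// ler_norml sin_geN1 sin_le1.
Qed.

Theorem disc_inequality (c s : R) : c ^+ 2 + s ^+ 2 = 1 ->
  triple_mean (fun i => hopf_weight i *
    (`|c * b * hopf i 0 o0 + s * hopf i 0 o1| * W (hopf i 0 o0))) <=
  triple_mean (fun i => hopf_weight i *
    (`|1 * b * hopf i 0 o0 + 0 * hopf i 0 o1| * W (hopf i 0 o0))).
Proof.
move=> cs; rewrite !triple_mean_disc ler_wpM2l//.
  by rewrite mulr_ge0// exprn_ge0// ltW// chord_b_gt0.
have [r [a [r0 cE sE rE]]] := polar_coordinates c s.
have r1 : r = 1 by apply/eqP; rewrite -(@eqrXn2 _ 2)// rE cs expr1n.
have -> : (fun u : U => `|c * cos (2 * pi * sval u) + s * sin (2 * pi * sval u)| * disc_mod q (sval u)) =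
    (fun u => `|cos (2 * pi * sval u - a)| * disc_mod q (sval u)).
  by apply/funext => u; rewrite cE sE r1 !mul1r cosB; congr (`|_| * _); ring.
have -> : (fun u : U => `|1 * cos (2 * pi * sval u) + 0 * sin (2 * pi * sval u)| * disc_mod q (sval u)) =
    (fun u => `|cos (2 * pi * sval u)| * disc_mod q (sval u)).
  by apply/funext => u; rewrite mul1r mul0r addr0.
exact: disc_rearrangement.
Qed.

End DiscTriple.

(** * Orthonormal frames *)

Section Frames.
Context {R : realType}.
Local Notation T := 'rV[R]_4.
Implicit Types (u v w n e : T).

(** For [w = 0] this is the identity, so the reflection exchanging two vectors of equal length makes
    sense even when they coincide. *)
Definition reflection w u : T := u - (2 * dotv u w / dotv w w) *: w.

Lemma reflection_adj w u v : dotv (reflection w u) v = dotv u (reflection w v).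
Proof. by rewrite dotvBl dotvBr dotvZl dotvZr [dotv w v]dotvC; ring. Qed.

Lemma reflection_isometry w u v :
  dotv (reflection w u) (reflection w v) = dotv u v.
Proof.
have [->|w0] := eqVneq w 0; first by rewrite /reflection !scaler0 !subr0.
have ww : dotv w w != 0 by rewrite dotv_eq0.
rewrite dotvBl !dotvBr !dotvZl !dotvZr [dotv w v]dotvC.
by move: (dotv u v) (dotv u w) (dotv v w) (dotv w w) ww => a b c d d0; field.
Qed.

Lemma reflection_swap u v : dotv u u = dotv v v -> reflection (u - v) u = v.
Proof.
move=> uv; have [->|w0] := eqVneq u v.
  by rewrite /reflection subrr scaler0 subr0.
have ww : dotv (u - v) (u - v) != 0 by rewrite dotv_eq0 subr_eq0.
have e : dotv (u - v) (u - v) = 2 * dotv u (u - v).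
  by rewrite dotvBl !dotvBr [dotv v u]dotvC -uv; ring.
by rewrite /reflection -e divff// scale1r opprB addrC subrK.
Qed.

Lemma reflection_orth w u : dotv u w = 0 -> reflection w u = u.
Proof. by move=> uw; rewrite /reflection uw mulr0 mul0r scale0r subr0. Qed.

(** Inner products and norms determine the Poisson kernel, so orthogonal maps enter only through
    their adjoint and the preservation of norms. *)
Record isometry_pair (O O' : T -> T) : Prop := IsometryPair {
  isometry_adj : forall u v, dotv (O u) v = dotv u (O' v);
  isometry_sq : forall u, dotv (O u) (O u) = dotv u u;
  isometry_sq' : forall u, dotv (O' u) (O' u) = dotv u u }.

Let e0 : T := delta_mx 0 o0.
Let e1 : T := delta_mx 0 o1.
Let e00 : dotv e0 e0 = 1. Proof. by rewrite dotv_delta mxE. Qed.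
Let e11 : dotv e1 e1 = 1. Proof. by rewrite dotv_delta mxE. Qed.
Let e01 : dotv e0 e1 = 0. Proof. by rewrite dotv_delta mxE. Qed.

Lemma reflection_swapC u v : dotv u u = dotv v v -> reflection (u - v) v = u.
Proof.
move=> uv; rewrite -[RHS](reflection_swap (esym uv)) /reflection -(opprB v u).
rewrite !(dotvNl, dotvNr) opprK mulrN mulNr scalerN scaleNr opprK.
by [].
Qed.

(** The first reflection exchanges the first axis and [n]; the second exchanges the second axis and
    the image of [e], and fixes the first axis because both vectors are orthogonal to it. *)
Lemma exists_frame n e : dotv n n = 1 -> dotv e e = 1 -> dotv n e = 0 ->
  exists O O', [/\ isometry_pair O O', forall u, dotv (O u) n = u 0 o0 &
    forall u, dotv (O u) e = u 0 o1].
Proof.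
move=> nn ee ne.
have e0n : dotv e0 e0 = dotv n n by rewrite e00.
pose H1 := reflection (e0 - n); pose e' := H1 e.
have e1e' : dotv e1 e1 = dotv e' e' by rewrite e11 reflection_isometry.
pose H2 := reflection (e1 - e').
have e'0 : dotv e0 e' = 0 by rewrite -reflection_adj reflection_swap.
have H20 : H2 e0 = e0 by apply: reflection_orth; rewrite dotvBr e01 e'0 subr0.
exists (fun u => H1 (H2 u)), (fun u => H2 (H1 u)); split.
- split=> [u v|u|u].
  + by rewrite !reflection_adj.
  + by rewrite !reflection_isometry.
  + by rewrite !reflection_isometry.
- move=> u; rewrite reflection_adj [reflection _ n]reflection_swapC//.
  by rewrite reflection_adj -/H2 H20 dotv_delta.
- move=> u; rewrite reflection_adj -/(H1 e) -/e' reflection_adj.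
  by rewrite [reflection _ e']reflection_swapC// dotv_delta.
Qed.

Lemma exists_orthogonal n : dotv n n = 1 -> exists2 e, dotv e e = 1 & dotv n e = 0.
Proof.
move=> nn; pose H1 := reflection (e0 - n).
have H1e : H1 e0 = n by apply: reflection_swap; rewrite e00.
exists (H1 e1); first by rewrite reflection_isometry.
by rewrite -H1e reflection_isometry.
Qed.

Lemma direction_decomposition n v : dotv n n = 1 -> dotv v v = 1 ->
  exists e c s, [/\ dotv e e = 1, dotv n e = 0, c ^+ 2 + s ^+ 2 = 1 & v = c *: n + s *: e].
Proof.
move=> nn vv; pose c := dotv v n; pose w := v - c *: n.
have vE : v = c *: n + w by rewrite addrC subrK.
have nw : dotv n w = 0 by rewrite dotvBr dotvZr nn mulr1 dotvC subrr.
move: (w) vE nw => {}w vE nw.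
have ww : c ^+ 2 + dotv w w = 1.
  have : dotv (c *: n + w) (c *: n + w) = 1 by rewrite -vE.
  have wn : dotv w n = 0 by rewrite dotvC.
  rewrite dotvDl !dotvDr !dotvZl !dotvZr nn nw wn => <-; ring.
(* If [v] is a multiple of [n] there is no orthogonal part to normalise, and any unit vector
   orthogonal to [n] serves with [s = 0]. *)
have [w0|w0] := eqVneq w 0.
  have [e ee ne] := exists_orthogonal nn.
  exists e, c, 0; split=> //; last by rewrite scale0r addr0 {1}vE w0 addr0.
  by move: ww; have /eqP -> : dotv w w == 0; [rewrite dotv_eq0 w0|rewrite expr0n].
have s0 : enorm w != 0 by rewrite sqrtr_eq0 -ltNge dotv_gt0.
exists ((enorm w)^-1 *: w), c, (enorm w); split.
- by rewrite dotvZl dotvZr mulrA -expr2 exprVn -enorm_sqr mulVf// expf_neq0.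
- by rewrite dotvZr nw mulr0.
- by rewrite enorm_sqr.
- by rewrite scalerA divff// scale1r.
Qed.

Lemma poisson_isometry O O' z y : isometry_pair O O' ->
  poisson (O z) y = poisson z (O' y).
Proof.
move=> [adj sq sq']; rewrite /poisson /newton sq'; congr (_ * _^-1 ^+ 2).
rewrite !dotvBl !dotvBr sq sq' [dotv y (O z)]dotvC adj.
by rewrite [dotv (O' y) z]dotvC.
Qed.

End Frames.

(** * The gradient of the Poisson kernel in projective coordinates *)

Section GradientKernel.
Context {R : realType}.
Local Notation T := 'rV[R]_4.

(** Over the common denominator the terms quadratic in [q] cancel in the coefficient of [dotv z n],
    and the constant term is what defines [disc_p]. *)
Lemma poisson1_direction (z n e : T) (q c s : R) :
  dotv z z = 1 -> dotv n n = 1 -> dotv n e = 0 ->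
  1 + 4 * q ^+ 2 - 4 * q * dotv z n != 0 ->
  \sum_j poisson1 z j ((2 * q) *: n) * (c *: n + s *: e) 0 j =
  4 * (c * (dotv z n - disc_p q) + s * (1 - 4 * q ^+ 2) * dotv z e) /
  (1 + 4 * q ^+ 2 - 4 * q * dotv z n) ^+ 3.
Proof.
move=> zz nn ne; set x := _ *: n; set v := c *: n + s *: e => D0.
have xz : dotv (x - z) (x - z) = 1 + 4 * q ^+ 2 - 4 * q * dotv z n.
  rewrite dotvBl !dotvBr !dotvZl !dotvZr [dotv n z]dotvC zz nn; ring.
transitivity (- 2 * dotv x v * newton z x ^+ 2 -
    4 * (1 - dotv x x) * dotv (x - z) v * newton z x ^+ 3).
  rewrite [dotv x v]/dotv [dotv (x - z) v]/dotv !mulr_sumr !mulr_suml -sumrB.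
  by apply: eq_bigr => j _; rewrite /poisson1 !mxE; ring.
rewrite /newton xz dotvBl !dotvDr !dotvZl !dotvZr nn ne /disc_p.
by move: (dotv z n) (dotv z e) D0 => t w D0; field.
Qed.

Section KleinKernel.
Context {I : Type} {xi : I -> T} {J : I -> R}.
Hypothesis xi1 : forall i, dotv (xi i) (xi i) = 1.
Variables (q k : R).
Hypothesis q01 : 0 < q < 1 / 2.
Hypothesis k01 : 0 < k < 1.
Hypothesis kp : klein_p k = disc_p q.
Hypothesis kb : klein_b k = chord_b q * (1 - 4 * q ^+ 2).

(* In projective coordinates the gradient of the Poisson kernel at [2 q n] is,
   up to a constant, linear in [xi] times a weight depending on [xi 0] only. *)
Lemma klein_poisson1 (z n e : T) (c s : R) (i : I) :
  dotv z z = 1 -> dotv n n = 1 -> dotv n e = 0 ->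
  dotv z n = @klein R I xi k i 0 o0 -> dotv z e = @klein R I xi k i 0 o1 ->
  @klein_density R I xi J k i * (\sum_j poisson1 z j ((2 * q) *: n) * (c *: n + s *: e) 0 j) =
  4 * chord_b q ^+ 4 / (1 - 4 * q ^+ 2) * (J i *
    ((c * chord_b q * xi i 0 o0 + s * xi i 0 o1) * disc_weight q (xi i 0 o0))).
Proof.
move=> zz nn ne zn ze.
have d0 := klein_den_gt0 xi1 k01 i.
have x1 : `|xi i 0 o0| <= 1.
  rewrite -(@expr_le1 _ 2)// real_normK ?num_real// -(xi1 i) dotv4 -!expr2.
  by rewrite -!addrA lerDl !addr_ge0 ?sqr_ge0.
have [p1 q1] := disc_weight_den_gt0 q01 x1.
have r1 : 0 < 1 - 4 * q ^+ 2.
  have /andP[h0 h1] := q01.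
  have -> : 1 - 4 * q ^+ 2 = (1 - 2 * q) * (1 + 2 * q) by ring.
  by rewrite mulr_gt0//; lra.
have d0' : 1 + disc_p q * xi i 0 o0 != 0 by rewrite gt_eqF.
have [v0 v1 _ _] := vec4E (klein_p k + xi i 0 o0) (klein_b k * xi i 0 o1)
  (klein_b k * xi i 0 o2) (klein_b k * xi i 0 o3).
have zn' : dotv z n = (disc_p q + xi i 0 o0) / (1 + disc_p q * xi i 0 o0).
  by rewrite zn /klein /klein_den mxE v0 kp mulrC.
have ze' : dotv z e = klein_b k * xi i 0 o1 / (1 + disc_p q * xi i 0 o0).
  by rewrite ze /klein /klein_den mxE v1 kp mulrC.
have D : 1 + 4 * q ^+ 2 - 4 * q * dotv z n =
    (1 - 4 * q ^+ 2) ^+ 2 * (1 - q * xi i 0 o0) / (1 + disc_p q * xi i 0 o0).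
  rewrite zn'; move: (xi i 0 o0) d0' => a a0.
  by move: a0; rewrite /disc_p => a0; field.
have D0 : 1 + 4 * q ^+ 2 - 4 * q * dotv z n != 0.
  by rewrite D !mulf_neq0 ?invr_eq0 ?expf_neq0// gt_eqF.
have cp : dotv z n - disc_p q = klein_b k ^+ 2 * xi i 0 o0 / (1 + disc_p q * xi i 0 o0).
  by rewrite zn' klein_bp kp; move: (xi i 0 o0) d0' => a a0; field.
rewrite poisson1_direction// cp D ze' /klein_density /klein_den kp kb /disc_weight.
have r1' : 1 - 4 * q ^+ 2 != 0 by rewrite gt_eqF.
have q1' : 1 - q * xi i 0 o0 != 0 by rewrite gt_eqF.
move: (xi i 0 o0) (xi i 0 o1) (J i) (chord_b q) (disc_p q) d0' r1' q1' => a w j b p h1 h2 h3.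
by field; rewrite h1 h2 h3.
Qed.

End KleinKernel.

(** The witness is the half-angle formula [tan (a / 2) = (1 - cos a) / sin a]. *)
Lemma klein_parameter (p b : R) : 0 < p -> 0 < b -> b ^+ 2 = 1 - p ^+ 2 ->
  exists k, [/\ 0 < k < 1, klein_p k = p & klein_b k = b].
Proof.
move=> p0 b0 bp.
have b1 : b < 1 by rewrite -(@expr_lt1 _ 2) ?(ltW b0)// bp gtrBl exprn_gt0.
have h : 0 < 1 - b by rewrite subr_gt0.
have k2 : 1 + ((1 - b) / p) ^+ 2 = 2 * (1 - b) / p ^+ 2.
  have e : p ^+ 2 = 1 - b ^+ 2 by rewrite bp; ring.
  rewrite expr_div_n -[X in X + _](divff (_ : p ^+ 2 != 0)) ?expf_neq0 ?gt_eqF//.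
  by rewrite -mulrDl {1}e; congr (_ / _); ring.
exists ((1 - b) / p); split.
- rewrite divr_gt0//= ltr_pdivrMr// mul1r -(@ltr_pXn2r _ 2) ?nnegrE ?ltW//.
  have -> : p ^+ 2 = (1 - b) * (1 + b) by rewrite -[p ^+ 2](subKr 1) -bp; ring.
  by rewrite expr2 ltr_pM2l//; lra.
- by rewrite /klein_p k2; field; rewrite !gt_eqF.
- rewrite /klein_b k2 expr_div_n.
  have e : p ^+ 2 = (1 - b) * (1 + b) by rewrite -[p ^+ 2](subKr 1) -bp; ring.
  rewrite e; field; rewrite !gt_eqF//; lra.
Qed.

End GradientKernel.

(** * Sharp constants as means of the Poisson kernel *)

Section SupNorm.
Context {R : realType} {n : nat}.
Local Notation T := 'rV[R]_n.+1.
Implicit Types (U : T -> R) (v : T).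

Lemma eball0 : @eball R n.+1 0.
Proof. by apply/eballE; have /eqP -> : dotv (0 : T) 0 == 0 by rewrite dotv_eq0. Qed.

Lemma le_supnorm U y : bounded_harmonic U -> @eball R n.+1 y -> `|U y| <= supnorm U.
Proof.
move=> [_ [M [_ bU]]] y1; apply: ub_le_sup; last by exists y.
by exists (M + 1) => _ [w w1 <-]; apply: bU => //; rewrite ltrDl.
Qed.

Lemma supnorm_le U M : (forall y, @eball R n.+1 y -> `|U y| <= M) -> supnorm U <= M.
Proof.
move=> UM; apply: ge_sup => [|_ [y y1 <-]]; last exact: UM.
by exists `|U 0|, 0 => //; exact: eball0.
Qed.

Lemma supnorm_ge0 U : bounded_harmonic U -> 0 <= supnorm U.
Proof. by move=> bU; apply: le_trans (le_supnorm bU eball0). Qed.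

Lemma bounded_harmonic1 : bounded_harmonic (fun _ : T => 1 : R).
Proof.
have p0 i a : partial i (fun _ : T => a : R) = fun _ => 0.
  by apply/funext => y; rewrite /partial derive_cst.
split; last by exists 1; split => // M M1 y _ /=; rewrite normr1 ltW.
split=> [|y _]; last first.
  by rewrite /laplacian big1 // => i _; rewrite !p0.
split=> [y _|i]; first exact: cst_continuous.
split=> [y _|]; first exact: derivable_cst.
rewrite p0; split=> [y _|j]; first exact: cst_continuous.
split=> [y _|]; first exact: derivable_cst.
by rewrite p0; split=> // y _; exact: cst_continuous.
Qed.

Lemma supnorm1 : supnorm (fun _ : T => 1 : R) = 1.
Proof.
apply/eqP; rewrite eq_le; apply/andP; split.
  by apply: supnorm_le => y _; rewrite normr1.
by have := le_supnorm bounded_harmonic1 eball0; rewrite normr1.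
Qed.

Lemma dir_grad_bounds_ge0 (x v : T) c : dir_grad_bounds x v c -> 0 <= c.
Proof. by move=> /(_ _ bounded_harmonic1); rewrite supnorm1 mulr1; exact: le_trans. Qed.

Lemma norm_dotv_unit (u v : T) : dotv v v = 1 -> `|dotv u v| <= enorm u.
Proof.
move=> v1; rewrite -(@ler_pXn2r _ 2) ?nnegrE ?enorm_ge0//.
by rewrite real_normK ?num_real// enorm_sqr -[leRHS]mulr1 -v1 cauchy_schwarz.
Qed.

(** The norm of a nonzero gradient is its component along its own direction, which depends on [U]; a
    bound uniform over all directions therefore bounds it. The bounds [c'] need not be sharp, so
    only the direction [e] must have an exact constant. *)
Lemma gradient_constant_max (x e : T) c : dotv e e = 1 -> directional_constant x e c ->
  (forall v, dotv v v = 1 -> exists2 c', dir_grad_bounds x v c' & c' <= c) ->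
  gradient_constant x c.
Proof.
move=> e1 [_ lc] cmax; split=> [U bU|c' c'x]; last first.
  apply: lc => U bU; apply: le_trans (c'x U bU); exact: norm_dotv_unit.
have [g0|g0] := eqVneq (grad U x) 0.
  have [c' c'e c'c] := cmax e e1.
  have c0 := le_trans (dir_grad_bounds_ge0 c'e) c'c.
  rewrite /enorm g0; have /eqP -> : dotv (0 : T) 0 == 0 by rewrite dotv_eq0.
  by rewrite sqrtr0 mulr_ge0// supnorm_ge0.
have gg := dotv_gt0 g0; have ng : 0 < enorm (grad U x) by rewrite sqrtr_gt0.
have [|c' c'v c'c] := cmax ((enorm (grad U x))^-1 *: grad U x).
  by rewrite dotvZl dotvZr mulrA -expr2 exprVn enorm_sqr mulVf// gt_eqF.
apply: le_trans (_ : c' * supnorm U <= _); last by rewrite ler_wpM2r// supnorm_ge0.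
have := c'v U bU; rewrite dotvZr -enorm_sqr expr2 mulrA mulVf ?gt_eqF// mul1r.
by rewrite gtr0_norm.
Qed.

End SupNorm.

(** * The directional constant as the mean of the kernel *)

Section DirectionalConstant.
Context {R : realType} {I : Type} {E : (I -> R) -> R} (mE : is_mean E).
Local Notation T := 'rV[R]_4.
Context {z : I -> T} {J : I -> R}.
Hypothesis z1 : forall i, dotv (z i) (z i) = 1.
Hypothesis J0 : forall i, 0 <= J i.
Hypothesis bJ : bounded_fct J.
Hypothesis mass : forall y, dotv y y < 1 -> E (fun i => poisson (z i) y * J i) = 1.
Variables (x v : T).
Hypothesis x1 : dotv x x < 1.

Definition gradient_kernel (i : I) : R := J i * \sum_j poisson1 (z i) j x * v 0 j.
Local Notation K := gradient_kernel.
Local Notation PI := (@poisson_integral R I E z J).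
Local Notation PI1 := (@poisson_integral1 R I E z J).
Local Notation PI2 := (@poisson_integral2 R I E z J).

Lemma bounded_gradient_kernel : bounded_fct K.
Proof.
apply: boundedM => //; apply: bounded_sum => j.
by apply: boundedM; [exact: (poisson1_bounded z1)|exact: bounded_cst].
Qed.

Lemma poisson_gradient f : bounded_fct f ->
  \sum_j PI1 f j x * v 0 j = E (fun i => K i * f i).
Proof.
move=> bf; have b1 j : bounded_fct (fun i => poisson1 (z i) j x * (J i * f i)).
  by apply: boundedM; [exact: (poisson1_bounded z1)|exact: boundedM].
transitivity (\sum_j E (fun i => v 0 j * (poisson1 (z i) j x * (J i * f i)))).
  by apply: eq_bigr => j _; rewrite (meanZ mE)// mulrC.
rewrite -(mean_sum mE) => [|j]; last by apply: boundedM; [exact: bounded_cst|].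
apply: eq_mean => i; rewrite /gradient_kernel -mulrA mulrCA mulr_suml.
by apply: eq_bigr => j _; ring.
Qed.

Lemma near_ball (P : T -> Prop) (y : T) : (forall w, dotv w w < 1 -> P w) ->
  dotv y y < 1 -> \near y, P y.
Proof. by move=> ball_P y1; apply: filterS (nbhs_ball_sq y1) => w; exact: ball_P. Qed.

Lemma partial_poisson f j y : bounded_fct f -> dotv y y < 1 -> partial j (PI f) y = PI1 f j y.
Proof. by move=> bf y1; exact: (derive_val (is_derive := is_derive_poisson_integral mE z1 bJ bf j y1)). Qed.

(** The formula for [partial j] holds in the open ball only; agreement near the point is what lets
    it be differentiated again. *)
Lemma is_derive_partial_poisson f j l y : bounded_fct f -> dotv y y < 1 ->
  is_derive y (delta_mx 0 l) (partial j (PI f)) (PI2 f j l y).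
Proof.
move=> bf y1; apply: (near_eq_is_derive _ (is_derive_poisson_integral1 mE z1 bJ bf j l y1)).
by apply: near_ball y1 => w w1; rewrite partial_poisson.
Qed.

Lemma near_eq_continuous (f g : T -> R) y : (\near y, f y = g y) ->
  {for y, continuous f} -> {for y, continuous g}.
Proof.
move=> fg cf; have e : f y = g y := nbhs_singleton fg.
rewrite /prop_for /continuous_at -e; apply: cvg_trans cf.
exact: (near_eq_cvg fg).
Qed.

Lemma poisson_bounded_harmonic f : (forall i, `|f i| <= 1) ->
  bounded_harmonic (PI f) /\ supnorm (PI f) <= 1.
Proof.
move=> f1; have bf : bounded_fct f by exists 1.
have le1 y : @eball R 4 y -> `|PI f y| <= 1.
  by move=> /eballE y1; exact: (poisson_integral_le mE z1 J0 bJ mass).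
split; last exact: supnorm_le.
split; last by exists 1; split=> // M M1 y y1 /=; rewrite (le_trans (le1 y y1)) ?ltW.
split=> [|y /eballE y1]; last first.
  rewrite -[RHS](poisson_integral_harmonic mE z1 bJ bf y1); apply: eq_bigr => j _.
  exact: (derive_val (is_derive := is_derive_partial_poisson j j bf y1)).
split=> [y /eballE y1|j]; first exact: (poisson_integral_continuous mE z1 bJ bf y1).
split=> [y /eballE y1|]; first by case: (is_derive_poisson_integral mE z1 bJ bf j y1).
split=> [y /eballE y1|l].
  apply: near_eq_continuous (poisson_integral1_continuous mE z1 bJ bf y1).
  by apply: near_ball y1 => w w1; rewrite partial_poisson.
split=> [y /eballE y1|]; first by case: (is_derive_partial_poisson j l bf y1).
split=> // y /eballE y1.
apply: near_eq_continuous (poisson_integral2_continuous mE z1 bJ bf y1).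
apply: near_ball y1 => w w1.
exact: (esym (derive_val (is_derive := is_derive_partial_poisson j l bf w1))).
Qed.

(** The Poisson integral of the sign of the kernel is a competitor of sup norm at most 1 whose
    derivative is exactly the mean of [|K|]. *)
Lemma dir_grad_bound_lower c : dir_grad_bounds x v c -> E (fun i => `|K i|) <= c.
Proof.
move=> cx; have c0 := dir_grad_bounds_ge0 cx.
pose f i := Num.sg (K i).
have f1 i : `|f i| <= 1 by rewrite normr_sg; case: (_ != _).
have [bU U1] := poisson_bounded_harmonic f1.
apply: (le_trans _ (le_trans (cx _ bU) _)); last by rewrite ler_piMr.
rewrite -[leLHS](_ : dotv (grad (PI f) x) v = _) ?ler_norm//.
have bf : bounded_fct f by exists 1.
transitivity (\sum_j PI1 f j x * v 0 j).
  by apply: eq_bigr => j _; rewrite mxE partial_poisson.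
by rewrite poisson_gradient//; apply: eq_mean => i; rewrite normrEsg mulrC.
Qed.

(** A bounded harmonic function need not extend to the sphere, but its dilate [U (a *: y)] is
    continuous on the closed ball, so the Poisson formula applies to it. *)
Lemma scaled_harmonic_gradient (U : T -> R) (a : R) : bounded_harmonic U -> 0 < a < 1 ->
  `|\sum_j a * partial j U (a *: x) * v 0 j| <= E (fun i => `|K i|) * supnorm U.
Proof.
move=> bU /andP[a0 a1]; have [[[cU dU] hU] _] := bU.
have inb y : dotv y y <= 1 -> @eball R 4 (a *: y).
  move=> y1; apply/eballE; rewrite dotvZl dotvZr mulrA -expr2.
  apply: le_lt_trans (_ : a ^+ 2 < 1); first by rewrite ler_piMr// sqr_ge0.
  by rewrite expr_lt1// ltW.
pose u y := U (a *: y).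
pose u1 j y := a * partial j U (a *: y).
pose u2 j y := a * (a * partial j (partial j U) (a *: y)).
have cu y : dotv y y <= 1 -> {for y, continuous u}.
  move=> y1; apply: (@continuous_comp _ _ _ (fun w : T => a *: w) U).
    exact: scaler_continuous.
  exact: cU (inb y y1).
have d1 (y : T) j : dotv y y < 1 -> is_derive y (delta_mx 0 j) u (u1 j y).
  move=> y1; apply: is_derive_scale; apply: derivableP.
  by have [h _] := dU j; apply: h; exact/inb/ltW.
have d2 (y : T) j : dotv y y < 1 -> is_derive y (delta_mx 0 j) (u1 j) (u2 j y).
  move=> y1; apply: (is_deriveZ a); apply: is_derive_scale; apply: derivableP.
  by have [_ [_ /(_ j)[h _]]] := dU j; apply: h; exact/inb/ltW.
have hu (y : T) : dotv y y < 1 -> \sum_j u2 j y = 0.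
  by move=> y1; rewrite /u2 -!mulr_sumr [\sum_j _]hU ?mulr0//; exact/inb/ltW.
have [bu uE] := poisson_formula mE z1 J0 bJ mass cu d1 d2 hu.
have u1E j : u1 j x = PI1 (fun i => u (z i)) j x.
  have h := is_derive_poisson_integral mE z1 bJ bu j x1.
  rewrite -(derive_val (is_derive := d1 x j x1)).
  rewrite -[RHS](derive_val (is_derive := h)); apply: near_eq_derive.
  exact: near_ball.
under eq_bigr => j _ do rewrite [a * _]u1E.
rewrite poisson_gradient// mulrC -(meanZ mE); last exact/bounded_norm/bounded_gradient_kernel.
apply: (norm_mean_le mE) => [|i].
  by apply: boundedM; [exact: bounded_cst|exact/bounded_norm/bounded_gradient_kernel].
rewrite normrM mulrC ler_wpM2r//; apply: (le_supnorm bU (_ : eball (a *: z i))).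
by apply: inb; rewrite z1.
Qed.

Lemma dir_grad_bound_upper : dir_grad_bounds x v (E (fun i => `|K i|)).
Proof.
move=> U bU; have [[[cU dU] hU] _] := bU.
pose g (a : R) := \sum_j a * partial j U (a *: x) * v 0 j.
have -> : dotv (grad U x) v = g 1.
  by apply: eq_bigr => j _; rewrite mxE scale1r mul1r.
(* The bound is independent of [a]; continuity of the first partial derivatives at [x] lets the
   dilation tend to the identity. *)
have cg : g a @[a --> 1^'-] --> g 1.
  apply: cvg_at_left_filter; apply: cvg_sum_ord => j.
  apply: cvgM; last exact: cvg_cst.
  apply: cvgM; first exact: cvg_id.
  apply: (@continuous_comp _ _ _ (fun a : R => a *: x) (partial j U) 1).
    by apply: cvgZr_tmp; exact: cvg_id.
  by rewrite scale1r; have [_ [h _]] := dU j; apply: h; exact/eballE.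
apply: (closed_cvg (fun t => t <= _) _ _ _ (cvg_norm cg)).
  exact: closed_le.
near=> a; apply: scaled_harmonic_gradient => //; apply/andP; split.
  near: a; exact: nbhs_left_gt.
near: a; exact: nbhs_left_lt.
Unshelve. all: by end_near. Qed.

Lemma directional_constant_mean : directional_constant x v (E (fun i => `|K i|)).
Proof. by split; [exact: dir_grad_bound_upper|exact: dir_grad_bound_lower]. Qed.

End DirectionalConstant.

(** * Comparison of the directions *)

Section SharpConstant.
Context {R : realType}.
Local Notation T := 'rV[R]_4.
Variables (n : T) (q : R).
Hypothesis n1 : dotv n n = 1.
Hypothesis q01 : 0 < q < 1 / 2.

Local Notation xi := (@hopf R (ellipse_cos q) (ellipse_sin q)).
Local Notation dens := (@hopf_density R (ellipse_speed q)).
Local Notation weight := (@hopf_weight R (ellipse_speed q)).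
Local Notation b := (chord_b q).
Local Notation x := ((2 * q) *: n).
Let circ := ellipse_circle q01.

Let r1 : 0 < 1 - 4 * q ^+ 2.
Proof.
have /andP[h0 h1] := q01.
have -> : 1 - 4 * q ^+ 2 = (1 - 2 * q) * (1 + 2 * q) by ring.
by rewrite mulr_gt0//; lra.
Qed.

Let x1 : dotv x x < 1.
Proof.
rewrite dotvZl dotvZr n1 mulr1 -subr_gt0.
by have -> : 1 - 2 * q * (2 * q) = 1 - 4 * q ^+ 2 by ring.
Qed.

Definition disc_kernel (c s : R) (i : unitI R * (unitI R * unitI R)) : R :=
  weight i * (`|c * b * xi i 0 o0 + s * xi i 0 o1| * disc_weight q (xi i 0 o0)).

(** The constant from [klein_poisson1], divided by the total Hopf weight. It does not depend on the
    direction, so comparing constants amounts to comparing means. *)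
Definition disc_scale : R :=
  4 * b ^+ 4 / (1 - 4 * q ^+ 2) / triple_mean weight.

Let scale_ge0 : 0 <= disc_scale.
Proof.
rewrite divr_ge0 ?(ltW (hopf_total_gt0 circ))// divr_ge0 ?(ltW r1)// mulr_ge0//.
by rewrite exprn_ge0// (ltW (chord_b_gt0 q01)).
Qed.

Let xi_le1 i : `|xi i 0 o0| <= 1 /\ `|xi i 0 o1| <= 1.
Proof.
have h := hopf_unit circ i; move: h; rewrite dotv4 -!expr2 => h.
move: (sqr_ge0 (xi i 0 o0)) (sqr_ge0 (xi i 0 o1)) (sqr_ge0 (xi i 0 o2)) (sqr_ge0 (xi i 0 o3)).
move: h => /[swap] h0 /[swap] h1 /[swap] h2 /[swap] h3.
by split; rewrite -(@expr_le1 _ 2)// real_normK ?num_real//; lra.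
Qed.

Let bounded_disc_kernel c s : bounded_fct (disc_kernel c s).
Proof.
have [M WM] := disc_weight_bound q01.
apply: boundedM; first exact: (bounded_hopf_weight circ).
apply: boundedM; last by exists M => i; apply: WM; have [] := xi_le1 i.
apply/bounded_norm/boundedD; apply: boundedM; try exact: bounded_cst.
  by exists 1 => i; have [] := xi_le1 i.
by exists 1 => i; have [] := xi_le1 i.
Qed.

(** The sphere is parametrised by Hopf coordinates, followed by the automorphism and by an isometry
    taking the first two axes to [n] and [e]. The isometry changes with [e], yet the resulting mean
    involves only [c] and [s], which makes all directions comparable. *)
Lemma directional_constant_disc (e : T) (c s : R) : dotv e e = 1 -> dotv n e = 0 ->
  directional_constant x (c *: n + s *: e) (disc_scale * triple_mean (disc_kernel c s)).
Proof.
move=> ee ne; have [A [A' [iA An Ae]]] := exists_frame n1 ee ne.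
have [adj sq sq'] := iA.
have /andP[p0 p1] := disc_p_bounds q01.
have b0 := chord_b_gt0 q01.
have [k [k01 kp kb]] : exists k, [/\ 0 < k < 1, klein_p k = disc_p q &
    klein_b k = b * (1 - 4 * q ^+ 2)].
  apply: klein_parameter => //; first by rewrite mulr_gt0.
  (* This is [sin ^+ 2 + cos ^+ 2 = 1] for the tripled angle. *)
  by rewrite exprMn chord_b_sqr// /disc_p; ring.
have u1 := hopf_unit circ; have d0 := hopf_density_ge0 circ.
have bd := bounded_hopf_density circ; have hm := hopf_mass circ.
have mE := @triple_mean_is_mean R.
pose z i := A (@klein R _ xi k i); pose J := @klein_density R _ xi dens k.
have z1 i : dotv (z i) (z i) = 1 by rewrite sq (klein_unit u1 k01).
have J0 i : 0 <= J i := klein_density_ge0 u1 d0 k01 i.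
have bJ : bounded_fct J := bounded_klein_density u1 bd k01.
have mass y : dotv y y < 1 -> triple_mean (fun i => poisson (z i) y * J i) = 1.
  move=> y1; have y1' : dotv (A' y) (A' y) < 1 by rewrite sq'.
  have <- := klein_mass mE u1 d0 bd hm k01 y1'.
  by apply: eq_mean => i; rewrite (poisson_isometry (@klein R _ xi k i) y iA).
have -> : disc_scale * triple_mean (disc_kernel c s) =
    triple_mean (fun i => `|@gradient_kernel R _ z J x (c *: n + s *: e) i|).
  rewrite -(meanZ mE)//; apply: eq_mean => i.
  rewrite /gradient_kernel (klein_poisson1 u1 q01 k01 kp kb _ _ (z1 i) n1 ne (An _) (Ae _)).
  have [l1 _] := xi_le1 i; have [w0 w1] := disc_weight_den_gt0 q01 l1.
  have W0 : 0 <= disc_weight q (xi i 0 o0).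
    by rewrite invr_ge0 mulr_ge0 ?exprn_ge0 ?(ltW w0) ?(ltW w1).
  have C0 : 0 <= 4 * b ^+ 4 / (1 - 4 * q ^+ 2).
    by rewrite divr_ge0 ?(ltW r1)// mulr_ge0// exprn_ge0// ltW.
  rewrite normrM (ger0_norm C0) normrM (ger0_norm (d0 i)) normrM (ger0_norm W0).
  rewrite /disc_scale /disc_kernel /hopf_density.
  move: (`|_|) (disc_weight _ _) (weight i) (4 * b ^+ 4 / _) ((triple_mean weight)^-1).
  by move=> *; ring.
exact: (directional_constant_mean mE z1 J0 bJ mass _ x1).
Qed.

Lemma gradient_constant_radial : exists c,
  gradient_constant x c /\ directional_constant x n c.
Proof.
have [e ee ne] := exists_orthogonal n1.
have dn : directional_constant x n (disc_scale * triple_mean (disc_kernel 1 0)).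
  have := directional_constant_disc 1 0 ee ne.
  by rewrite scale1r scale0r addr0.
exists (disc_scale * triple_mean (disc_kernel 1 0)); split; last exact: dn.
apply: (gradient_constant_max n1 dn) => v v1.
have [e' [c [s [ee' ne' cs ->]]]] := direction_decomposition n1 v1.
have [h _] := directional_constant_disc c s ee' ne'.
exists (disc_scale * triple_mean (disc_kernel c s)); first exact: h.
exact: (ler_wpM2l scale_ge0 (disc_inequality q01 cs)).
Qed.

End SharpConstant.

Theorem theorem1p2 (R : realType) (x : 'rV[R]_4) (hx : @eball R 4 x)
    (hx0 : x <> 0) :
  exists c : R,
    gradient_constant x c /\ directional_constant x (radial_dir x) c.
Proof.
have xx : 0 < dotv x x by apply: dotv_gt0; exact/eqP.
have r0 : 0 < enorm x by rewrite sqrtr_gt0.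
have n1 : dotv (radial_dir x) (radial_dir x) = 1.
  by rewrite dotvZl dotvZr mulrA -expr2 exprVn enorm_sqr mulVf// gt_eqF.
(* Halving the radius gives the parameter [q], for which [x] is [2 * q] times its radial
   direction. *)
have q01 : 0 < enorm x / 2 < 1 / 2 by move: hx; rewrite /eball /= => h; lra.
have := gradient_constant_radial n1 q01.
have -> : 2 * (enorm x / 2) = enorm x by field.
by rewrite /radial_dir scalerA divff ?scale1r// gt_eqF.
Qed.
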